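(* Let $F=P_{\ell_1}\cup\cdots\cup P_{\ell_k}$ be a linear forest with $k\ge 2$, $\ell_1\ge\cdots\ge\ell_k\ge 2$ and $\ell_i\ne 3$ for all $i$. Let $G$ be an $F$-free connected graph on $n\ge 2|F|$ vertices with minimum degree $\delta(G)\ge\delta_F$. Then $G$ is isomorphic to a subgraph of $G_F(n)$, unless one of the following holds (with $\ell\ge2$ an integer and $t,t_1,t_2$ nonnegative integers): (1) $F\in\{P_{\ell+1}\cup P_\ell,\ 2P_\ell\}$ with $\ell$ even, or $F\in\{P_{\ell+2}\cup P_\ell,\ P_{\ell+1}\cup P_\ell,\ 2P_\ell\cup P_2\}$ with $\ell$ odd, and $G=K_1+tK_{\ell-1}$; (2) $F=2P_\ell$ with $\ell$ odd, and $G$ is isomorphic to a subgraph of $K_1+(t_1K_{\ell-1}\cup t_2K_{\ell-2})$; (3) $F=3P_5$ and $G=K_2+tK_4$ or $G=E_2+tK_4$.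
   Context: $P_m$, $K_m$, $E_m$: path, complete graph, edgeless graph on $m$ vertices; $G\cup H$ disjoint union; $tG$ is $t$ disjoint copies of $G$; $G+H$ is the join (all edges between $V(G)$ and $V(H)$ added to $G\cup H$). $|F|=\sum\ell_i$ and $\delta_F=\sum_{i=1}^k\lfloor \ell_i/2\rfloor-1$. $G_F(n)=K_{\delta_F}+E_{n-\delta_F}$ if some $\ell_i$ is even, and $G_F(n)=K_{\delta_F}+(E_{n-\delta_F-2}\cup K_2)$ if all $\ell_i$ are odd. $F$-free means containing no subgraph isomorphic to $F$. *)

(* Defs.v *)
From mathcomp Require Import all_boot.
Set Implicit Arguments. Unset Strict Implicit. Unset Printing Implicit Defensive.

Record sgraph := SGraph { vert : finType; adj : rel vert }.

Definition simple (G : sgraph) : Prop :=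
  symmetric (@adj G) /\ irreflexive (@adj G).

Definition Kg (m : nat) : sgraph := @SGraph 'I_m (fun i j => i != j).
Definition Eg (m : nat) : sgraph := @SGraph 'I_m (fun _ _ => false).
Definition Pg (m : nat) : sgraph :=
  @SGraph 'I_m (fun i j => ((val i).+1 == val j) || ((val j).+1 == val i)).

Definition gunion (G H : sgraph) : sgraph :=
  @SGraph (vert G + vert H)%type
    (fun x y => match x, y with
                | inl a, inl b => adj a b
                | inr a, inr b => adj a b
                | _, _ => false end).

Definition gjoin (G H : sgraph) : sgraph :=
  @SGraph (vert G + vert H)%type
    (fun x y => match x, y with
                | inl a, inl b => adj a b
                | inr a, inr b => adj a b
                | _, _ => true end).

Definition copies (t : nat) (G : sgraph) : sgraph :=
  @SGraph (vert G * 'I_t)%type (fun x y => (x.2 == y.2) && adj x.1 y.1).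

Definition subgraph (H G : sgraph) : Prop :=
  exists f : vert H -> vert G,
    injective f /\ forall x y, adj x y -> adj (f x) (f y).

Definition isomorphic (G H : sgraph) : Prop :=
  exists f : vert G -> vert H,
    bijective f /\ forall x y, adj x y = adj (f x) (f y).

Definition Ffree (F G : sgraph) : Prop := ~ subgraph F G.

Definition gconnected (G : sgraph) : Prop :=
  forall x y : vert G, connect (@adj G) x y.

Definition deg (G : sgraph) (x : vert G) : nat := #|[set y | adj x y]|.

Definition min_deg_ge (G : sgraph) (d : nat) : Prop :=
  forall x : vert G, d <= deg x.

Definition linear_forest (ls : seq nat) : sgraph :=
  foldr (fun l H => gunion (Pg l) H) (Eg 0) ls.

Definition forest_size (ls : seq nat) : nat := sumn ls.

Definition deltaF (ls : seq nat) : nat := (sumn (map (fun l => l./2) ls)).-1.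

Definition GF (ls : seq nat) (n : nat) : sgraph :=
  if has (fun l => ~~ odd l) ls
  then gjoin (Kg (deltaF ls)) (Eg (n - deltaF ls))
  else gjoin (Kg (deltaF ls)) (gunion (Eg (n - deltaF ls - 2)) (Kg 2)).

(* Main.v *)
Require Import Defs.
From mathcomp Require Import all_boot zify.
Set Implicit Arguments. Unset Strict Implicit. Unset Printing Implicit Defensive.

(** Write k for the sum of the l_i./2, so that d = deltaF ls = k - 1, and let P be a longest path
    of G; Dirac's argument gives |P| >= 2d + 1.

    Suppose first that some longest path P leaves an edge of G outside, and let Q be a path outside
    P that cannot be extended outside P, with 2 <= |Q|. Counting the gaps between the
    neighbours on P of the two ends of Q shows that |Q| < d is only possible for d <= 5, where
    P and Q contain F unless F = 3P_5. Hence |Q| >= d, and F is packed into the disjoint paths P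
    and Q (of at least 2k - 1 and k - 1 vertices) except when F is 5P_5 or one of the forests of
    (1) and (2); there, the components outside P hang on a single vertex of P, and exchanging
    them with segments of P determines G.

    Otherwise the complement of every longest path is independent. A greedy procedure cuts the
    components of F off P, completing odd ones by outside vertices; when it fails, the outside
    vertices left over have exactly d neighbours, among which no gap is longer than two. A rerouting
    argument then shows that all of them have the same neighbourhood A. Since |A| = d, an edge of
    G - A (if F has an even component), or two edges (if it has none), would yield a copy of F. *)

(** * Disjoint paths, cycles and Dirac's bound *)

(** With o odd components |F| = 2k + o, whereas Dirac's bound yields only 2k - 1 vertices on P: the
    deficit to overcome is o + 1. Excluding l_i = 3 makes every odd component contribute at least 2
    to k, so 2o <= k. With this, the gap count for q = |Q| and c common neighbours of the ends of Q
    becomes (2c - 3)(2q - 3) <= 5, which has five relevant solutions. Packing F into P and Q means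
    finding a group of components with more than o and at most k - 1 vertices for Q; 2o <= k is also
    why so few forests admit no such group. When the complement of P is independent, n >= 2|F|
    leaves more than 2k outside vertices even after o of them have been spent. Threading F through A
    and these vertices costs half of each component, rounded down, in A: k vertices in total, and
    |A| = k - 1. So any configuration off A that saves a single vertex of A produces F; an edge
    saves one for an even component, while odd components need a path on three vertices or two
    disjoint edges. *)

Lemma uniq_count_le (T : eqType) (L M : seq T) :
  uniq M -> (forall x, count_mem x L <= count_mem x M) -> uniq L.
Proof.
move=> uM le; apply: count_mem_uniq => x.
case: (boolP (x \in L)) => xL; last by apply/eqP; rewrite -leqn0 leqNgt -has_count has_pred1.
have := le x; have : 0 < count_mem x L by rewrite -has_count has_pred1.
by rewrite (count_uniq_mem _ uM); case: (x \in M) => /=; lia.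
Qed.

(** Every rerouted path consists of rearranged pieces of a list already known to be duplicate-free,
    so its uniqueness reduces to a linear inequality between multiplicities. *)
Ltac ucount U := apply: (uniq_count_le U) => ?; clear;
  rewrite -?cats1; do 7 rewrite /= ?(count_cat, count_rev, cats0); lia.

Lemma split_first (T : Type) (c : pred T) s : has c s ->
  exists m y t, [/\ s = m ++ y :: t, ~~ has c m & c y].
Proof.
elim: s => //= x s IH; case cx: (c x) => /= h; first by exists [::], x, s.
by have [m [y [t [-> nm cy]]]] := IH h; exists (x :: m), y, t; rewrite /= cx.
Qed.

Lemma split_last (T : Type) (c : pred T) s : has c s ->
  exists m y t, [/\ s = m ++ y :: t, ~~ has c t & c y].
Proof.
elim: s => //= x s IH; case hs: (has c s).
  by move=> _; have [m [y [t [-> nm cy]]]] := IH hs; exists (x :: m), y, t.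
by rewrite orbF => cx; exists [::], x, s; rewrite hs.
Qed.

Lemma perm_map_size (T : eqType) (ss : seq (seq T)) ls :
  perm_eq (map size ss) ls -> exists ss', perm_eq ss ss' /\ map size ss' = ls.
Proof.
elim: ls ss => [|l ls IH] ss.
  by move/perm_size; case: ss => // _; exists [::].
move=> pe.
have: l \in map size ss by rewrite (perm_mem pe) mem_head.
case/mapP => s sin ls_s.
have pe' : perm_eq ss (s :: rem s ss) by apply: perm_to_rem.
have : perm_eq (map size (rem s ss)) ls.
  by rewrite -(perm_cons l) {1}ls_s; apply: perm_trans pe; rewrite perm_sym; apply: (perm_map size pe').
case/IH => ss' [p1 p2]; exists (s :: ss'); split; last by rewrite /= p2 ls_s.
by apply: perm_trans pe' _; rewrite perm_cons.
Qed.

Lemma perm_flatten_count (T : eqType) (ss ss' : seq (seq T)) :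
  perm_eq ss ss' -> perm_eq (flatten ss) (flatten ss').
Proof.
move=> pe; apply/permP => x; rewrite !count_flatten; apply: perm_sumn; exact: perm_map.
Qed.

Section Paths.
Variables (T : finType) (e : rel T).
Hypotheses (esym : symmetric e) (eirr : irreflexive e).

(* [Fin ls]: disjoint paths whose numbers of vertices are, up to order, the entries of [ls]. *)
Definition Fin (ls : seq nat) : Prop := exists ss : seq (seq T),
  [/\ perm_eq (map size ss) ls, all (sorted e) ss & uniq (flatten ss)].

Definition pth (s : seq T) := uniq s && sorted e s.

(** The edge condition at the seam of a concatenation. It is vacuous when one side is empty, so that
    [sorted_cat] holds without side conditions. *)
Definition lk (s1 s2 : seq T) :=
  match s1, s2 with x :: s1', y :: _ => e (last x s1') y | _, _ => true end.

Lemma sorted_cat s1 s2 :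
  sorted e (s1 ++ s2) = [&& sorted e s1, sorted e s2 & lk s1 s2].
Proof.
case: s1 => [|x s1] /=; first by rewrite andbT.
case: s2 => [|y s2] /=; first by rewrite cats0 andbT.
by rewrite cat_path /=; congr andb; rewrite andbC.
Qed.

Lemma lk_rcons s1 x s2 : lk (rcons s1 x) s2 = if s2 is y :: _ then e x y else true.
Proof. by case: s1 => [|z s1] /=; case: s2 => //= y s2; rewrite ?last_rcons. Qed.

Lemma sorted_rev s : sorted e (rev s) = sorted e s.
Proof. by rewrite rev_sorted; apply: eq_sorted => x y; rewrite esym. Qed.

Lemma lk_cons s1 x s2 s2' : lk s1 (x :: s2) = lk s1 (x :: s2').
Proof. by case: s1. Qed.

Lemma pth_rev s : pth (rev s) = pth s.
Proof. by rewrite /pth rev_uniq sorted_rev. Qed.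

Lemma split_sorted (ls : seq nat) (s : seq T) : sorted e s -> sumn ls <= size s ->
  exists ss, [/\ map size ss = ls, all (sorted e) ss & forall x, count_mem x (flatten ss) <= count_mem x s].
Proof.
elim: ls s => [|l ls IH] s /=; first by exists [::].
move=> srt sz.
have := srt; rewrite -{1}(cat_take_drop l s) sorted_cat => /and3P[s1 s2 _].
have := IH (drop l s) s2; rewrite size_drop; case; first by lia.
move=> ss [m a c]; exists (take l s :: ss); split => /=; rewrite ?m ?s1 //.
  by congr cons; rewrite size_take; case: ltnP => //; lia.
move=> x; rewrite count_cat -{2}(cat_take_drop l s) count_cat leq_add2l; exact: c.
Qed.

(** A path can be cut into consecutive segments of any prescribed orders that fit in total, so only
    the sum of each group matters; surplus vertices are dropped. *)
Lemma Fin_bins (ls : seq nat) (bins : seq (seq T)) (parts : seq (seq nat)) :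
  uniq (flatten bins) -> all (sorted e) bins -> perm_eq (flatten parts) ls ->
  all2 (fun p b => sumn p <= size b) parts bins -> Fin ls.
Proof.
move=> ub ab pe a2.
suff [ss [m a c]]: exists ss, [/\ map size ss = flatten parts, all (sorted e) ss
    & forall x, count_mem x (flatten ss) <= count_mem x (flatten bins)].
  exists ss; split => //; first by rewrite m.
  exact: uniq_count_le ub c.
elim: parts bins ab {ub pe} a2 => [|p parts IH] [|b bins] //=; first by exists [::].
case/andP => sb ab /andP[sp a2].
have [ss [m a c]] := IH _ ab a2.
have [ss' [m' a' c']] := split_sorted sb sp.
exists (ss' ++ ss); split; rewrite ?map_cat ?m ?m' ?all_cat ?a ?a' //.
by move=> x; rewrite flatten_cat !count_cat; apply: leq_add.
Qed.

Lemma Fin1 ls s : pth s -> sumn ls <= size s -> Fin ls.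
Proof.
case/andP => u srt sz; apply: (@Fin_bins ls [:: s] [:: ls]) => //=; rewrite ?cats0 ?srt ?andbT //.
Qed.

Lemma Fin2 ls xs ys s t : sorted e s -> sorted e t -> uniq (s ++ t) -> perm_eq (xs ++ ys) ls ->
  sumn xs <= size s -> sumn ys <= size t -> Fin ls.
Proof.
move=> ss st u pe h1 h2; apply: (@Fin_bins ls [:: s; t] [:: xs; ys]) => //=; rewrite ?cats0 ?ss ?st ?h1 ?h2 //.
Qed.

Lemma Fin3 ls xs ys zs s t r : sorted e s -> sorted e t -> sorted e r ->
  uniq (s ++ t ++ r) -> perm_eq (xs ++ ys ++ zs) ls ->
  sumn xs <= size s -> sumn ys <= size t -> sumn zs <= size r -> Fin ls.
Proof.
move=> ss st sr u pe h1 h2 h3; apply: (@Fin_bins ls [:: s; t; r] [:: xs; ys; zs]) => //=; rewrite ?cats0 ?ss ?st ?sr ?h1 ?h2 ?h3 //.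
Qed.

(** A duplicate-free list has at most [#|T|] entries, so the possible lengths are bounded;
    quantifying over tuples makes the existence of a list of given length boolean. *)
Lemma ex_longest (pr : pred (seq T)) : (exists2 s, uniq s & pr s) ->
  exists s, [/\ uniq s, pr s & forall s', uniq s' -> pr s' -> size s' <= size s].
Proof.
move=> [s0 u0 p0].
pose Q n := [exists t : n.-tuple T, uniq t && pr t].
have QP s : uniq s -> pr s -> Q (size s).
  by move=> u p; apply/existsP; exists (in_tuple s); rewrite /= u p.
have ub n : Q n -> n <= #|T|.
  by case/existsP => t /andP[u _]; rewrite -(size_tuple t) -(card_uniqP u) max_card.
have exQ : exists n, Q n by exists (size s0); apply: QP.
case: (ex_maxnP exQ ub) => n /existsP[t /andP[ut pt]] mx.
exists t; split=> // s' u' p'; rewrite size_tuple; apply: mx; exact: QP.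
Qed.

(** Pigeonhole on the [size t] consecutive pairs of [x :: t]: a pair is charged once if [a] holds at
    its right entry and once if [b] holds at its left one. *)
Lemma cycle_split (a b : pred T) x t : size t < count a t + count b (belast x t) ->
  exists P1 y z P2, [/\ x :: t = rcons P1 y ++ z :: P2, b y & a z].
Proof.
elim: t x => [|y t IH] x //=.
case: (boolP (a y && b x)) => [/andP[ay bx]|nab] h.
  by exists [::], x, y, t.
have [|P1 [u [v [P2 [-> bu av]]]]] := IH y; first by lia.
by exists (x :: P1), u, v, P2.
Qed.

(* Two adjacent positions of the path, the left one joined to its last vertex and the
   right one to its first vertex, close it into a cycle. *)
Lemma path_to_cycle x t : uniq (x :: t) -> path e x t ->
  size t < count (e x) (x :: t) + count (e (last x t)) (x :: t) ->
  exists c, cycle e c /\ perm_eq c (x :: t).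
Proof.
move=> u p h.
have [|P1 [y [z [P2 [E ey ez]]]]] := @cycle_split (e x) (e (last x t)) x t.
  move: h; rewrite {2}(lastI x t) -cats1 count_cat /= !eirr; lia.
have sP : sorted e (rcons P1 y ++ z :: P2) by rewrite -E.
have hx : x = head x (rcons P1 y) by case: (P1) E => [|? ?] [].
have hl : last x t = last z P2.
  by have := congr1 (last x) E; rewrite /= last_cat.
exists (rcons P1 y ++ rev (z :: P2)); split; last first.
  by rewrite E perm_cat2l perm_rev.
move: sP; rewrite sorted_cat lk_rcons => /and3P[s1 s2 _].
have : sorted e (rcons P1 y ++ rev (z :: P2)).
  rewrite sorted_cat s1 sorted_rev s2 /= lk_rcons (lastI z P2) rev_rcons -hl esym; exact: ey.
have {s1 E ey h} [c' ->] : exists c', rcons P1 y ++ rev (z :: P2) = x :: rcons c' z.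
  rewrite rev_cons; case: P1 hx {s1 E} => [|x1 P1] /= ->; first by exists (rev P2).
  by exists (rcons P1 y ++ rev P2); rewrite rcons_cat.
by move=> /= s; rewrite rcons_path s last_rcons esym.
Qed.

Lemma cycle_head c y : cycle e c -> uniq c -> y \in c ->
  exists s, pth (y :: s) /\ perm_eq (y :: s) c.
Proof.
move=> cc uc yc; case: (rot_to yc) => i s E; exists s.
have : cycle e (y :: s) by rewrite -E rot_cycle.
rewrite /= rcons_path /pth /= => /andP[-> _].
rewrite -[(y \notin s) && uniq s]/(uniq (y :: s)) -E rot_uniq uc; split=> //.
by rewrite perm_rot.
Qed.

(** Connectedness as the absence of a proper nonempty closed subset of [S]. It is applied wherever a
    vertex set has just been shown to be closed under adjacency. *)
Definition conn (S : {set T}) := forall X : {set T}, X \subset S -> X != set0 ->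
  (forall x y, x \in X -> y \in S -> e x y -> y \in X) -> X = S.

Definition isin (S : {set T}) (s : seq T) := all (mem S) s.

Definition lpath (Y : {set T}) (s : seq T) :=
  [/\ pth s, isin Y s & forall s', pth s' -> isin Y s' -> size s' <= size s].

Lemma ex_lpath Y : exists s, lpath Y s.
Proof.
have [|s [us /andP[ss si] mx]] := @ex_longest (fun s => sorted e s && isin Y s).
  by exists [::].
exists s; split; rewrite /pth ?us ?ss //.
by move=> s' /andP[u' s'']  i'; apply: mx; rewrite ?s''.
Qed.

Lemma isinP (Y : {set T}) s : reflect {subset s <= Y} (isin Y s).
Proof. exact: allP. Qed.

Lemma lpath_nbr Y x t z : lpath Y (x :: t) -> z \in Y -> e x z -> z \in x :: t.
Proof.
move=> [/andP[u p] i mx] zY xz; apply: contraT => nz.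
suff : size (z :: x :: t) <= size (x :: t) by rewrite ltnn.
apply: mx; last by rewrite /isin /= zY.
by rewrite /pth (cons_uniq z) nz u /= esym xz.
Qed.

Lemma lpath_rev Y s : lpath Y s -> lpath Y (rev s).
Proof.
move=> [p i mx]; split; rewrite ?pth_rev ?size_rev //.
by rewrite /isin all_rev.
Qed.

Lemma lpath_perm Y s s' : lpath Y s -> pth s' -> perm_eq s' s -> lpath Y s'.
Proof.
move=> [p i mx] p' pe; split=> //; last by rewrite (perm_size pe).
by rewrite /isin (perm_all _ pe).
Qed.

(** The degree condition closes the path into a cycle, which can be opened at any vertex. So every
    vertex starts a longest path on the same vertex set and has no neighbour in [Y] off it. *)
Lemma lpath_closed Y x t : lpath Y (x :: t) ->
  size (x :: t) <= count (e x) (x :: t) + count (e (last x t)) (x :: t) ->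
  (forall y, y \in x :: t -> exists s, lpath Y (y :: s) /\ perm_eq (y :: s) (x :: t)) /\
  (forall y z, y \in x :: t -> z \in Y -> e y z -> z \in x :: t).
Proof.
move=> L h; have [/andP[u p] i mx] := L.
have [c [cc pc]] := path_to_cycle u p h.
have uc : uniq c by rewrite (perm_uniq pc).
have H1 : forall y, y \in x :: t -> exists s, lpath Y (y :: s) /\ perm_eq (y :: s) (x :: t).
  move=> y; rewrite -(perm_mem pc) => yc.
  have [s [ps pe]] := cycle_head cc uc yc.
  have pe' := perm_trans pe pc.
  by exists s; split=> //; apply: lpath_perm L ps pe'.
split=> // y z yin zY yz.
have [s [Ls pe]] := H1 _ yin.
rewrite -(perm_mem pe); exact: lpath_nbr Ls zY yz.
Qed.

Lemma count_card (S : {set T}) (x : T) s : uniq s ->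
  (forall y, y \in S -> e x y -> y \in s) -> #|[set y in S | e x y]| <= count (e x) s.
Proof.
move=> us h; rewrite -size_filter -(card_uniqP (filter_uniq _ us)).
by apply: subset_leq_card; apply/subsetP => y; rewrite inE mem_filter => /andP[yS xy]; rewrite xy h.
Qed.

(** The neighbours in [S] of both ends lie on the path. Were the path too short, their number would
    close it into a cycle, so its vertex set would be closed and hence equal to [S], against its
    being smaller. *)
Lemma dirac_path (S : {set T}) d : conn S ->
  (forall x, x \in S -> d <= #|[set y in S | e x y]|) ->
  forall s, lpath S s -> minn #|S| d.*2.+1 <= size s.
Proof.
move=> cS dS s L; have [/andP[us ps] i mx] := L.
have [->|/set0Pn[x0 x0S]] := eqVneq S set0; first by rewrite cards0 min0n.
case: s us ps i mx L => [|x t] us ps i mx L.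
  by have := mx [:: x0] isT; rewrite /isin /= x0S => /(_ isT).
rewrite leqNgt; apply/negP; rewrite leq_min => /andP[h1 h2].
have iS : {subset x :: t <= S} by apply/isinP.
have Lr := lpath_rev L.
have c1 : d <= count (e x) (x :: t).
  apply: leq_trans (dS _ (iS _ (mem_head _ _))) _; apply: count_card => // y yS xy.
  exact: lpath_nbr L yS xy.
have c2 : d <= count (e (last x t)) (x :: t).
  apply: leq_trans (dS _ (iS _ (mem_last _ _))) _; apply: count_card => // y yS xy.
  rewrite -mem_rev; move: Lr; rewrite lastI rev_rcons => Lr; exact: lpath_nbr Lr yS xy.
have [|_ cl] := lpath_closed L; first by lia.
pose X := [set y in x :: t].
have XS : X = S.
  apply: cS; first by apply/subsetP => y; rewrite inE => /iS.
    by apply/set0Pn; exists x; rewrite inE mem_head.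
  by move=> y z; rewrite !inE => yX zS yz; apply: cl yX zS yz.
by move: h1; rewrite -XS cardsE (card_uniqP us) ltnn.
Qed.
End Paths.

Lemma subgraph_of_Fin (G : sgraph) ls : simple G ->
  Fin (@adj G) ls -> subgraph (linear_forest ls) G.
Proof.
move=> [sG iG] [ss0 [pe a0 u0]].
have [ss [p1 <-]] := perm_map_size pe.
have u : uniq (flatten ss) by rewrite -(perm_uniq (perm_flatten_count p1)).
have a : all (sorted (@adj G)) ss by rewrite -(perm_all _ p1).
suff [f [fi fe _]] : exists f : vert (linear_forest (map size ss)) -> vert G,
  [/\ injective f, forall x y, adj x y -> adj (f x) (f y) & forall x, f x \in flatten ss].
  by exists f.
elim: ss u a {pe a0 u0 p1 ss0} => [|s ss IH] /=.
  by move=> _ _; exists (fun x : 'I_0 => False_rect _ (notF (ltn_ord x))); split; case.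
rewrite cat_uniq => /and3P[us dis u] /andP[ps a].
have [f [fi fe fin]] := IH u a.
pose g (x : 'I_(size s) + vert (linear_forest (map size ss))) :=
  match x with inl i => tnth (in_tuple s) i | inr y => f y end.
have gs i : g (inl i) \in s by rewrite /g; apply: (mem_tnth i (in_tuple s)).
have nx i y : g (inl i) <> f y.
  by move=> E; move/hasP: dis; apply; exists (f y) => //=; rewrite -E.
have ge (i j : 'I_(size s)) : i.+1 = j -> adj (g (inl i)) (g (inl j)).
  move=> ij; have [x0 _] : exists x0 : vert G, True by exists (tnth (in_tuple s) i).
  rewrite /g !(tnth_nth x0) /= -ij.
  by move/(sortedP x0): ps; apply; rewrite ij.
exists g; split.
- move=> [i|x] [j|y] //=; last 1 first.
  + by move/fi=> ->.
  + have [x0 _] : exists x0 : vert G, True by exists (tnth (in_tuple s) i).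
    rewrite !(tnth_nth x0) /= => E; congr inl; apply/val_inj.
    by apply/eqP; rewrite -(nth_uniq x0 (ltn_ord i) (ltn_ord j) us) E.
  + by move/nx.
  + by move/esym/nx.
- move=> [i|x] [j|y] //=; last exact: fe.
  by case/orP=> /eqP; [exact: ge|move/ge; rewrite sG].
- by move=> [i|x] /=; rewrite mem_cat ?gs ?fin ?orbT.
Qed.

(* [s] starts at a vertex satisfying [a] or [b]; charge to every such vertex the vertices up
   to the next one. *)
Lemma gap_weight (T : Type) (a b : pred T) q x s : 0 < q ->
  (forall s1 y m z s2, x :: s = s1 ++ y :: m ++ z :: s2 ->
     ((a y && b z) || (b y && a z) -> q <= size m) /\
     ((a y || b y) && (a z || b z) -> 0 < size m)) ->
  (forall s1 y s2, x :: s = s1 ++ y :: s2 -> a y || b y -> q <= size s2) ->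
  a x || b x ->
  exists c a0 b0, [/\ count (predI a b) (x :: s) = c, count a (x :: s) = c + a0,
    count b (x :: s) = c + b0 &
    [/\ c * q.+1 + (a0 + b0).*2 <= (size s).+1,
      0 < a0 + b0 -> c * q.+1 + (a0 + b0).*2 + q.-1 <= (size s).+1 &
      c = 0 -> 0 < a0 -> 0 < b0 -> (a0 + b0).*2 + q.-1 + q.-1 <= (size s).+1]].
Proof.
move=> q0; elim: {s}(size s).+1 {-2}s x (leqnn (size s).+1) => // n IH s x szn.
move=> H1 H2 abx.
case: (boolP (has (predU a b) s)) => [hs|]; last first.
  rewrite has_predU negb_or => /andP[ha hb] /=.
  have ca : count a s = 0 by apply/eqP; rewrite -leqn0 leqNgt -has_count.
  have cb : count b s = 0 by apply/eqP; rewrite -leqn0 leqNgt -has_count.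
  have cab : count (predI a b) s = 0.
    by apply/eqP; rewrite -leqn0 -ca; apply: sub_count => y /andP[].
  have := H2 [::] x s erefl abx; rewrite ca cb cab /= !addn0.
  move: (size s) => S; case: (a x) abx => /= [_|->]; [case: (b x)|] => /= qS.
  - by exists 1, 0, 0; split=> //; split; lia.
  - by exists 0, 1, 0; split=> //; split; lia.
  - by exists 0, 0, 1; split=> //; split; lia.
have [m [y [t [E nm aby]]]] := split_first hs; rewrite /= in aby.
have {nm} [ca cb] : count a m = 0 /\ count b m = 0.
  move: nm; rewrite has_predU negb_or => /andP[ha hb].
  by split; apply/eqP; rewrite -leqn0 leqNgt -has_count.
have cab : count (predI a b) m = 0.
  by apply/eqP; rewrite -leqn0 -ca; apply: sub_count => z /andP[].
have := IH t y _ _ _ aby; case.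
- by move: szn; rewrite E size_cat /=; lia.
- move=> s1 u m' v s2 Et; apply: (H1 (x :: m ++ s1) u m' v s2).
  by rewrite E Et /= -catA.
- move=> s1 u s2 Et; apply: (H2 (x :: m ++ s1) u s2).
  by rewrite E Et /= -catA.
have [M1 M2] := H1 [::] x m y t (congr1 (cons x) E).
have {}M2 : 0 < size m by apply: M2; rewrite abx.
move=> c [a0 [b0 [Ec Ea Eb [B1 B2 B3]]]].
have cE p : count p (x :: s) = p x + count p m + count p (y :: t).
  by rewrite E /= count_cat /= addnA.
have st : size s = size m + (size t).+1 by rewrite E size_cat.
rewrite !cE Ec Ea Eb ca cb cab !addn0 st /=.
have yc : (a y && b y) -> 0 < c by move=> h; rewrite -Ec /= h.
have ya : a y -> 0 < c + a0 by move=> h; rewrite -Ea /= h.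
have yb : b y -> 0 < c + b0 by move=> h; rewrite -Eb /= h.
have yao : a y -> b y = false -> 0 < a0.
  move=> h1 h2; move: Ec Ea; rewrite /= h1 h2 /=.
  by have := @sub_count _ (predI a b) a (fun z => @proj1 _ _ \o andP) t; lia.
have ybo : b y -> a y = false -> 0 < b0.
  move=> h1 h2; move: Ec Eb; rewrite /= h1 h2 /=.
  by have := @sub_count _ (predI a b) b (fun z => @proj2 _ _ \o andP) t; lia.
rewrite /= in B1 B2 B3.
move: (size t) B1 B2 B3 (size m) M1 M2 => S B1 B2 B3 M M1 M2.
move: (c * q.+1) (mulSn c q.+1) B1 B2 B3 => K KS B1 B2 B3.
case ax : (a x) abx M1 => /= abx M1; [case bx: (b x) M1 => /= M1|].
- have qM : q <= M by apply: M1; rewrite orbC.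
  by exists c.+1, a0, b0; rewrite KS; split=> //; split; lia.
- exists c, a0.+1, b0; rewrite addnS; split=> //; rewrite ?orbF in M1.
  case by_: (b y) in M1 yb.
  + by have := M1 isT; have := yb isT; split; lia.
  + have ay: a y by move: aby; rewrite by_ orbF.
    by have := yao ay by_; split; lia.
- rewrite abx /= in M1 *.
  exists c, a0, b0.+1; rewrite addnS; split=> //.
  case ay: (a y) in M1 ya.
  + by have := M1 isT; have := ya isT; split; lia.
  + have by_: b y by move: aby; rewrite ay.
    by have := ybo by_ ay; split; lia.
Qed.

(** * Vertices attached to a longest path *)

(** The charging of [gap_weight] plus an initial block of [q] vertices before the first marked one.
    In the application [q] is the order of an outside path, [a] and [b] are adjacency to its two
    ends, [c] counts common and [a0], [b0] private neighbours. A common neighbour costs q + 1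
    vertices, a private one 2; a run of private neighbours of one end closes with a long gap, worth
    q - 1 more. *)
Lemma gap_weight_list (T : Type) (a b : pred T) q s : 0 < q ->
  (forall s1 y m z s2, s = s1 ++ y :: m ++ z :: s2 ->
     ((a y && b z) || (b y && a z) -> q <= size m) /\
     ((a y || b y) && (a z || b z) -> 0 < size m)) ->
  (forall s1 y s2, s = s1 ++ y :: s2 -> a y || b y -> q <= size s1 /\ q <= size s2) ->
  exists c a0 b0, [/\ count (predI a b) s = c, count a s = c + a0, count b s = c + b0 &
    0 < c + a0 + b0 ->
    [/\ q + c * q.+1 + (a0 + b0).*2 <= size s,
      0 < a0 + b0 -> q + c * q.+1 + (a0 + b0).*2 + q.-1 <= size s &
      c = 0 -> 0 < a0 -> 0 < b0 -> q + (a0 + b0).*2 + q.-1 + q.-1 <= size s]].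
Proof.
move=> q0 H1 H2; case: (boolP (has (predU a b) s)) => [hs|]; last first.
  rewrite has_predU negb_or => /andP[ha hb].
  have ca : count a s = 0 by apply/eqP; rewrite -leqn0 leqNgt -has_count.
  have cb : count b s = 0 by apply/eqP; rewrite -leqn0 leqNgt -has_count.
  have cab : count (predI a b) s = 0.
    by apply/eqP; rewrite -leqn0 -ca; apply: sub_count => y /andP[].
  by exists 0, 0, 0.
have [m [x [t [E nm abx]]]] := split_first hs; rewrite /= in abx.
have {nm} [ca cb] : count a m = 0 /\ count b m = 0.
  move: nm; rewrite has_predU negb_or => /andP[ha hb].
  by split; apply/eqP; rewrite -leqn0 leqNgt -has_count.
have cab : count (predI a b) m = 0.
  by apply/eqP; rewrite -leqn0 -ca; apply: sub_count => z /andP[].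
have [qm _] := H2 _ _ _ E abx.
have [||c [a0 [b0 [Ec Ea Eb [B1 B2 B3]]]]] := @gap_weight T a b q x t q0 _ _ abx.
- by move=> s1 u m' v s2 Et; apply: (H1 (m ++ s1) u m' v s2); rewrite E Et -catA.
- by move=> s1 u s2 Et h; case: (H2 (m ++ s1) u s2 _ h) => //; rewrite E Et -catA.
exists c, a0, b0; rewrite E !count_cat ca cb cab Ec Ea Eb size_cat /=; split=> // _.
by split; lia.
Qed.

Lemma spor_arith d q o p c a0 b0 : 2 <= q -> q < d -> o.*2 <= d.+1 -> p <= d.*2.+1 + o ->
  d < q + c + a0 -> d < q + c + b0 ->
  [/\ q + c * q.+1 + (a0 + b0).*2 <= p,
      0 < a0 + b0 -> q + c * q.+1 + (a0 + b0).*2 + q.-1 <= p &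
      c = 0 -> 0 < a0 -> 0 < b0 -> q + (a0 + b0).*2 + q.-1 + q.-1 <= p] ->
  a0 = 0 /\ b0 = 0 /\ (d = 3 /\ q = 2 /\ c = 2 \/ d = 4 /\ q = 3 /\ c = 2 \/
     d = 4 /\ q = 2 /\ c = 3 \/ d = 5 /\ q = 4 /\ c = 2 \/ d = 5 /\ q = 2 /\ c = 4).
Proof.
move=> q2 qd od pd ha hb [B1 B2 B3].
(* A private neighbour forces at least one more long gap, which the upper bound on [p] does not
   allow. *)
have z : a0 + b0 = 0.
  apply/eqP; rewrite -leqn0 leqNgt; apply/negP => pos; move/(_ pos): B2 => B2 {B1}.
  case: c => [|c] in ha hb B2 B3 *; first by have := B3 erefl; lia.
  case: (leqP d (q + c)) => h.
    have : 2 * q <= c.+1 * q.+1 + 0 by nia.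
    by nia.
  by nia.
have [-> ->] : a0 = 0 /\ b0 = 0 by lia.
split=> //; split=> //.
have {B2 B3} B1 : q + c * q.+1 <= p by lia.
have c2 : 2 <= c by lia.
(* Eliminating [d], [o] and [p] gives (2c - 3)(2q - 3) <= 5, here in expanded form; with both
   variables at least 2 only five pairs remain. *)
have key : 2 * (c * q) + 2 <= 3 * c + 3 * q by nia.
have prod (x y : nat) : 2 <= x -> 5 <= y -> 3 * x + 3 * y < 2 * (x * y) + 2.
  by move=> hx hy; rewrite -(subnK hx) -(subnK hy); nia.
have q4 : q <= 4 by rewrite leqNgt; apply/negP => h; have := prod c q c2 h; lia.
have c4 : c <= 4 by rewrite leqNgt; apply/negP => h; have := prod q c q2 h; move: key; rewrite (mulnC q); lia.
have : (q == 2) || (q == 3) || (q == 4) by lia.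
have : (c == 2) || (c == 3) || (c == 4) by lia.
case/orP=> [/orP[]|] /eqP ?; case/orP=> [/orP[]|] /eqP ?; subst q c; lia.
Qed.

Section Long.
Variables (T : finType) (e : rel T).
Hypotheses (esym : symmetric e) (eirr : irreflexive e).
Notation lpath := (lpath e).
Notation pth := (pth e).

Lemma sorted_pivot s1 a s2 :
  sorted e (s1 ++ a :: s2) = sorted e (rcons s1 a) && sorted e (a :: s2).
Proof. exact: sorted_cat_cons. Qed.

Lemma isinT (s : seq T) : isin [set: T] s.
Proof. by apply/isinP => x; rewrite inE. Qed.

Lemma lpath_max P s : lpath [set: T] P -> pth s -> size s <= size P.
Proof. by move=> [_ _ mx] ps; apply: mx => //; apply: isinT. Qed.

Lemma longest_lpath P s : lpath [set: T] P -> pth s -> size P <= size s -> lpath [set: T] s.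
Proof.
move=> L ps sz; split=> //; first exact: isinT.
by move=> s' p' _; apply: leq_trans sz; apply: lpath_max L p'.
Qed.

(** Replacing either side of P at [a] by the outside path gives another path, which cannot be longer
    than P. *)
Lemma attach_ends P x t s1 a s2 : lpath [set: T] P -> pth (x :: t) -> uniq (P ++ x :: t) ->
  P = s1 ++ a :: s2 -> e a x -> size (x :: t) <= size s1 /\ size (x :: t) <= size s2.
Proof.
move=> L /andP[_ sQ] u E ax; have [/andP[_ sP] _ _] := L.
move: sP; rewrite E sorted_pivot => /andP[S1 S2].
split.
- have := @lpath_max P (rev (x :: t) ++ a :: s2) L.
  rewrite /pth E !size_cat size_rev /= ltn_add2r; apply.
  rewrite E in u; apply/andP; split; first by ucount u.
  by rewrite sorted_pivot S2 andbT -rev_cons sorted_rev //= ax.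
- have := @lpath_max P (s1 ++ a :: x :: t) L.
  rewrite /pth E !size_cat /= leq_add2l ltnS; apply.
  rewrite E in u; apply/andP; split; first by ucount u.
  by rewrite sorted_pivot S1 /= ax.
Qed.

(** Splicing the outside path in place of [m] gives a path, so [m] is at least as long. The second
    disjunct is the same argument for the reversed outside path. *)
Lemma attach_between P x t s1 a m b s2 : lpath [set: T] P -> pth (x :: t) ->
  uniq (P ++ x :: t) -> P = s1 ++ a :: m ++ b :: s2 ->
  e a x && e b (last x t) || e a (last x t) && e b x -> size (x :: t) <= size m.
Proof.
have W x' t' : lpath [set: T] P -> pth (x' :: t') -> uniq (P ++ x' :: t') ->
  P = s1 ++ a :: m ++ b :: s2 -> e a x' && e b (last x' t') -> size (x' :: t') <= size m.
  move=> L /andP[_ sQ] u E /andP[ax bw]; have [/andP[_ sP] _ _] := L.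
  move: sP; rewrite E sorted_pivot -cat_cons sorted_pivot => /and3P[S1 _ Sb].
  have := @lpath_max P (s1 ++ a :: (x' :: t') ++ b :: s2) L.
  rewrite /pth E !size_cat /= !size_cat /= => h.
  suff : size s1 + (size t' + (size s2).+1).+2 <= size s1 + (size m + (size s2).+1).+1 by lia.
  apply: h; rewrite E in u; apply/andP; split; first by ucount u.
  rewrite sorted_pivot S1 /= cat_path ax /=; move: sQ Sb => /= -> ->.
  by rewrite esym bw.
move=> L pQ u E /orP[|h]; first exact: W.
have := W (last x t) (rev (belast x t)) L.
have Er : last x t :: rev (belast x t) = rev (x :: t) by rewrite (lastI x t) rev_rcons.
rewrite Er pth_rev // size_rev; apply=> //; first by rewrite -(perm_uniq (s1 := P ++ x :: t)) // perm_cat2l perm_sym perm_rev.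
rewrite andbC; case/andP: h => h1 h2; rewrite h1 andbT.
suff -> : last (last x t) (rev (belast x t)) = x by [].
have : last x (rev (x :: t)) = x by rewrite rev_cons last_rcons.
by rewrite -Er.
Qed.

Lemma single_between P x s1 a b s2 : lpath [set: T] P -> x \notin P ->
  P = s1 ++ a :: b :: s2 -> e x a -> e x b -> False.
Proof.
move=> L xP E ax bx; have [/andP[uP _] _ _] := L.
have := @attach_between P x [::] s1 a [::] b s2 L isT _ E; rewrite /= !(esym _ x) ax bx ltnn => h.
suff : false by []. by apply: h => //; rewrite cat_uniq uP /= orbF xP.
Qed.

(** These are the gap hypotheses of [gap_weight_list]. Two neighbours of the same end allow only a
    single vertex to be inserted, whence the weaker second bound. *)
Lemma outside_gaps P x t : lpath [set: T] P -> pth (x :: t) -> uniq (P ++ x :: t) ->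
  forall s1 y m z s2, P = s1 ++ y :: m ++ z :: s2 ->
     ((e x y && e (last x t) z) || (e (last x t) y && e x z) -> size (x :: t) <= size m) /\
     ((e x y || e (last x t) y) && (e x z || e (last x t) z) -> 0 < size m).
Proof.
move=> L pQ u s1 y m z s2 E.
have B : (e x y && e (last x t) z) || (e (last x t) y && e x z) -> size (x :: t) <= size m.
  by move=> h; apply: (attach_between L pQ u E); rewrite !(esym y) !(esym z).
split=> // h; case: (boolP ((e x y && e (last x t) z) || (e (last x t) y && e x z))) => [/B|n].
  exact: leq_trans.
have xP : forall v, v \in x :: t -> v \notin P.
  move=> v vQ; move: u; rewrite cat_uniq => /and3P[_ /hasPn hn _]; exact: hn.
case: m E B n h => // E B n h.
have [] : (e x y /\ e x z) \/ (e (last x t) y /\ e (last x t) z).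
- by move: n h; do 4 case: (e _ _) => //=; auto.
- by case=> *; case: (single_between L (xP x (mem_head _ _)) E).
- by case=> *; case: (single_between L (xP _ (mem_last _ _)) E).
Qed.

Lemma outside_ends P x t : lpath [set: T] P -> pth (x :: t) -> uniq (P ++ x :: t) ->
  forall s1 y s2, P = s1 ++ y :: s2 -> e x y || e (last x t) y ->
  size (x :: t) <= size s1 /\ size (x :: t) <= size s2.
Proof.
move=> L pQ u s1 y s2 E /orP[] h.
  by apply: (attach_ends L pQ u E); rewrite esym.
have Er : last x t :: rev (belast x t) = rev (x :: t) by rewrite (lastI x t) rev_rcons.
have := @attach_ends P (last x t) (rev (belast x t)) s1 y s2 L.
rewrite Er pth_rev // size_rev => W; apply: (W pQ _ E); last by rewrite esym.
by rewrite -(perm_uniq (s1 := P ++ x :: t)) // perm_cat2l perm_sym perm_rev.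
Qed.

Lemma outside_weight P x t : lpath [set: T] P -> pth (x :: t) -> uniq (P ++ x :: t) ->
  exists c a0 b0, [/\ count (predI (e x) (e (last x t))) P = c, count (e x) P = c + a0,
    count (e (last x t)) P = c + b0 & let q := size (x :: t) in
    0 < c + a0 + b0 ->
    [/\ q + c * q.+1 + (a0 + b0).*2 <= size P,
      0 < a0 + b0 -> q + c * q.+1 + (a0 + b0).*2 + q.-1 <= size P &
      c = 0 -> 0 < a0 -> 0 < b0 -> q + (a0 + b0).*2 + q.-1 + q.-1 <= size P]].
Proof.
move=> L pQ u; apply: gap_weight_list => //.
- exact: outside_gaps.
- exact: outside_ends.
Qed.

End Long.

(** * Half sums of forests and the small exceptional forests *)

Definition okl l := (2 <= l) && (l != 3).
Definition hsum (ls : seq nat) := sumn (map half ls).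

Lemma forest_sizeE ls : sumn ls = (hsum ls).*2 + count odd ls.
Proof.
by elim: ls => //= l ls ->; rewrite /hsum /=; have := odd_double_half l; case: (odd l) => /=; lia.
Qed.

(** An odd component has at least five vertices since 3 is excluded, so it contributes at least 2 to
    the half sum. *)
Lemma odd_le_hsum ls : all okl ls -> (count odd ls).*2 <= hsum ls.
Proof.
elim: ls => //= l ls IH /andP[/andP[h2 h3] /IH]; rewrite /hsum /=.
by have := odd_double_half l; case: (odd l) => /=; lia.
Qed.

Lemma size_le_hsum ls : all okl ls -> size ls <= hsum ls.
Proof.
by elim: ls => //= l ls IH /andP[/andP[h2 h3] /IH]; rewrite /hsum /=; lia.
Qed.

Lemma small4 ls : 1 < size ls -> sorted geq ls -> all okl ls -> hsum ls = 4 -> 9 <= sumn ls ->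
  ls = [:: 7; 2] \/ ls = [:: 5; 4] \/ ls = [:: 5; 5] \/ ls = [:: 5; 2; 2].
Proof.
move=> sz so al h s; have := size_le_hsum al; rewrite h.
move: sz so al h s; rewrite /hsum /okl.
case: ls => [|a [|b [|c [|x [|y ls]]]]] //=; rewrite ?andbT ?addn0.
- move=> _ so /andP[/andP[a2 a3] /andP[b2 b3]] h s _.
  have : a = 7 /\ b = 2 \/ a = 5 /\ b = 4 \/ a = 5 /\ b = 5 by lia.
  by case=> [[-> ->]|[[-> ->]|[-> ->]]]; auto.
- move=> _ so /and3P[/andP[a2 a3] /andP[b2 b3] /andP[c2 c3]] h s _.
  have : a = 5 /\ b = 2 /\ c = 2 by lia.
  by case=> -> [-> ->]; auto.
- by move=> _ so /and4P[/andP[a2 a3] /andP[b2 b3] /andP[c2 c3] /andP[x2 x3]] h s _; lia.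
Qed.

Lemma small5 ls : 1 < size ls -> sorted geq ls -> all okl ls -> hsum ls = 5 -> 12 <= sumn ls ->
  ls = [:: 7; 5] \/ ls = [:: 5; 5; 2].
Proof.
move=> sz so al h s; have := odd_le_hsum al; have := size_le_hsum al.
have := forest_sizeE ls; rewrite h => E.
move: sz so al h s E; rewrite /hsum /okl.
case: ls => [|a [|b [|c [|x ls]]]] //=; rewrite ?andbT ?addn0.
- move=> _ so /andP[/andP[a2 a3] /andP[b2 b3]] h s _ _ _.
  have : a = 7 /\ b = 5 by lia.
  by case=> -> ->; auto.
- move=> _ so /and3P[/andP[a2 a3] /andP[b2 b3] /andP[c2 c3]] h s _ _ _.
  have : a = 5 /\ b = 5 /\ c = 2 by lia.
  by case=> -> [-> ->]; auto.
- move=> _ so /and5P[/andP[a2 a3] /andP[b2 b3] /andP[c2 c3] /andP[x2 x3] al] h s E _ o2.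
  have := @forest_sizeE ls; have := odd_le_hsum al; rewrite /hsum; lia.
Qed.

Lemma small6 ls : 1 < size ls -> sorted geq ls -> all okl ls -> hsum ls = 6 -> 15 <= sumn ls ->
  ls = [:: 5; 5; 5].
Proof.
move=> sz so al h s; have := odd_le_hsum al; have := size_le_hsum al.
have := forest_sizeE ls; rewrite h => E.
move: sz so al h s E; rewrite /hsum /okl.
case: ls => [|a [|b [|c [|x ls]]]] //=; rewrite ?andbT ?addn0.
- move=> _ so /andP[/andP[a2 a3] /andP[b2 b3]] h s _ _ _; lia.
- move=> _ so /and3P[/andP[a2 a3] /andP[b2 b3] /andP[c2 c3]] h s _ _ _.
  have : a = 5 /\ b = 5 /\ c = 5 by lia.
  by case=> -> [-> ->]; auto.
- move=> _ so /and5P[/andP[a2 a3] /andP[b2 b3] /andP[c2 c3] /andP[x2 x3] al] h s E _ o2.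
  have := @forest_sizeE ls; have := odd_le_hsum al; rewrite /hsum; lia.
Qed.

(** The hypotheses of the theorem for a relation on a finite type: [conn] is connectedness by closed
    sets, [~ Fin e ls] is F-freeness, and [(hsum ls).-1] is [deltaF ls]. *)
Record setting (T : finType) (e : rel T) (ls : seq nat) : Prop := Setting {
  g_sym : symmetric e;
  g_irr : irreflexive e;
  g_size : 1 < size ls;
  g_sorted : sorted geq ls;
  g_ok : all okl ls;
  g_card : 2 * sumn ls <= #|T|;
  g_conn : conn e [set: T];
  g_free : ~ Fin e ls;
  g_deg : forall x, (hsum ls).-1 <= #|[set y | e x y]| }.

Section SmallOutsidePaths.
Variables (T : finType) (e : rel T) (ls : seq nat).
Hypothesis H : setting e ls.
Let esym : symmetric e := g_sym H.
Let eirr : irreflexive e := g_irr H.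
Let lsz : 1 < size ls := g_size H.
Let lso : sorted geq ls := g_sorted H.
Let lal : all okl ls := g_ok H.
Let nT : 2 * sumn ls <= #|T| := g_card H.
Let cT : conn e [set: T] := g_conn H.
Let nF : ~ Fin e ls := g_free H.
Let dT : forall x, (hsum ls).-1 <= #|[set y | e x y]| := g_deg H.
Local Notation d := (hsum ls).-1.
Local Notation o := (count odd ls).
Local Notation lpathT := (lpath e [set: T]).

Lemma hsum_gt1 : 1 < hsum ls.
Proof. exact: leq_trans lsz (size_le_hsum lal). Qed.

Lemma longest_lt P : pth e P -> size P < sumn ls.
Proof. by move=> pP; rewrite ltnNge; apply/negP => h; apply: nF; apply: Fin1 pP h. Qed.

Lemma longest_ge P : lpathT P -> d.*2.+1 <= size P.
Proof.
move=> L; have dS x : x \in [set: T] -> d <= #|[set y in [set: T] | e x y]|.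
  move=> _; apply: leq_trans (dT x) _; apply/subset_leq_card/subsetP => y.
  by rewrite !inE.
have := dirac_path esym eirr cT dS L.
have [pP _ _] := L; have := longest_lt pP; rewrite cardsT.
have := nT; have := hsum_gt1; have := forest_sizeE ls; lia.
Qed.

Lemma longest_le P : pth e P -> size P <= d.*2.+1 + o.
Proof. by move/longest_lt; have := forest_sizeE ls; have := hsum_gt1; lia. Qed.

Lemma od_le : o.*2 <= d.+1.
Proof. by have := odd_le_hsum lal; have := hsum_gt1; lia. Qed.

Lemma deg_count x s : uniq s -> (forall y, e x y -> y \in s) -> d <= count (e x) s.
Proof.
move=> us h; apply: leq_trans (dT x) _.
have := @count_card T e [set: T] x s us (fun y _ => h y); apply: leq_trans.
by apply/subset_leq_card/subsetP => y; rewrite !inE.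
Qed.

Lemma deg_split P x t : uniq (P ++ x :: t) -> (forall y, e x y -> y \notin P -> y \in x :: t) ->
  d <= count (e x) P + count (e x) (x :: t) /\ count (e x) (x :: t) <= size t.
Proof.
move=> u h; split; last by rewrite /= eirr add0n count_size.
rewrite -count_cat; apply: deg_count => // y xy; rewrite mem_cat.
by case: (boolP (y \in P)) => //= yP; apply: h.
Qed.

(* [x :: t] cannot be extended by vertices outside [P]. *)
Definition stuck P x t := [/\ pth e (x :: t), uniq (P ++ x :: t),
  (forall y, e x y -> y \notin P -> y \in x :: t) &
  (forall y, e (last x t) y -> y \notin P -> y \in x :: t)].

Lemma stuck_rev P x t : stuck P x t -> stuck P (last x t) (rev (belast x t)).
Proof.
have Er : last x t :: rev (belast x t) = rev (x :: t) by rewrite (lastI x t) rev_rcons.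
have El : last (last x t) (rev (belast x t)) = x.
  have : last x (rev (x :: t)) = x by rewrite rev_cons last_rcons.
  by rewrite -Er.
move=> [p u h1 h2]; split; rewrite ?Er ?El.
- by rewrite pth_rev.
- by rewrite -(perm_uniq (s1 := P ++ x :: t)) // perm_cat2l perm_sym perm_rev.
- by move=> y; rewrite mem_rev; apply: h2.
- by move=> y; rewrite mem_rev; apply: h1.
Qed.

Lemma deg_stuck P x t : stuck P x t ->
  d <= count (e x) P + size t /\ d <= count (e (last x t)) P + size t.
Proof.
move=> S; have S' := stuck_rev S.
have [_ u h _] := S; have [_ u' h' _] := S'.
have [a b] := deg_split u h; have [a' b'] := deg_split u' h'.
rewrite size_rev size_belast in b'.
by split; [apply: leq_trans a _ | apply: leq_trans a' _]; rewrite leq_add2l.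
Qed.

Lemma outside_small_arith P x t : lpathT P -> stuck P x t -> 0 < size t -> (size t).+1 < d ->
  exists2 c, [/\ count (predI (e x) (e (last x t))) P = c, count (e x) P = c,
    count (e (last x t)) P = c & c * (size t).+2 + (size t).+1 <= size P] &
  let q := (size t).+1 in
  (d = 3 /\ q = 2 /\ c = 2 \/ d = 4 /\ q = 3 /\ c = 2 \/
     d = 4 /\ q = 2 /\ c = 3 \/ d = 5 /\ q = 4 /\ c = 2 \/ d = 5 /\ q = 2 /\ c = 4).
Proof.
move=> L S q1 qd; have [pQ u _ _] := S; have [d1 d2] := deg_stuck S.
have [c [a0 [b0 [Ec Ea Eb W]]]] := outside_weight esym L pQ u.
rewrite /= in W; rewrite Ea in d1; rewrite Eb in d2.
have [pP _ _] := L.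
have h1 : d < (size t).+1 + c + a0 by lia.
have h2 : d < (size t).+1 + c + b0 by lia.
have {}W : 0 < c + a0 + b0 -> _ := W.
have {}W := W ltac:(lia).
have [za [zb HH]] := spor_arith (q1 : 2 <= (size t).+1) qd od_le (longest_le pP) h1 h2 W.
subst a0 b0; rewrite !addn0 in Ea Eb.
by exists c => //; split=> //; case: W => W _ _; lia.
Qed.

Lemma last_hub P x t c : lpathT P -> stuck P x t -> 0 < c ->
  count (predI (e x) (e (last x t))) P = c -> count (e x) P = c -> count (e (last x t)) P = c ->
  exists pre b s2, [/\ P = pre ++ b :: s2, e x b, e (last x t) b,
    count (e x) pre = c.-1 &
    [/\ c * (size t).+2 <= (size pre).+1, size t < size s2,
      {in P, e x =1 e (last x t)} & {in s2, forall y, ~~ e x y}]].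
Proof.
move=> L [pQ u _ _] c0 Cab Ca Cb.
have eqb : {in P, e x =1 e (last x t)}.
  have ii (a b : pred T) s : count (predI a b) s = count a s -> {in s, forall y, a y -> b y}.
    elim: s => //= y s IH h z; rewrite inE => /orP[/eqP->{z}|zs].
      have := @sub_count _ (predI a b) a (fun z => @proj1 _ _ \o andP) s.
      by move: h; case: (a y) => //=; case: (b y) => //=; lia.
    apply: IH zs; have := @sub_count _ (predI a b) a (fun z => @proj1 _ _ \o andP) s.
    by move: h; case: (a y) => //=; case: (b y) => //=; lia.
  move=> y yP; apply/idP/idP.
    by apply: (ii _ _ P _ y yP); rewrite Cab.
  apply: (ii (e (last x t)) (e x) P _ y yP); rewrite Cb -Cab.
  by apply: eq_count => z /=; rewrite andbC.
have : has (e x) P by rewrite has_count Ca.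
case/split_last => pre [b [s2 [E ns xb]]].
have bP : b \in P by rewrite E mem_cat mem_head orbT.
have wb : e (last x t) b by rewrite -eqb.
have cs2 : count (e x) s2 = 0 by apply/eqP; rewrite -leqn0 leqNgt -has_count.
have cpre : count (e x) pre = c.-1.
  by move: Ca; rewrite E count_cat /= xb cs2; lia.
have [_ qs2] := outside_ends esym L pQ u E (introT orP (or_introl xb)).
have cab : count (predI (e x) (e (last x t))) pre = c.-1.
  rewrite -cpre; apply: eq_in_count => y yp /=; rewrite eqb ?andbb //.
  by rewrite E mem_cat yp.
exists pre, b, s2; split=> //; split=> //; last by move=> y ys; apply: contra ns => xy; apply/hasP; exists y.
have [|||c' [a0 [b0 [Ec _ _ W]]]] := @gap_weight_list T (e x) (e (last x t)) (size (x :: t)) pre.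
- by [].
- move=> s1 y m z s2' E'; apply: (outside_gaps esym L pQ u (s1 := s1) (s2 := s2' ++ b :: s2)).
  by rewrite E E' /= -!catA /= -catA.
- move=> s1 y s2' E' h.
  have EP : P = s1 ++ y :: s2' ++ b :: s2 by rewrite E E' -catA.
  split; first by have [] := outside_ends esym L pQ u EP h.
  have [W _] := outside_gaps esym L pQ u EP; apply: W.
  by rewrite xb wb !andbT; case/orP: h => ->; rewrite ?orbT.
have E1 : c' = c.-1 by rewrite -Ec cab.
case: c c0 Cab Ca Cb cpre cab E1 => // c _ _ _ _ _ _ /= E1.
(* For c = 1 the prefix contains no neighbour, so the gap count is silent and the end condition at
   [b] gives its length. *)
case: c E1 => [|c] E1.
  have [] := outside_ends esym L pQ u E (introT orP (or_introl xb)) => /= h _; lia.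
have [|W1 _ _] := W; first by lia.
by rewrite E1 in W1; rewrite mulSn /= in W1 *; lia.
Qed.

(** In every numerical solution the forest fits into the two paths of [last_hub] or into P and Q.
    The exception is 5, 5, 5 with q = 4 and c = 2: both paths of [last_hub] are only known to have 9
    vertices, one short of two components, and |P| is squeezed between 14 and 14. *)
Lemma outside_small P x t : lpathT P -> stuck P x t -> 0 < size t -> (size t).+1 < d ->
  [/\ ls = [:: 5; 5; 5], size t = 3, size P = 14,
    count (e x) P = 2 & {in P, e x =1 e (last x t)}].
Proof.
move=> L S q1 qd; have [c [Cab Ca Cb pge] HH] := outside_small_arith L S q1 qd.
have c0 : 0 < c by move: HH => /=; lia.
have [pre [b [s2 [E xb wb cpre [W qs2 eqb _]]]]] := last_hub L S c0 Cab Ca Cb.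
have [pQ u _ _] := S; have [pP _ _] := L.
have pl := longest_lt pP.
have [ /andP[uP sP] /andP[uQ sQ]] := (pP, pQ).
have spre : sorted e pre by move: sP; rewrite E sorted_cat => /and3P[].
have sQb : sorted e ((x :: t) ++ b :: s2).
  rewrite /= cat_path /=; move: sQ => /= ->; rewrite wb.
  by move: sP; rewrite E sorted_pivot => /andP[].
have sz : size P = size pre + (size s2).+1 by rewrite E size_cat.
have uu : uniq (pre ++ (x :: t) ++ b :: s2) by rewrite E in u; ucount u.
have bins xs ys : perm_eq (xs ++ ys) ls -> sumn xs <= size pre ->
    sumn ys <= (size t + size s2).+2 -> False.
  move=> pe h1 h2; apply: nF; apply: (Fin2 spre sQb uu pe h1).
  by rewrite size_cat /= addnS.
have hd : hsum ls = d.+1 by move: hsum_gt1; clear; case: (hsum ls).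
have {}qs2 : (size t).*2.+3 <= (size t + size s2).+2.
  by move: qs2; clear; rewrite -addnn !ltnS -addnS leq_add2l.
have big : c * (size t).+2 + (size t).+2 <= sumn ls by apply: leq_trans pl; rewrite addnS ltnS.
have {}W : (c * (size t).+2).-1 <= size pre by move: W; case: (c * _).
have {}bins n1 n2 xs ys : sumn xs <= n1 -> sumn ys <= n2 -> n1 <= size pre ->
    n2 <= (size t + size s2).+2 -> perm_eq (xs ++ ys) ls -> False.
  by move=> h1 h2 h3 h4 pe; apply: (bins xs ys pe); [exact: leq_trans h3|exact: leq_trans h4].
case: HH => [[Ed [[St] Ec]]|[[Ed [[St] Ec]]|[[Ed [[St] Ec]]|[[Ed [[St] Ec]]|[Ed [[St] Ec]]]]]];
  rewrite Ed in hd; rewrite Ec St in W big pge; rewrite St in qs2 bins.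
- exfalso; case: (small4 lsz lso lal hd big) => [El|[El|[El|El]]].
  (* Here [pre] is only known to have 5 vertices, but P itself has at least 2 * 3 + 2 = 8, and Q has
     2. *)
  + apply: nF; rewrite El; apply: (Fin2 sP sQ u (xs := [:: 7]) (ys := [:: 2])) => //=.
    by rewrite ?St //; apply: leq_trans pge.
  + by apply: (bins _ _ [:: 5] [:: 4] _ _ W qs2); rewrite ?El.
  + by apply: (bins _ _ [:: 5] [:: 5] _ _ W qs2); rewrite ?El.
  + by apply: (bins _ _ [:: 5] [:: 2; 2] _ _ W qs2); rewrite ?El.
- exfalso; case: (small5 lsz lso lal hd big) => El.
  + by apply: (bins _ _ [:: 7] [:: 5] _ _ W qs2); rewrite ?El.
  + by apply: (bins _ _ [:: 5; 2] [:: 5] _ _ W qs2); rewrite ?El.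
- exfalso; case: (small5 lsz lso lal hd big) => El.
  + by apply: (bins _ _ [:: 7] [:: 5] _ _ W qs2); rewrite ?El.
  + by apply: (bins _ _ [:: 5; 2] [:: 5] _ _ W qs2); rewrite ?El.
- have El : ls = [:: 5; 5; 5] by apply: small6.
  split=> //; last by rewrite Ca Ec.
  by apply/eqP; rewrite eqn_leq pge; rewrite El in pl; rewrite -ltnS pl.
(* With c = 4 and q = 2 the prefix has at least 4 * 3 - 1 = 11 vertices and the other path at least
   5. *)
- exfalso; have El : ls = [:: 5; 5; 5] by apply: small6.
  by apply: (bins _ _ [:: 5; 5] [:: 5] _ _ W qs2); rewrite ?El.
Qed.

End SmallOutsidePaths.

(** * Splitting the forest into two parts *)

Definition type1 l (ls : seq nat) :=
  (~~ odd l /\ (ls = [:: l.+1; l] \/ ls = [:: l; l]))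
  \/ (odd l /\ (ls = [:: l.+2; l] \/ ls = [:: l.+1; l] \/ ls = [:: l; l; 2])).

Lemma hsum_cat s1 s2 : hsum (s1 ++ s2) = hsum s1 + hsum s2.
Proof. by rewrite /hsum map_cat sumn_cat. Qed.

Lemma split_at_sum o (s : seq nat) : o < sumn s ->
  exists s1 j s2, [/\ s = s1 ++ j :: s2, sumn s1 <= o & o < sumn s1 + j].
Proof.
elim: s o => [|j s IH] o //= h; case: (ltnP o j) => oj; first by exists [::], j, s.
have [|s1 [j' [s2 [-> h1 h2]]]] := IH (o - j); first by lia.
by exists (j :: s1), j', s2; split=> //=; lia.
Qed.

Lemma hsum_ge j s : all (leq j) s -> j./2 * size s <= hsum s.
Proof.
elim: s => [|a s IH] /=; first by rewrite muln0.
by case/andP => ja /IH; rewrite mulnS /hsum /=; have := half_leq ja; lia.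
Qed.

Ltac pcount := apply/permP => ?; clear; do 3 rewrite /= ?count_cat; lia.

(** Since |F| = 2k + o for k = [hsum ls], the two capacities ask for a group [ys] with o < [sumn ys]
    <= k - 1. Components are taken in increasing order until their sum exceeds o. If this group is
    too large, its last member [j] carries the sum of the preceding ones, at most o, up to k or
    more; as all remaining components are at least [j], very few forests are left. *)
Lemma bin_packing ls : 1 < size ls -> sorted geq ls -> all okl ls ->
  [\/ exists xs ys, [/\ perm_eq (xs ++ ys) ls, sumn ys <= (hsum ls).-1 &
        sumn xs <= (hsum ls).*2.-1],
      ls = [:: 5; 5; 5; 5; 5],
      exists l, 2 <= l /\ type1 l ls |
      exists l, [/\ 2 <= l, odd l & ls = [:: l; l]]].
Proof.
move=> sz so al; have tot := forest_sizeE ls; have k1 := size_le_hsum al.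
have [|S [j [A [E S1 S2]]]] := @split_at_sum (count odd ls) (rev ls).
  by rewrite sumn_rev tot; lia.
have Els : ls = rev A ++ j :: rev S.
  by rewrite -(revK ls) E rev_cat rev_cons -cats1 -catA.
have pe ys xs : perm_eq (xs ++ ys) (S ++ j :: A) -> perm_eq (xs ++ ys) ls.
  by move=> h; apply: perm_trans h _; rewrite -E perm_rev.
have ok : all okl (S ++ j :: A) by rewrite -E all_rev.
have soA : sorted leq (S ++ j :: A) by rewrite -E rev_sorted.
have Ek : hsum ls = hsum S + (j./2 + hsum A).
  by rewrite -[j./2 + hsum A]/(hsum (j :: A)) -hsum_cat -E /hsum map_rev sumn_rev.
have Eo : count odd ls = count odd S + (odd j + count odd A).
  by rewrite -count_rev E count_cat.
move: ok; rewrite all_cat => /and3P[okS okj okA].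
have jA : all (leq j) A.
  by move: soA; rewrite sorted_cat_cons => /andP[_ /(order_path_min leq_trans)].
have hA := hsum_ge jA; have oA := odd_le_hsum okA; have oS := odd_le_hsum okS.
have sS := size_le_hsum okS; have sA := size_le_hsum okA.
have mA := count_size odd A; have ES := forest_sizeE S; have EA := forest_sizeE A.
have Ej := odd_double_half j; have j2 : 2 <= j by case/andP: okj.
have j3 : j != 3 by case/andP: okj.
have szA : size S + (size A).+1 = size ls by rewrite -(size_rev ls) E size_cat.
case: (leqP (sumn S + j) (hsum ls).-1) => h.
  apply: Or41; exists A, (S ++ [:: j]); split.
  - by apply: pe; pcount.
  - by rewrite sumn_cat /= addn0.
  - by lia.
have {}h : hsum ls <= sumn S + j by clear -h k1 sz; case: (hsum ls) h k1 => //= *; lia.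
move: (hsum ls) tot k1 Ek h => K tot k1 Ek h.
(* With [S] empty the smallest component [j] has at least k vertices. Three components would give k
   >= 3 * [j./2] > j, so there are two, and their orders differ by at most 2. *)
case: S => [|s S] in E S1 S2 Els pe soA Ek Eo okS oS sS ES szA h *.
  rewrite /= in S1 S2 Els Ek Eo okS oS sS ES szA h.
  case: A => [|a [|a' A]] in E Els pe soA Ek Eo okA jA hA oA sA mA EA szA h *.
  - by move: szA sz; rewrite /=; lia.
  - rewrite /= andbT in jA; rewrite /hsum /= addn0 in Ek.
    case oj: (odd j) Ej => Ej.
    + have : a = j \/ a = j.+1 \/ a = j.+2 by clear -Ek h Ej jA; lia.
      case=> [Ea|[Ea|Ea]]; subst a.
      * by apply: Or44; exists j; split.
      * by apply: Or43; exists j; split=> //; right; split=> //; right; left.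
      * by apply: Or43; exists j; split=> //; right; split=> //; left.
    + have : a = j \/ a = j.+1 by clear -Ek h Ej jA; lia.
      by case=> Ea; subst a; apply: Or43; exists j; split=> //; left; rewrite oj; split=> //; [right|left].
  - exfalso; move: hA; rewrite /= mulnS mulnS => hA; move: Ek; rewrite /hsum /= => Ek.
    rewrite /hsum /= in hA; clear -hA Ek h Ej j2 j3; move: (_ * _) hA => X hA; case: (odd j) Ej => /=; lia.
have g2 : 2 <= j./2.
  rewrite leqNgt; apply/negP => g1; have Ej2 : j = 2 by clear -g1 j2 j3; lia.
  rewrite Ej2 in Eo Ek h; rewrite /= in sS.
  by clear - Eo Ek h sS oS ES S1 oA; lia.
(* Each member of [A] has half at least [j./2]. As k <= [sumn S + j], all but one of these halves
   are paid for by [S] and by parities; [oAx] in turn bounds [S] by the number of odd components. *)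
have key : j./2 * (size A).-1 <= hsum (s :: S) + count odd (s :: S) + odd j.
  have : j./2 * (size A) <= hsum (s :: S) + count odd (s :: S) + odd j + j./2.
    by clear - hA Ek h ES Ej; lia.
  by case: (size A) => [|m] /=; rewrite ?muln0 // mulnS; clear; lia.
have oAx : (hsum (s :: S)).*2 <= count odd A + odd j by clear -S1 ES Eo; lia.
have key2 : 2 * (size A).-1 <= j./2 * (size A).-1 by rewrite leq_mul2r g2 orbT.
have x2 : hsum (s :: S) <= 2 by clear -key2 key oAx oS mA; case: (odd j) key oAx; lia.
have x1 : 1 <= hsum (s :: S) by apply: leq_trans sS.
have oj : odd j by clear -key2 key oAx oS mA x1; case: (odd j) key oAx; lia.
rewrite oj in Ej Eo key oAx.
case: S => [|s' S] in E S1 S2 Els pe soA Ek Eo okS oS sS ES szA h key oAx x1 x2 *; last first.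
  exfalso; have oz : odd s = false /\ odd s' = false /\ hsum S = 0.
    move: okS x2; rewrite /okl /hsum /= => /and3P[s1 s2 s3]; clear -s1 s2; lia.
  case: oz => os [os' hS]; have S0 : size S = 0.
    have := @size_le_hsum S; case/and3P: okS => _ _ s3 /(_ s3); rewrite hS; clear; lia.
  have := size0nil S0 => ?; subst S; rewrite /= os os' in key oAx x2.
  rewrite /hsum /= in key oAx x2; case/and3P: okS => /andP[s1 _] /andP[s1' _] _.
  clear - key oAx x2 mA g2 key2 s1 s1'; lia.
rewrite /hsum /= !addn0 in x2 key oAx S1 S2 Ek Eo oS sS ES szA h.
have s2 : 2 <= s by move: okS; rewrite /okl /= andbT => /andP[].
have s3 : s != 3 by move: okS; rewrite /okl /= andbT => /andP[].
case: A => [|a [|a' [|a'' [|b A]]]] in E Els pe soA Ek Eo okA jA hA oA sA mA EA szA h key key2 oAx *.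
- by exfalso; rewrite /= in oAx; clear -s2 oAx; lia.
- have Es : s = 2.
    by rewrite /= in oAx; clear -oAx s2 s3; case: (odd a) oAx => /=; lia.
  subst s; rewrite /= andbT in jA.
  have oa : odd a by rewrite /= in oAx; clear -oAx; case: (odd a) oAx.
  case: (eqVneq a j) => aj.
    subst a; apply: Or43; exists j; split=> //; right; split=> //; right; right.
    by rewrite Els.
  (* The group 2, j overshoots, but [j] alone is admissible: a >= j + 2 gives k >= j + 1, and o = 2
     < j. *)
  apply: Or41; exists [:: 2; a], [:: j]; split.
  + by apply: pe; pcount.
  + by rewrite /= in Ek *; clear - Ek oa Ej jA aj; lia.
  + by rewrite /= in Ek *; clear - Ek Ej g2; lia.
- have Es : s = 2.
    rewrite /= in oAx; clear -oAx s2 s3; case: (odd a) oAx; case: (odd a'); lia.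
  subst s; have Ej2 : j = 5 by rewrite /= muln1 in key; clear -key Ej g2; lia.
  subst j; rewrite /= andbT in jA; case/andP: jA => a5 a5'.
  apply: Or41; exists [:: 2; a; a'], [:: 5]; split.
  + by apply: pe; pcount.
  + by rewrite /hsum /= in Ek *; clear - Ek a5 a5'; lia.
  + by rewrite /hsum /= in Ek *; clear - Ek a5 a5'; lia.
- have Es : s = 5.
    rewrite /= in key key2; clear -key key2 g2 x2 s2 s3; case os: (odd s) key; lia.
  subst s; have Ej2 : j = 5 by rewrite /= in key; clear -key Ej g2; lia.
  subst j; rewrite /= in oAx jA; case/and4P: jA => a5 a5' a5'' _.
  have [oa [oa' oa'']] : odd a /\ odd a' /\ odd a''.
    by clear -oAx; move: oAx; do 3 case: (odd _).
  apply: Or42; rewrite Els /=; rewrite /hsum /= in Ek h.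
  have [-> [-> ->]] : a = 5 /\ a' = 5 /\ a'' = 5 by clear -Ek h oa oa' oa'' a5 a5' a5''; lia.
  by [].
- exfalso; rewrite /= in key key2; have os : odd s <= 1 by case: (odd s).
  by clear -key key2 x2 os; lia.
Qed.

(** * Components outside a longest path *)

Section Blocks.
Variables (T : finType) (e : rel T) (ls : seq nat).
Hypothesis H : setting e ls.
Let esym : symmetric e := g_sym H.
Let eirr : irreflexive e := g_irr H.
Let cT : conn e [set: T] := g_conn H.
Local Notation d := (hsum ls).-1.
Local Notation lpathT := (lpath e [set: T]).

(** A longest path among those off [P] that contain all vertices of [s0] cannot be prolonged at
    either end off [P]. *)
Lemma ex_stuck P s0 : uniq P -> pth e s0 -> uniq (P ++ s0) -> s0 != [::] ->
  exists x t, stuck e P x t /\ {subset s0 <= x :: t}.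
Proof.
move=> uP /andP[us0 ss0] u n0.
pose pr s := [&& sorted e s, all (fun y => y \notin P) s & all (mem s) s0].
have dis s : uniq s -> all (fun y => y \notin P) s -> uniq (P ++ s).
  move=> us h; rewrite cat_uniq uP us andbT /=; apply/hasPn => y ys; exact: (allP h).
have [|s [us /and3P[ss ns sub] mx]] := @ex_longest T pr.
  exists s0 => //; rewrite /pr ss0 /=; apply/andP; split; last by apply/allP.
  by move: u; rewrite cat_uniq => /and3P[_ /hasPn h _]; apply/allP.
case: s us ss ns sub mx => [|x t] us ss ns sub mx.
  by case: (s0) n0 sub.
exists x, t; split; last by apply/allP.
have nbr s y : uniq s -> pr s -> size s = size (x :: t) -> y \notin P ->
    (if s is z :: _ then e z y else false) -> y \in s.
  case: s => // z s uzs /and3P[h1 h2 h3] sz yP zy; apply: contraT => ny.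
  have := mx (y :: z :: s); rewrite /= ny -/(uniq (z :: s)) uzs => /(_ isT).
  rewrite -[(size s).+1]/(size (z :: s)) sz ltnn => -> //.
  rewrite /pr /= esym zy yP; move: h1 h2 => /= -> ->; rewrite /=.
  by apply/allP => w ws; have wz : w \in z :: s := allP h3 w ws; rewrite /= inE wz orbT.
split.
- by rewrite /pth us.
- exact: dis.
- move=> y xy yP; apply: (nbr (x :: t)) => //; exact/and3P.
- move=> y xy yP.
  have Er : last x t :: rev (belast x t) = rev (x :: t) by rewrite (lastI x t) rev_rcons.
  rewrite -mem_rev; apply: nbr => //; first by rewrite rev_uniq.
  + rewrite /pr (sorted_rev esym) ss all_rev ns /=.
    by apply/allP => w /(allP sub) /=; rewrite mem_rev.
  + by rewrite size_rev.
  + by rewrite -Er.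
Qed.

Lemma pth_nbr_out P x y : uniq P -> x \notin P -> y \notin P -> e x y ->
  exists z t, stuck e P z t /\ 0 < size t.
Proof.
move=> uP xP yP xy; have nxy : x != y by apply: contraTneq xy => ->; rewrite eirr.
have [|||z [t [S sub]]] := @ex_stuck P [:: x; y] uP.
- by rewrite /pth /= inE nxy xy.
- by rewrite cat_uniq uP /= (negbTE xP) (negbTE yP) /= inE nxy.
- by [].
exists z, t; split=> //; have [/andP[u _] _ _ _] := S.
have : size [:: x; y] <= size (z :: t) by apply: uniq_leq_size => //=; rewrite inE nxy.
by [].
Qed.

Lemma lpath_stuck P (Y : {set T}) x t : uniq P -> {in Y, forall y, y \notin P} ->
  (forall y z, y \in Y -> e y z -> z \notin P -> z \in Y) ->
  lpath e Y (x :: t) -> stuck e P x t.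
Proof.
move=> uP YP cl L; have [pQ /isinP iQ _] := L.
have Er : last x t :: rev (belast x t) = rev (x :: t) by rewrite (lastI x t) rev_rcons.
split=> //.
- have /andP[uQ _] := pQ; rewrite cat_uniq uP uQ andbT; apply/hasPn => y /iQ; exact: YP.
- by move=> y xy yP; apply: (lpath_nbr esym L _ xy); apply: (cl _ _ _ xy yP); apply: iQ; exact: mem_head.
- move=> y xy yP; have Lr := lpath_rev esym L; rewrite -Er in Lr.
  rewrite -mem_rev -Er; apply: (lpath_nbr esym Lr _ xy); apply: (cl _ _ _ xy yP); apply: iQ; exact: mem_last.
Qed.

Lemma clique_sorted (Q s : seq T) : {in Q &, forall y z, y != z -> e y z} ->
  {subset s <= Q} -> uniq s -> sorted e s.
Proof.
move=> cl; case: s => // x s; elim: s x => //= y s IH x sub /andP[nx u].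
rewrite IH //; last by move=> z zs; apply: sub; rewrite inE zs orbT.
rewrite andbT; apply: cl; first by apply: sub; rewrite mem_head.
  by apply: sub; rewrite !inE eqxx orbT.
by apply: contraNneq nx => ->; rewrite mem_head.
Qed.

Lemma mem_split (y : T) s : y \in s -> exists s1 s2, s = s1 ++ y :: s2.
Proof. by case/splitPr => p1 p2; exists p1, p2. Qed.

Lemma two_split (a b : T) (P : seq T) : a \in P -> b \in P -> a != b ->
  exists s1 m s2, P = s1 ++ a :: m ++ b :: s2 \/ P = s1 ++ b :: m ++ a :: s2.
Proof.
move=> /mem_split[s1 [s2 ->]]; rewrite mem_cat inE => /orP[/mem_split[u [w ->]]|/orP[/eqP->|/mem_split[u [w ->]]]] nab.
- by exists u, w, s2; right; rewrite -catA.
- by rewrite eqxx in nab.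
- by exists s1, u, w; left.
Qed.

(* A longest path [x :: t] of a union [Y] of components of [G - P], whose length is close to
   the minimum degree, spans a component of [G - P] which is joined to [P] at one vertex. *)
Lemma block_attach P (Y : {set T}) x t : lpathT P -> {in Y, forall y, y \notin P} ->
  (forall y z, y \in Y -> e y z -> z \notin P -> z \in Y) ->
  lpath e Y (x :: t) -> let q := (size t).+1 in
  1 < d -> d <= q -> q <= d.+1 -> (q = d.+1 -> 2 < d) -> size P <= d.*2.+3 ->
  exists a s0 s1 y0 s, [/\ P = s0 ++ a :: s1, q <= size s0, q <= size s1,
    [/\ e y0 a, pth e (y0 :: s) & perm_eq (y0 :: s) (x :: t)] &
    forall y z, y \in x :: t -> e y z -> z \in x :: t \/ z = a].
Proof.
move=> L YP cl LQ q d2 dq qd q3 pP; have [/andP[uP sP] _ _] := L.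
have few y s : lpath e Y (y :: s) -> perm_eq (y :: s) (x :: t) ->
    count (e y) P <= 1 /\ d <= 1 + count (e y) (y :: s) /\ d <= 1 + count (e (last y s)) (y :: s).
  move=> Ly pe; have S := lpath_stuck uP YP cl Ly.
  have [pQ u h1 _] := S; have [D1 _] := deg_split H u h1.
  have S' := stuck_rev H S; have [_ u' h2 _] := S'; have [D2 _] := deg_split H u' h2.
  have Er : last y s :: rev (belast y s) = rev (y :: s) by rewrite (lastI y s) rev_rcons.
  rewrite Er count_rev in D2.
  have [d1 d2'] := deg_stuck H S.
  have sz : size s = size t by apply/succn_inj; apply: (perm_size pe).
  have [c [a0 [b0 [Ec Ea Eb W]]]] := outside_weight esym L pQ u.
  rewrite Ea in D1 d1 *; rewrite Eb in D2 d2'; rewrite /= sz -/q in W d1 d2'.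
  (* The two ends together have at most one neighbour on P: with q at least d, a second one would by
     the gap weights require more than 2d + 3 vertices of P. *)
  suff le1 : c + a0 + b0 <= 1.
    clear -le1 D1 D2; split; first by lia.
    by split; [apply: leq_trans D1 _|apply: leq_trans D2 _]; rewrite leq_add2r; lia.
  rewrite leqNgt; apply/negP => gt1.
  have [|W1 W2 W3] := W; first by clear -gt1; lia.
  have dt : q = (size t).+1 by [].
  have [Eq|Eq] : q = d \/ q = d.+1 by clear -dq qd; lia.
  - have [c0|[c1|c2]] : c = 0 \/ c = 1 \/ 2 <= c by clear; lia.
    + have a1 : 0 < a0 by clear -c0 d1 Eq dt; lia.
      have b1 : 0 < b0 by clear -c0 d2' Eq dt; lia.
      have := W3 c0 a1 b1; clear -a1 b1 pP d2 Eq; lia.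
    + have := W2; rewrite c1 mul1n => {}W2; clear -c1 gt1 W2 pP Eq d2; lia.
    + have : 2 * q.+1 <= c * q.+1 by rewrite leq_mul2r c2 orbT.
      by clear -W1 pP Eq d2; move: (c * _) W1 => z *; lia.
  - have [c0|[c1|c2]] : c = 0 \/ c = 1 \/ 2 <= c by clear; lia.
    + by clear -c0 W2 gt1 pP Eq d2; move: (c * _) W2 => z *; lia.
    + have := W2; rewrite c1 mul1n => {}W2; clear -c1 gt1 W2 pP Eq d2; lia.
    + have : 2 * q.+1 <= c * q.+1 by rewrite leq_mul2r c2 orbT.
      by clear -W1 pP Eq d2; move: (c * _) W1 => z *; lia.
have [_ [c1 c2]] := few x t LQ (perm_refl _).
(* Each end keeps at least d - 1 neighbours inside the outside path. The sum 2(d - 1) reaches q if q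
   = d >= 2, or if q = d + 1 and d > 2, which is what the conditional hypothesis secures. *)
have [|H1 H2] := lpath_closed esym eirr LQ.
  rewrite -[size _]/q; move: c1 c2; set A := count (e x) _; set B := count (e (last x t)) _ => c1 c2.
  have [Eq|Eq] : q = d \/ q = d.+1 by clear -dq qd; lia.
    by clear -c1 c2 Eq d2; lia.
  by have := q3 Eq; clear -c1 c2 Eq; lia.
have iQ : {subset x :: t <= Y} by have [_ /isinP] := LQ.
have cQ y z : y \in x :: t -> e y z -> z \notin P -> z \in x :: t.
  by move=> yQ yz zP; apply: (H2 y) => //; apply: (cl y) => //; apply: iQ.
have hub1 y a b : y \in x :: t -> a \in P -> b \in P -> e y a -> e y b -> a = b.
  move=> yQ aP bP ya yb; have [s [Ls pe]] := H1 y yQ; have [h _] := few _ _ Ls pe.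
  apply/eqP; apply: contraT => nab; move: h; rewrite leqNgt -size_filter.
  have : size [:: a; b] <= size (filter (e y) P).
    apply: uniq_leq_size => /=; first by rewrite inE nab.
    by move=> z; rewrite !inE mem_filter => /orP[]/eqP->; rewrite ?ya ?yb.
  by move=> ->.
(* Two distinct attachment points leave at least q vertices of P beyond each of them, too many if q
   = d + 1. If q = d, the degrees make the outside path a clique, so a spanning path leads from [y]
   to [y'] and the gap between the attachment points also has q vertices. *)
have hubs y y' a b : y \in x :: t -> y' \in x :: t -> a \in P -> b \in P -> e y a -> e y' b -> a = b.
  move=> yQ yQ' aP bP ya yb; apply/eqP; apply: contraT => nab.
  have nyy : y != y' by apply: contraNneq nab => E; rewrite -E in yb; rewrite (hub1 _ _ _ yQ aP bP ya yb).
  have ends z c s1 s2 : z \in x :: t -> P = s1 ++ c :: s2 -> e z c -> q <= size s1 /\ q <= size s2.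
    move=> zQ E zc; have [s [Ls pe]] := H1 z zQ.
    have [pz uz _ _] := lpath_stuck uP YP cl Ls.
    have := attach_ends esym L pz uz E; rewrite esym zc (perm_size pe) => h; exact: h.
  have W s1 m s2 c c' z z' : P = s1 ++ c :: m ++ c' :: s2 -> z \in x :: t -> z' \in x :: t -> z != z' ->
      e z c -> e z' c' -> False.
    move=> E zQ zQ' nz zc zc'.
    have [e1 _] := ends z c _ _ zQ E zc.
    have [_ e2] := ends z' c' (s1 ++ c :: m) s2 zQ' (etrans E (catA s1 (c :: m) (c' :: s2))) zc'.
    have sP' : size P = size s1 + size m + size s2 + 2.
      by rewrite E !size_cat /= size_cat /=; clear; lia.
    have [Eq|Eq] : q = d \/ q = d.+1 by clear -dq qd; lia.
      have cliq : {in x :: t &, forall u w, u != w -> e u w}.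
        move=> u w uQ wQ nuw; have [s [Ls pe]] := H1 u uQ.
        have [h1 [h2 _]] := few _ _ Ls pe.
        have : size s <= count (e u) s.
          move: h2; rewrite /= eirr add0n.
          have : size s = size t by apply/succn_inj; apply: (perm_size pe).
          by move=> ->; clear -Eq; lia.
        move/(conj (count_size (e u) s))/andP; rewrite -eqn_leq -all_count => /allP; apply.
        by move: wQ; rewrite -(perm_mem pe) inE eq_sym (negbTE nuw).
      pose s := filter (fun w => (w != z) && (w != z')) (x :: t).
      have [/andP[uQ _] _ _] := LQ.
      have pe : perm_eq (z :: rcons s z') (x :: t).
        apply: uniq_perm => //.
          rewrite /= rcons_uniq mem_rcons inE (negbTE nz) /= !mem_filter !eqxx /= andbF /=.
          exact: filter_uniq.
        move=> w; rewrite inE mem_rcons inE mem_filter /=.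
        case: (eqVneq w z) => [->|_] /=; first by rewrite zQ.
        by case: (eqVneq w z') => [->|_] /=; first by rewrite zQ'.
      have pz : pth e (z :: rcons s z').
        rewrite /pth (perm_uniq pe) uQ; apply: (clique_sorted cliq); last by rewrite (perm_uniq pe).
        by move=> w; rewrite (perm_mem pe).
      have uz : uniq (P ++ z :: rcons s z').
        have [_ u _ _] := lpath_stuck uP YP cl LQ.
        by rewrite -(perm_uniq (s1 := P ++ x :: t)) // perm_cat2l perm_sym.
      have := attach_between esym L pz uz E; rewrite last_rcons (esym c) zc (esym c') zc' (perm_size pe) => /(_ isT) h.
      have {}h : q <= size m := h.
      by clear -sP' pP Eq d2 h e1 e2; lia.
    by clear -sP' pP Eq d2 e1 e2; lia.
  have [s1 [m [s2 [E|E]]]] := two_split aP bP nab.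
    by case: (W _ _ _ _ _ _ _ E yQ yQ' nyy ya yb).
  by rewrite eq_sym in nyy; case: (W _ _ _ _ _ _ _ E yQ' yQ nyy yb ya).
have [y0 [a [y0Q aP ya]]] : exists y0 a, [/\ y0 \in x :: t, a \in P & e y0 a].
  case: (boolP [exists y in x :: t, [exists a in P, e y a]]).
    by case/existsP => y /andP[yQ /existsP[a /andP[aP ya]]]; exists y, a.
  move=> nex; exfalso.
  have : [set y in x :: t] = [set: T].
    apply: cT => //; first by apply/set0Pn; exists x; rewrite inE mem_head.
    move=> y z; rewrite !in_set => yQ _ yz; apply: (cQ _ _ yQ yz); apply: contra nex => zP.
    by apply/existsP; exists y; rewrite yQ; apply/existsP; exists z; rewrite zP.
  have := longest_ge H L; case: (P) YP => // p P' YP _ /setP/(_ p); rewrite !inE => pQ.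
  have : p \in x :: t by rewrite inE pQ.
  by move/iQ/YP; rewrite mem_head.
have [s [Ls pe]] := H1 y0 y0Q; have [py uy _ _] := lpath_stuck uP YP cl Ls.
have [s0 [s1 E]] := mem_split aP.
have := attach_ends esym L py uy E; rewrite esym ya (perm_size pe) => /(_ isT)[e1 e2].
exists a, s0, s1, y0, s; split=> // y z yQ yz.
case: (boolP (z \in P)) => zP; last by left; apply: cQ yz zP.
by right; apply: hubs yQ y0Q zP aP yz ya.
Qed.

End Blocks.

(** Off [A] the graph is a disjoint union of cliques of order [c], each completely joined to [A].
    Edges inside [A] are left open, so that the same notion covers joins with K_1, K_2 and E_2. *)
Definition blocks (T : finType) (e : rel T) (A : {set T}) c := forall v, v \notin A ->
  exists C : {set T}, [/\ v \in C, #|C| = c &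
    forall y, y \in C -> y \notin A /\ forall z, e y z = (z \in A) || (z \in C) && (z != y)].

Lemma isomorphic_inv (G H : sgraph) (g : vert H -> vert G) : injective g ->
  (forall v, exists u, g u = v) -> (forall x y, adj x y = adj (g x) (g y)) -> isomorphic G H.
Proof.
move=> gi gs ge.
have gs' v : exists u, g u == v by have [u <-] := gs v; exists u.
pose f v := xchoose (gs' v).
have gK v : g (f v) = v by apply/eqP; exact: (xchooseP (gs' v)).
exists f; split; last by move=> x y; rewrite ge !gK.
exists g => //; move=> u; apply: gi; exact: gK.
Qed.

(** The cliques partition the complement of [A]; t is their number, and enumerating the set of
    cliques and each single clique gives the isomorphism. [h] identifies [H] with the graph spanned
    by [A]. *)
Lemma iso_blocks (G H : sgraph) (A : {set vert G}) c (h : vert H -> vert G) :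
  symmetric (@adj G) -> injective h -> (forall i, h i \in A) ->
  (forall a, a \in A -> exists i, h i = a) -> (forall i j, adj i j = adj (h i) (h j)) ->
  blocks (@adj G) A c -> exists t, isomorphic G (gjoin H (copies t (Kg c))).
Proof.
move=> sG hi hA hs he B.
pose nb v : {set vert G} := [set y | (y == v) || adj v y] :\: A.
have nbE v (C : {set vert G}) : v \notin A -> (forall y, y \in C -> y \notin A) -> v \in C ->
    (forall z, adj v z = (z \in A) || (z \in C) && (z != v)) -> nb v = C.
  move=> vA CA vC E; apply/setP => z; rewrite !inE E.
  case: (eqVneq z v) => [->|nz] /=; first by rewrite vA vC.
  rewrite andbT; case zC: (z \in C); first by rewrite CA ?orbT.
  by rewrite orbF; case: (z \in A).
pose cl : {set {set vert G}} := [set nb v | v in ~: A].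
have clP C : C \in cl -> #|C| = c /\ forall y, y \in C ->
    [/\ y \notin A, nb y = C & forall z, adj y z = (z \in A) || (z \in C) && (z != y)].
  case/imsetP => v; rewrite inE => vA ->.
  have [D [vD cD D1]] := B v vA.
  have CA y : y \in D -> y \notin A by case/D1.
  have -> : nb v = D by apply: nbE => //; have [] := D1 v vD.
  split=> // y yD; have [yA E] := D1 y yD; split=> //; exact: nbE.
have pc (j : 'I_#|cl|) : c = #|enum_val j| by case: (clP _ (enum_valP j)) => ->.
pose g (x : vert (gjoin H (copies #|cl| (Kg c)))) : vert G :=
  match x with inl i => h i | inr y => enum_val (cast_ord (pc y.2) y.1) end.
have gin (y : 'I_c * 'I_#|cl|) : g (inr y) \in enum_val y.2 by apply: enum_valP.
have gin' (y : 'I_c * 'I_#|cl|) := (clP _ (enum_valP y.2)).2 _ (gin y).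
exists #|cl|; apply: (@isomorphic_inv _ _ g).
- move=> [i|[i j]] [i'|[i' j']].
  + by move/hi=> ->.
  + by move=> E; have [] := gin' (i', j'); rewrite -E /= hA.
  + by move=> E; have [] := gin' (i, j); rewrite E /= hA.
  + move=> E; have [_ n1 _] := gin' (i, j); have [_ n2 _] := gin' (i', j').
    have ej : j = j' by apply: enum_val_inj; rewrite -n1 -n2 E.
    subst j'; congr (inr (_, _)).
    by move: E => /= /enum_val_inj/cast_ord_inj.
- move=> v; case: (boolP (v \in A)) => [/hs[i <-]|vA]; first by exists (inl i).
  have nc : nb v \in cl by apply: imset_f; rewrite inE.
  have vin : v \in nb v by rewrite !inE eqxx vA.
  pose j := enum_rank_in nc (nb v).
  have ej : enum_val j = nb v by rewrite enum_rankK_in.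
  have vj : v \in enum_val j by rewrite ej.
  exists (inr (cast_ord (esym (pc j)) (enum_rank_in vj v), j)) => /=.
  by rewrite cast_ordKV enum_rankK_in.
- move=> [i|[i j]] [i'|[i' j']].
  + exact: he.
  + by have [_ _ E] := gin' (i', j'); rewrite sG E [g (inl i)]/= hA.
  + by have [_ _ E] := gin' (i, j); rewrite E [g (inl i')]/= hA.
  + have [_ n1 E] := gin' (i, j); have [n2 n3 _] := gin' (i', j').
    rewrite E (negbTE n2) orFb /=; case: (eqVneq j j') => [ej|nj] /=.
      subst j'; rewrite (enum_valP (cast_ord (pc j) i')) /=.
      by rewrite (inj_eq enum_val_inj) (inj_eq (@cast_ord_inj _ _ _)) eq_sym.
    symmetry; apply/negbTE; rewrite negb_and; apply/orP; left.
    apply: contra nj => mj; apply/eqP; apply: enum_val_inj.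
    by have [_ <- _] := (clP _ (enum_valP j)).2 _ mj.
Qed.

Section TypeOneBlock.
Variables (T : finType) (e : rel T) (ls : seq nat).
Hypothesis H : setting e ls.
Let esym : symmetric e := g_sym H.
Let eirr : irreflexive e := g_irr H.
Let lal : all okl ls := g_ok H.
Let nF : ~ Fin e ls := g_free H.
Local Notation d := (hsum ls).-1.
Local Notation lpathT := (lpath e [set: T]).


Lemma type1_facts l : type1 l ls -> hsum ls = l /\
  exists rest, [/\ perm_eq (l :: rest) ls, sumn ls = l + sumn rest,
    2 <= l, sumn rest <= l.*2.-1 & sumn rest <= l.+2].
Proof.
have ok := lal; case=> [[ol [E|E]]|[ol [E|[E|E]]]]; move: ok; rewrite {1}E /okl /= ?andbT.
- move=> /andP[_ /andP[l2 _]]; split; first by rewrite /hsum E /=; clear -ol; lia.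
  exists [:: l.+1]; rewrite E /= !addn0; split=> //; [by pcount|by clear; lia|by clear -l2; lia].
- move=> /andP[_ /andP[l2 _]]; split; first by rewrite /hsum E /=; clear -ol; lia.
  exists [:: l]; rewrite E /= !addn0; split=> //; by clear -l2; lia.
- move=> /andP[_ /andP[l2 _]]; split; first by rewrite /hsum E /=; clear -ol; lia.
  exists [:: l.+2]; rewrite E /= !addn0; split=> //; [by pcount|by clear; lia|by clear -l2 ol; lia].
- move=> /andP[_ /andP[l2 _]]; split; first by rewrite /hsum E /=; clear -ol; lia.
  exists [:: l.+1]; rewrite E /= !addn0; split=> //; [by pcount|by clear; lia|by clear -l2; lia].
- move=> /and3P[/andP[l2 _] _ _]; split; first by rewrite /hsum E /=; clear -ol; lia.
  exists [:: l; 2]; rewrite E /= ?addn0; split=> //; by clear -l2 ol; lia.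
Qed.

Lemma type1_out l P s : type1 l ls -> lpathT P -> pth e s -> uniq (P ++ s) -> size s < l.
Proof.
move=> ty L ps u; have [hl [rest [pe sl l2 r1 r2]]] := type1_facts ty.
rewrite ltnNge; apply/negP => h; apply: nF.
have [/andP[_ sP] _ _] := L; have [ _ ss] := andP ps.
apply: (Fin2 (xs := rest) (ys := [:: l]) sP ss u).
- by apply: perm_trans pe; pcount.
- by apply: leq_trans (longest_ge H L); rewrite hl; clear -r1 l2; lia.
- by rewrite /= addn0.
Qed.

Lemma out_uniq (P s : seq T) : uniq P -> uniq s -> isin (~: [set y in P]) s -> uniq (P ++ s).
Proof.
move=> uP us /isinP i; rewrite cat_uniq uP us andbT; apply/hasPn => y /i.
by rewrite !inE.
Qed.

Lemma uniq_out (P s : seq T) : uniq (P ++ s) -> isin (~: [set y in P]) s.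
Proof.
by rewrite cat_uniq => /and3P[_ /hasPn h _]; apply/isinP => y /h; rewrite !inE.
Qed.

(** A vertex of [Q] has only d possible neighbours, [a] and the d - 1 other vertices of [Q], so the
    minimum degree makes it adjacent to all of them. *)
Lemma block_full a (Q : seq T) : uniq Q -> size Q = d -> a \notin Q ->
  (forall y z, y \in Q -> e y z -> z \in Q \/ z = a) ->
  forall y z, y \in Q -> e y z = (z == a) || (z \in Q) && (z != y).
Proof.
move=> uQ sQ aQ cl y z yQ.
pose S := filter (predC1 y) (a :: Q).
have ya : a != y by apply: contraNneq aQ => ->.
have yS w : e y w -> w \in S.
  move=> yw; rewrite mem_filter /= inE; apply/andP; split.
    by apply: contraTneq yw => ->; rewrite eirr.
  by case: (cl y w yQ yw) => ->; rewrite ?eqxx ?orbT.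
have uS : uniq S by rewrite filter_uniq //= aQ.
have sS : size S = d.
  rewrite /S /= ya /= size_filter -sQ -(count_predC (pred1 y) Q) (count_uniq_mem _ uQ) yQ add1n.
  by congr _.+1; apply: eq_count.
have := deg_count H uS yS; rewrite -sS => ge.
have := count_size (e y) S => le.
have : all (e y) S by rewrite all_count eqn_leq le.
move=> aS; apply/idP/idP => [/yS|h].
  by rewrite mem_filter /= inE => /andP[-> /orP[->|->]]; rewrite ?orbT.
apply: (allP aS); rewrite mem_filter /= inE.
by case/orP: h => [/eqP->|/andP[-> ->]]; rewrite ?eqxx ?orbT ?ya.
Qed.

Lemma type1_block l P s : type1 l ls -> 1 < d -> lpathT P -> pth e s -> uniq (P ++ s) ->
  size s = d -> exists a s0 s1, [/\ P = s0 ++ a :: s1, size s0 = d, size s1 = d &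
   forall y z, y \in s -> e y z = (z == a) || (z \in s) && (z != y)].
Proof.
move=> ty d2 L ps u sd; have [hl [rest [pe sl l2 r1 r2]]] := type1_facts ty.
have [pP _ _] := L; have [uP sP] := andP pP.
case: s ps u sd => [|x t] ps u sd; first by rewrite -sd in d2.
pose Y := ~: [set y in P].
have LQ : lpath e Y (x :: t).
  split=> //; first exact: uniq_out.
  move=> s' ps' is'; rewrite sd; have [us' _] := andP ps'.
  have := type1_out ty L ps' (out_uniq uP us' is'); rewrite hl; clear -l2; lia.
have st : (size t).+1 = d := sd.
have [|||||||a [s0 [s1 [y0 [s' [E q0 q1 [ya py pey] cl]]]]]] := block_attach H L _ _ LQ.
- by move=> y; rewrite !inE.
- by move=> y z _ _; rewrite !inE.
- by [].
- by rewrite st.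
- by rewrite st.
- by rewrite st => h; exfalso; clear -h; lia.
- by have := longest_lt H pP; rewrite sl hl; clear -r2 l2; lia.
rewrite st in q0 q1.
have aP : a \in P by rewrite E mem_cat mem_head orbT.
have aQ : a \notin x :: t.
  by move: u; rewrite cat_uniq => /and3P[_ /hasPn h _]; apply/negP => /h; rewrite aP.
have sz : size P = size s0 + (size s1).+1 by rewrite E size_cat.
have [uQ _] := andP ps.
(* A side of P with l vertices would hold P_l, while the outside path, the hub and the other side
   form a path on at least 2d + 1 = 2l - 1 vertices, enough for [rest]. *)
have fit w v b : uniq (w ++ b :: v ++ y0 :: s') -> sorted e w -> sorted e (rcons (rev (y0 :: s')) b) -> sorted e (b :: v) -> l <= size w -> d <= size v -> False.
  move=> uu sw sr sv lw lv; apply: nF.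
  apply: (Fin2 (xs := [:: l]) (ys := rest) (s := w) (t := rev (y0 :: s') ++ b :: v)) => //.
  - by rewrite sorted_pivot sr sv.
  - by ucount uu.
  - by rewrite /= addn0.
  - by rewrite size_cat size_rev (perm_size pey) /= st; apply: leq_trans r1 _; rewrite hl; clear -lv l2 hl; lia.
have sr : sorted e (rcons (rev (y0 :: s')) a).
  by rewrite -rev_cons sorted_rev //= esym ya; case/andP: py => _ /= ->.
have uu : uniq (s0 ++ a :: s1 ++ y0 :: s').
  have u' := u; rewrite -(perm_uniq (s1 := P ++ y0 :: s')) in u'; last by rewrite perm_cat2l.
  by rewrite E in u'; ucount u'.
move: sP; rewrite E sorted_pivot => /andP[S0 S1].
have z0 : size s0 = d.
  apply/eqP; rewrite eqn_leq q0 andbT leqNgt; apply/negP => h.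
  apply: (fit s0 s1 a uu _ sr S1 _ q1); last by rewrite -hl; clear -h; lia.
  by move: S0; rewrite -cats1 => /cat_sorted2[].
have z1 : size s1 = d.
  apply/eqP; rewrite eqn_leq q1 andbT leqNgt; apply/negP => h.
  apply: (fit s1 (rev s0) a _ _ sr _ _ _).
  - by ucount uu.
  - by move: S1 => /path_sorted.
  - by rewrite -rev_rcons sorted_rev.
  - by rewrite -hl; clear -h; lia.
  - by rewrite size_rev.
exists a, s0, s1; split=> //; exact: block_full.
Qed.

End TypeOneBlock.

Section TypeOneBlocks.
Variables (T : finType) (e : rel T) (ls : seq nat).
Hypothesis H : setting e ls.
Let esym : symmetric e := g_sym H.
Let eirr : irreflexive e := g_irr H.
Local Notation d := (hsum ls).-1.
Local Notation lpathT := (lpath e [set: T]).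

Lemma cat_pivot_inj (T' : eqType) (s0 s0' s1 s1' : seq T') a a' : size s0 = size s0' ->
  s0 ++ a :: s1 = s0' ++ a' :: s1' -> a = a'.
Proof. by move=> sz /eqP; rewrite eqseq_cat // => /andP[_ /eqP[]]. Qed.

Lemma stuck_size P x t : ls <> [:: 5; 5; 5] -> lpathT P -> stuck e P x t -> 0 < size t ->
  d <= (size t).+1.
Proof.
move=> n5 L S t0; rewrite leqNgt; apply/negP => h.
by have [] := outside_small H L S t0 h.
Qed.

Lemma type1_not555 l : type1 l ls -> ls <> [:: 5; 5; 5].
Proof. by move=> + E; rewrite E; case=> [[_ []]|[_ [|[]]]] // []. Qed.

Lemma stuck_singleton P v : stuck e P v [::] -> v \notin P /\ forall y, e v y -> y \in P.
Proof.
move=> [_ u h _]; split; first by move: u; rewrite cat_uniq /= orbF => /and3P[].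
move=> y vy; case: (boolP (y \in P)) => // /(h y vy).
by rewrite inE => /eqP E; move: vy; rewrite E eirr.
Qed.

Lemma ex_stuck1 P v : uniq P -> v \notin P ->
  exists x t, stuck e P x t /\ v \in x :: t.
Proof.
move=> uP vP; have [||x [t [S sub]]] := ex_stuck H uP (isT : pth e [:: v]) => //.
  by rewrite cat_uniq uP /= orbF vP.
by exists x, t; split=> //; apply: sub; rewrite mem_head.
Qed.

(** The outside path and both sides of P at [a] have d vertices each. Swapping the outside path with
    a side gives a longest path with the same middle vertex and that side outside, so the sides are
    clique blocks over [a] too. An outside vertex with all its neighbours on P could then only be
    adjacent to [a], against d >= 2. *)
Lemma type1_blocks l P x t : type1 l ls -> lpathT P -> stuck e P x t -> 0 < size t ->
  exists a, blocks e [set a] d.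
Proof.
move=> ty L S t0; have [hl _] := type1_facts H ty.
have n5 := type1_not555 ty.
have [/andP[uP sP] _ _] := L; have [pQ u _ _] := S.
have full P' y s : lpathT P' -> stuck e P' y s -> 0 < size s -> size (y :: s) = d.
  move=> L' S' s0; have [pQ' u' _ _] := S'.
  have := type1_out H ty L' pQ' u'; have := stuck_size n5 L' S' s0.
  by rewrite hl /=; clear; lia.
have sz := full P x t L S t0.
have d2 : 1 < d by rewrite -sz.
have [a [s0 [s1 [E z0 z1 B]]]] := type1_block H ty d2 L pQ u sz.
have uu : uniq (s0 ++ a :: s1 ++ x :: t) by rewrite E in u; ucount u.
move: (sP); rewrite E sorted_pivot => /andP[S0 S1]; have [uQ sQ] := andP pQ.
have xa : e x a by rewrite B ?mem_head ?eqxx.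
have wa : e (last x t) a by rewrite B ?mem_last ?eqxx.
have pick P' s s' s'' : pth e P' -> P' = s' ++ a :: s'' -> size s' = d -> size s'' = d ->
    pth e s -> size s = d -> uniq (P' ++ s) ->
    forall y z, y \in s -> e y z = (z == a) || (z \in s) && (z != y).
  move=> pP' E' z' z'' ps zs us.
  have L' : lpathT P' by apply: longest_lpath L _ _ => //; rewrite E E' !size_cat /= z0 z1 z' z''.
  have [b [r0 [r1 [E'' zr0 zr1 B']]]] := type1_block H ty d2 L' ps us zs.
  by have -> : a = b by apply: (cat_pivot_inj _ (etrans (Logic.eq_sym E') E'')); rewrite z' zr0.
have B0 : forall y z, y \in s0 -> e y z = (z == a) || (z \in s0) && (z != y).
  apply: (pick ((x :: t) ++ a :: s1) s0 (x :: t) s1) => //.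
  - apply/andP; split; first by ucount uu.
    by rewrite sorted_pivot S1 andbT -cats1 sorted_cat sQ /= wa.
  - apply/andP; split; first by ucount uu.
    by move: S0; rewrite -cats1 => /cat_sorted2[].
  - by ucount uu.
have B1 : forall y z, y \in s1 -> e y z = (z == a) || (z \in s1) && (z != y).
  apply: (pick (s0 ++ a :: x :: t) s1 s0 (x :: t)) => //.
  - apply/andP; split; first by ucount uu.
    by rewrite sorted_pivot S0 /= (esym a) xa; move: sQ => /= ->.
  - apply/andP; split; first by ucount uu.
    exact: path_sorted S1.
  - by ucount uu.
have mk s v : v \in s -> v != a -> a \notin s -> uniq s -> size s = d ->
    (forall y z, y \in s -> e y z = (z == a) || (z \in s) && (z != y)) ->
    exists C : {set T}, [/\ v \in C, #|C| = d &
      forall y, y \in C -> y \notin [set a] /\ forall z, e y z = (z \in [set a]) || (z \in C) && (z != y)].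
  move=> vs va as_ us zs Bs; exists [set y in s]; split; rewrite ?inE //.
    by rewrite cardsE (card_uniqP us).
  move=> y; rewrite inE => ys; rewrite inE; split; first by apply: contraNneq as_ => <-.
  by move=> z; rewrite !inE; apply: Bs.
exists a => v; rewrite inE => va.
case: (boolP (v \in P)) => vP.
  move: vP; rewrite E mem_cat inE (negbTE va) /= => /orP[]vs.
    apply: (mk s0) => //; last by ucount uu.
    apply/negP => h; move: uu; rewrite cat_uniq => /and3P[_ /hasPn/(_ a (mem_head _ _)) + _].
    by rewrite /= h.
  apply: (mk s1) => //; last by ucount uu.
  apply/negP => h; move: uu; rewrite cat_uniq => /and3P[_ _].
  by rewrite /= mem_cat h.
have [x' [t' [S' vt']]] := ex_stuck1 uP vP.
case: t' S' vt' => [|y' t'] S' vt'.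
  move: vt' S'; rewrite inE => /eqP <- /stuck_singleton[_ nb].
  have := @deg_count _ _ _ H v [:: a] isT; rewrite leqNgt (leq_ltn_trans (count_size _ _)) // => h.
  suff : false by []. apply: h => y vy; have := nb y vy.
  rewrite E mem_cat !inE => /orP[ys|/orP[->//|ys]].
    move: vy; rewrite esym B0 // (negbTE va) /= => /andP[vs _].
    by move: vP; rewrite E mem_cat vs.
  move: vy; rewrite esym B1 // (negbTE va) /= => /andP[vs _].
  by move: vP; rewrite E mem_cat inE vs !orbT.
have zQ := full P _ _ L S' isT.
have [pQ' u' _ _] := S'.
have B' := pick P (x' :: y' :: t') s0 s1 (introT andP (conj uP sP)) E z0 z1 pQ' zQ u'.
have [uQ' _] := andP pQ'; apply: (mk (x' :: y' :: t')) => //.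
move: u'; rewrite cat_uniq => /and3P[_ /hasPn h _]; apply/negP => /h.
by rewrite E mem_cat mem_head orbT.
Qed.

End TypeOneBlocks.

(** * Single vertices outside a longest path *)

Definition sparse (T : Type) (b : pred T) s := sorted (fun x y => ~~ (b x && b y)) s.

Lemma sparse_count (T : Type) (b : pred T) x s : sparse b (x :: s) ->
  (count b (x :: s)).*2 <= (size s).+1 + b x.
Proof.
elim: s x => [|y s IH] x; first by rewrite /=; case: (b x).
move=> /andP[nb h]; have := IH y h; rewrite /=; move: nb.
by case: (b x); case: (b y) => //= _; clear; lia.
Qed.

Lemma sparse_cat (T : Type) (b : pred T) s1 s2 : sparse b (s1 ++ s2) -> sparse b s1 /\ sparse b s2.
Proof. by move=> h; have [] := cat_sorted2 h; split. Qed.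

Lemma sparse_count_gen (T : Type) (b : pred T) s : sparse b s -> (count b s).*2 <= (size s).+1.
Proof.
by case: s => // x s h; have := sparse_count h; case: (b x) => /=; clear; lia.
Qed.

Section SingleVertices.
Variables (T : finType) (e : rel T) (ls : seq nat).
Hypothesis H : setting e ls.
Let esym : symmetric e := g_sym H.
Let nT : 2 * sumn ls <= #|T| := g_card H.
Let nF : ~ Fin e ls := g_free H.
Local Notation lpathT := (lpath e [set: T]).

Lemma single_ends P v s1 y s2 : lpathT P -> v \notin P -> P = s1 ++ y :: s2 -> e v y ->
  0 < size s1 /\ 0 < size s2.
Proof.
move=> L vP E vy; have [/andP[uP _] _ _] := L.
by apply: (@outside_ends T e esym P v [::] L isT _ s1 y s2 E); rewrite ?vy // cat_uniq uP /= orbF vP.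
Qed.

Lemma single_sparse P v : lpathT P -> v \notin P -> sparse (e v) P.
Proof.
move=> L vP; suff W s1 s : P = s1 ++ s -> sparse (e v) s by apply: (W [::]).
elim: s s1 => // x s IH s1 E; have := IH (rcons s1 x); rewrite cat_rcons => /(_ E).
case: s {IH} E => // y s E h; move: h; rewrite /sparse /= => ->; rewrite andbT.
by apply/negP => /andP[vx vy]; apply: (single_between esym L vP E).
Qed.

Lemma single_count_prefix P v s s2 : lpathT P -> v \notin P -> P = s ++ s2 ->
  (count (e v) s).*2 <= size s.
Proof.
move=> L vP E; have := single_sparse L vP; rewrite E => /sparse_cat[h _].
case: s E h => // x s E h; have := sparse_count h.
suff -> : e v x = false by rewrite addn0.
by apply/negP => vx; have [] := single_ends L vP (E : P = [::] ++ x :: s ++ s2) vx.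
Qed.

Lemma single_count_suffix P v s1 s : lpathT P -> v \notin P -> P = s1 ++ s ->
  (count (e v) s).*2 <= size s.
Proof.
move=> L vP E; have Lr := lpath_rev esym L.
have Er : rev P = rev s ++ rev s1 by rewrite E rev_cat.
have := @single_count_prefix (rev P) v (rev s) (rev s1) Lr.
by rewrite mem_rev count_rev size_rev; apply.
Qed.

(** The path is led through [v] past the hub [a], from the last neighbour of [v] before [a] to the
    first one after it, which frees [a] for a path into another outside component. Little is lost,
    because the retained pieces contain every neighbour of [v] in [s0] and [s1], and no two of these
    are consecutive. *)
Lemma through_single P v s0 a s1 : lpathT P -> v \notin P -> P = s0 ++ a :: s1 ->
  has (e v) s0 -> has (e v) s1 ->
  exists m0 y r0 r1 z m1, [/\ s0 = m0 ++ y :: r0, s1 = r1 ++ z :: m1, e v y, e v z &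
   [/\ (count (e v) s0).*2 <= (size m0).+1, (count (e v) s1).*2 <= (size m1).+1 &
       pth e (m0 ++ y :: v :: z :: m1)]].
Proof.
move=> L vP E h0 h1; have [/andP[uP sP] _ _] := L.
have [m0 [y [r0 [E0 n0 vy]]]] := split_last h0.
have [r1 [z [m1 [E1 n1 vz]]]] := split_first h1.
have c0 : count (e v) r0 = 0 by apply/eqP; rewrite -leqn0 leqNgt -has_count.
have c1 : count (e v) r1 = 0 by apply/eqP; rewrite -leqn0 leqNgt -has_count.
exists m0, y, r0, r1, z, m1; split=> //; split.
- have := @single_count_prefix P v (rcons m0 y) (r0 ++ a :: s1) L vP.
  rewrite E E0 cat_rcons -catA => /(_ erefl).
  by rewrite -cats1 !count_cat size_cat /= c0 addn1.
- have := @single_count_suffix P v (s0 ++ a :: r1) (z :: m1) L vP.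
  rewrite E E1 -catA => /(_ erefl).
  by rewrite !count_cat /= c1 add0n.
- move: sP uP; rewrite E E0 E1 -catA sorted_pivot /= => /andP[S0 S1] uP.
  apply/andP; split.
    have : uniq (v :: m0 ++ y :: r0 ++ a :: r1 ++ z :: m1).
      by rewrite /= uP andbT; move: vP; rewrite E E0 E1 -catA.
    by move=> u; ucount u.
  rewrite sorted_pivot S0 /= (esym y) vy vz.
  by move: S1; rewrite cat_path /= cat_path /= => /and5P[].
Qed.

(** A vertex off both paths has no neighbour on [x :: t], whose vertices see only [x :: t] and [P].
    So being stuck against the union is being stuck against [P]. *)
Lemma stuck_ext P x t y s : (forall v z, v \in x :: t -> e v z -> z \in x :: t \/ z \in P) ->
  stuck e (P ++ x :: t) y s -> stuck e P y s.
Proof.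
move=> cl [p u h1 h2].
have nQ w z : w \in y :: s -> e w z -> z \notin x :: t.
  move=> wy wz; apply/negP => zQ; have := cl z w zQ; rewrite esym wz => /(_ isT).
  by move: u; rewrite cat_uniq => /and3P[_ /hasPn/(_ w wy)]; rewrite /= mem_cat negb_or => /andP[/negbTE-> /negbTE->] _ [].
split=> //; first by ucount u.
- by move=> z yz zP; apply: (h1 z yz); rewrite mem_cat negb_or zP (nQ y) ?mem_head.
- by move=> z yz zP; apply: (h2 z yz); rewrite mem_cat negb_or zP (nQ (last y s)) ?mem_last.
Qed.

(** Here k = 10 and d = 9. The splittings 15 + 10 and 20 + 5 force an outside path of exactly 9
    vertices and |P| = 19, with the hub in the middle of P. As n >= 50, there is a further vertex: a
    long outside path through it gives 15 + 5 + 5, and if it is single, P is rerouted through it. *)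
Lemma five_P5 P x t : ls = [:: 5; 5; 5; 5; 5] -> lpathT P -> stuck e P x t -> 0 < size t -> False.
Proof.
move=> El L S t0; have n5 : ls <> [:: 5; 5; 5] by rewrite El.
have qd := stuck_size H n5 L S t0.
have hl : hsum ls = 10 by rewrite El.
have [/andP[uP sP] _ _] := L; have pl := longest_ge H L; rewrite hl in qd pl.
have [pQ u _ _] := S; have [uQ sQ] := andP pQ.
pose Y := ~: [set y in P].
have [Q LQ] := ex_lpath e Y.
have szQ : 9 <= size Q.
  have [_ _ mx] := LQ; apply: leq_trans qd _; apply: (mx _ pQ); exact: uniq_out.
case: Q LQ szQ => // x' t' LQ szQ {x t S t0 qd pQ u uQ sQ}.
have YP : {in Y, forall y, y \notin P} by move=> y; rewrite !inE.
have cY : forall y z, y \in Y -> e y z -> z \notin P -> z \in Y by move=> y z _ _; rewrite !inE.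
have S := lpath_stuck H uP YP cY LQ.
have [pQ u _ _] := S; have [uQ sQ] := andP pQ.
have q9 : size (x' :: t') = 9.
  apply/eqP; rewrite eqn_leq szQ andbT leqNgt; apply/negP => h; apply: nF; rewrite El.
  apply: (Fin2 (xs := [:: 5; 5; 5]) (ys := [:: 5; 5]) sP sQ u) => //=.
  by apply: leq_trans pl.
have p19 : size P = 19.
  apply/eqP; rewrite eqn_leq pl andbT leqNgt; apply/negP => h; apply: nF; rewrite El.
  apply: (Fin2 (xs := [:: 5; 5; 5; 5]) (ys := [:: 5]) sP sQ u) => //=.
  by apply: leq_trans szQ.
have [|||||a [s0 [s1 [y0 [s' [E q0 q1 [ya py pey] cl]]]]]] := block_attach H L YP cY LQ; rewrite ?hl ?(q9 : (size t').+1 = 9) ?p19 //.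
have z' : size (y0 :: s') = 9 by rewrite (perm_size pey).
have aP : a \in P by rewrite E mem_cat mem_head orbT.
have clP v z : v \in x' :: t' -> e v z -> z \in x' :: t' \/ z \in P.
  by move=> vQ vz; case: (cl v z vQ vz) => [|->]; auto.
have [v vn] : exists v, v \notin P ++ x' :: t'.
  apply/existsP; rewrite -negb_forall; apply/negP => /forallP all_in.
  have : #|T| <= size (P ++ x' :: t').
    by rewrite -cardsT -(card_uniqP u) subset_leq_card //; apply/subsetP => y _.
  by rewrite size_cat p19 q9 leqNgt; have := nT; rewrite El /=; clear; lia.
have [y [s [S2 vy]]] := ex_stuck1 H u vn.
have S3 := stuck_ext clP S2.
have [/andP[_ sy] uy _ _] := S2.
case: s S2 S3 vy sy uy => [|z s] S2 S3 vy sy uy; last first.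
  have := stuck_size H n5 L S3 isT; rewrite hl => h; apply: nF; rewrite El.
  apply: (Fin3 (xs := [:: 5; 5; 5]) (ys := [:: 5]) (zs := [:: 5]) sP sQ sy) => //.
  - by rewrite catA.
  - by rewrite p19.
  - by rewrite q9.
  - by rewrite /=; move: h; rewrite /=; clear; lia.
move: vy; rewrite inE => /eqP Ev; rewrite -Ev in S3.
have [vP nbv] := stuck_singleton H S3.
have cv : 9 <= count (e v) P by have := deg_count H uP nbv; rewrite hl.
have c0 : (count (e v) s0).*2 <= size s0 by apply: single_count_prefix L vP E.
have c1 : (count (e v) s1).*2 <= size s1.
  by apply: (@single_count_suffix P v (rcons s0 a) s1) => //; rewrite cat_rcons.
have sz : size s0 + size s1 = 18 by have := p19; rewrite E size_cat /=; clear; lia.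
have csum : count (e v) P = count (e v) s0 + (e v a + count (e v) s1) by rewrite E count_cat.
have q9' : (size t').+1 = 9 := q9; rewrite q9' in q0 q1.
have [z0 z1] : size s0 = 9 /\ size s1 = 9 by clear -sz q0 q1; lia.
have va1 : (e v a : nat) <= 1 by case: (e v a).
(* Each side of nine vertices contains at most four neighbours of [v] and the hub is at most one
   more, so nine neighbours force equality. *)
have [C0 C1] : count (e v) s0 = 4 /\ count (e v) s1 = 4.
  by clear -cv csum c0 c1 z0 z1 va1; lia.
have [||m0 [y1 [r0 [r1 [y2 [m1 [E0 E1 _ _ [h0 h1 pR]]]]]]]] := through_single L vP E.
- by rewrite has_count C0.
- by rewrite has_count C1.
rewrite C0 in h0; rewrite C1 in h1.
have [_ sR] := andP pR; apply: nF; rewrite El.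
(* The rerouted path has at least 7 + 3 + 7 vertices; the freed hub together with the outside path
   has exactly 10. *)
apply: (Fin2 (xs := [:: 5; 5; 5]) (ys := [:: 5; 5]) sR (_ : sorted e (a :: y0 :: s'))) => //.
- by rewrite /= esym ya; case/andP: py => _ /= ->.
- have uu : uniq (v :: P ++ y0 :: s').
    rewrite -(perm_uniq (s1 := v :: P ++ x' :: t')) /= ?vn ?u //.
    by rewrite perm_cons perm_cat2l perm_sym.
  by rewrite E E0 E1 in uu; ucount uu.
- by rewrite size_cat /=; clear -h0 h1; lia.
- by rewrite /= in z' *; rewrite z'.
Qed.

End SingleVertices.

(** * Two equal odd paths *)

Section Component.
Variables (T : finType) (e : rel T).
Hypothesis (esym : symmetric e).

(** The component of [v] in G - a, obtained by deleting the edges at [a] instead of the vertex. For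
    v = a it degenerates to the singleton of [a]. *)
Definition component (a v : T) : {set T} :=
  [set z | connect (fun x y => [&& e x y, x != a & y != a]) v z].

Let r a : rel T := fun x y => [&& e x y, x != a & y != a].

Lemma comp_self a v : v \in component a v.
Proof. by rewrite inE connect0. Qed.

Lemma comp_neq a v : v != a -> a \notin component a v.
Proof.
move=> va; rewrite inE; apply/negP => /connectP[p]; case/lastP: p => [|p z] /=.
  by move=> _ E; rewrite E eqxx in va.
by rewrite rcons_path last_rcons => /andP[_ /and3P[_ _ +]] E; rewrite E eqxx.
Qed.

Lemma comp_step a v x y : v != a -> x \in component a v -> e x y -> y != a -> y \in component a v.
Proof.
move=> va xK xy ya; have xa : x != a by apply: contraNneq (comp_neq va) => E; rewrite -{1}E.
move: xK; rewrite !inE => /connect_trans; apply; apply: connect1.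
by rewrite xy xa ya.
Qed.

Lemma comp_sub a v (C : {set T}) x : v != a ->
  (forall y z, y \in C -> e y z -> z \in C \/ z = a) -> x \in C -> x \in component a v ->
  component a v \subset C.
Proof.
move=> va cl xC; have sr : symmetric (r a).
  by move=> y z; rewrite /r esym; congr andb; rewrite andbC.
have cs := sym_connect_sym sr.
have clC : closed (r a) (mem C).
  apply: (intro_closed cs) => y z /and3P[yz _ za] yC.
  by case: (cl y z yC yz) => // E; rewrite E eqxx in za.
rewrite inE => vx; have vC := closed_connect clC vx; apply/subsetP => z; rewrite inE => vz.
by rewrite -[z \in C](closed_connect clC vz) vC.
Qed.

Lemma comp_conn a v : v != a -> conn e (component a v).
Proof.
move=> va X XK /set0Pn[x xX] cl; apply/eqP; rewrite eqEsubset XK.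
have xK := subsetP XK x xX.
apply: (@comp_sub a v X x) => // y z yX yz.
case: (eqVneq z a) => [->|za]; [by right|left; apply: (cl y z yX _ yz)].
exact: (comp_step va (subsetP XK y yX) yz za).
Qed.

Lemma comp_all a v s : v != a -> sorted e s -> a \notin s ->
  {subset s <= component a v} \/ {in s, forall y, y \notin component a v}.
Proof.
move=> va; elim: s => [|x s IH] //=; first by left.
case: s IH => [|y s] IH.
  rewrite inE => _ _; case: (boolP (x \in component a v)) => xK; [left|right] => z; rewrite inE => /eqP->//.
move=> /andP[xy sy]; rewrite inE negb_or => /andP[xa ys].
have ya : y != a by apply: contraNneq ys => ->; rewrite mem_head.
have [h|h] := IH sy ys; [left|right] => z; rewrite inE => /orP[/eqP->|]; try exact: h.
  by apply: (comp_step va (h y (mem_head _ _))); rewrite // ?(eq_sym x) // esym.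
have := h y (mem_head _ _); apply: contra => xK.
exact: (comp_step va xK xy ya).
Qed.

End Component.

Section Components.
Variables (T : finType) (e : rel T) (ls : seq nat).
Hypothesis H : setting e ls.
Let esym : symmetric e := g_sym H.
Let eirr : irreflexive e := g_irr H.
Let lal : all okl ls := g_ok H.
Let nT : 2 * sumn ls <= #|T| := g_card H.
Let cT : conn e [set: T] := g_conn H.
Let nF : ~ Fin e ls := g_free H.
Let dT : forall x, (hsum ls).-1 <= #|[set y | e x y]| := g_deg H.
Local Notation d := (hsum ls).-1.
Local Notation lpathT := (lpath e [set: T]).

Lemma comp_deg a v x : v != a -> x \in component e a v -> d.-1 <= #|[set y in component e a v | e x y]|.
Proof.
move=> va xK; suff h : #|[set y | e x y]| <= 1 + #|[set y in component e a v | e x y]|.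
  by move: (leq_trans (dT x) h); clear; case: (hsum ls).-1.
rewrite -(cards1 a); apply: leq_trans (leq_card_setU _ _).
apply/subset_leq_card/subsetP => y; rewrite !inE => xy.
case: (eqVneq y a) => //= ya; rewrite xy andbT.
by have := comp_step va xK xy ya; rewrite inE.
Qed.

Lemma exists_out (s : seq T) : size s < #|T| -> exists v, v \notin s.
Proof.
move=> lt; apply/existsP; rewrite -negb_forall; apply: contraL lt => /forallP h.
rewrite -leqNgt; apply: leq_trans (card_size s); rewrite -cardsT.
by apply/subset_leq_card/subsetP => y _.
Qed.

Section TwoOdd.
Variables (l : nat) (P : seq T) (x : T) (t : seq T) (a : T) (s0 s1 : seq T) (y0 : T) (s : seq T).
Hypotheses (Els : ls = [:: l; l]) (lo : odd l) (l5 : 5 <= l) (L : lpathT P).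
Hypothesis LQ : lpath e (~: [set y in P]) (x :: t).
Hypothesis qd : d <= (size t).+1.
Hypothesis qd1 : (size t).+1 <= d.+1.
Hypothesis E : P = s0 ++ a :: s1.
Hypotheses (q0 : (size t).+1 <= size s0) (q1 : (size t).+1 <= size s1).
Hypotheses (y0a : e y0 a) (py : pth e (y0 :: s)) (pey : perm_eq (y0 :: s) (x :: t)).
Hypothesis cl : forall y z, y \in x :: t -> e y z -> z \in x :: t \/ z = a.

Let dl : d.+2 = l.
Proof. by rewrite Els /hsum /=; clear -lo l5; lia. Qed.

Lemma two_paths r1 r2 : sorted e r1 -> sorted e r2 -> uniq (r1 ++ r2) ->
  l <= size r1 -> l <= size r2 -> False.
Proof.
move=> h1 h2 u z1 z2; apply: nF; rewrite Els.
by apply: (Fin2 (xs := [:: l]) (ys := [:: l]) h1 h2 u); rewrite //= addn0.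
Qed.

Let uP : uniq P. Proof. by have [/andP[]] := L. Qed.

Let pl : size P < l.*2.
Proof. by have [pP _ _] := L; have := longest_lt H pP; rewrite Els /= addn0 addnn. Qed.

Let S : stuck e P x t.
Proof. by apply: (lpath_stuck H uP _ _ LQ) => [y|y z _ _]; rewrite !inE. Qed.

Let sy : size (y0 :: s) = (size t).+1.
Proof. exact: perm_size pey. Qed.

Let uu : uniq (s0 ++ a :: s1 ++ y0 :: s).
Proof.
have [_ u _ _] := S; have u' : uniq (P ++ y0 :: s).
  by rewrite -(perm_uniq (s1 := P ++ x :: t)) // perm_cat2l perm_sym.
by rewrite E in u'; ucount u'.
Qed.

Let S0 : sorted e (rcons s0 a).
Proof. by have [/andP[_ +] _ _] := L; rewrite E sorted_pivot => /andP[]. Qed.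

Let S1 : sorted e (a :: s1).
Proof. by have [/andP[_ +] _ _] := L; rewrite E sorted_pivot => /andP[]. Qed.

Let SQ : sorted e (a :: y0 :: s).
Proof. by rewrite /= esym y0a; case/andP: py. Qed.

Let arm0 : sorted e (s0 ++ a :: y0 :: s).
Proof. by rewrite sorted_pivot S0 SQ. Qed.

Let arm1 : sorted e (rev (y0 :: s) ++ a :: s1).
Proof. by rewrite sorted_pivot S1 -rev_cons sorted_rev ?SQ. Qed.

Let sz0 : l <= size (s0 ++ a :: y0 :: s).
Proof. by rewrite size_cat /=; have := sy; rewrite /=; clear -dl q0 qd l5; lia. Qed.

Let sz1 : l <= size (rev (y0 :: s) ++ a :: s1).
Proof. by rewrite size_cat size_rev sy /=; clear -dl q1 qd l5; lia. Qed.

Let c0 : size s0 < l.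
Proof.
rewrite ltnNge; apply/negP => h; apply: (two_paths (r1 := s0) _ arm1 _ h sz1).
  by move: S0; rewrite -cats1 => /cat_sorted2[].
by ucount uu.
Qed.

Let c1 : size s1 < l.
Proof.
rewrite ltnNge; apply/negP => h; apply: (two_paths (r1 := s1) _ arm0 _ h sz0).
  exact: path_sorted S1.
by ucount uu.
Qed.

Let aP : a \in P. Proof. by rewrite E mem_cat mem_head orbT. Qed.

Let QP y : y \in x :: t -> y \notin P.
Proof. by have [_ u _ _] := S; move: u; rewrite cat_uniq => /and3P[_ /hasPn h _] /h. Qed.

Let aQ : a \notin x :: t.
Proof. by apply/negP => /QP; rewrite aP. Qed.

Lemma last_edge u w b : sorted e (rcons (rcons u w) b) -> e w b.
Proof. by rewrite -!cats1 -catA sorted_pivot /= => /and3P[]. Qed.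

(** Rerouting P through [v] past the hub leaves a path on at least l vertices. If another vertex is
    skipped besides [a], one such vertex is adjacent to [a], and followed by [a] and the outside
    path it gives a second path on d + 2 = l vertices. *)
Lemma single_case v : v \notin P ++ x :: t -> (forall y, e v y -> y \in P) -> False.
Proof.
move=> vPQ nbv; have vP : v \notin P by apply: contra vPQ; rewrite mem_cat => ->.
have cv := deg_count H uP nbv; rewrite E count_cat /= in cv.
have va1 : (e v a : nat) <= 1 by case: (e v a).
have p0 := single_count_prefix H L vP (etrans E (Logic.eq_sym (cat_rcons a s0 s1))).
rewrite size_rcons -cats1 count_cat /= addn0 in p0.
have p1 := single_count_suffix H L vP E; rewrite /= in p1.
have [||m0 [y [r0 [r1 [z [m1 [E0 E1 vy vz [h0 h1 pR]]]]]]]] := through_single H L vP E.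
- by rewrite has_count lt0n; apply/negP => /eqP c; clear -c cv p1 c1 dl l5; lia.
- by rewrite has_count lt0n; apply/negP => /eqP c; clear -c cv p0 c0 dl l5; lia.
have [uR sR] := andP pR.
have szR : l <= size (m0 ++ y :: v :: z :: m1).
  by rewrite size_cat /=; clear -h0 h1 cv va1 dl l5; lia.
have uuv : uniq (v :: s0 ++ a :: s1 ++ y0 :: s).
  rewrite cons_uniq uu andbT.
  have -> : s0 ++ a :: s1 ++ y0 :: s = P ++ y0 :: s by rewrite E -catA.
  by rewrite mem_cat (perm_mem pey) -mem_cat.
have szw w : l <= size (w :: a :: y0 :: s).
  by have := sy; rewrite /=; clear -dl qd; lia.
case/lastP: r0 E0 => [|r0 w] E0; last first.
  apply: (two_paths sR (_ : sorted e (w :: a :: y0 :: s)) _ szR (szw w)).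
    have wa : e w a by apply: (@last_edge (m0 ++ y :: r0)); rewrite rcons_cat rcons_cons -E0 S0.
    by move: SQ; rewrite /= wa.
  by rewrite E0 E1 in uuv; ucount uuv.
case: r1 E1 => [|w r1] E1; last first.
  apply: (two_paths sR (_ : sorted e (w :: a :: y0 :: s)) _ szR (szw w)).
    by move: S1 SQ; rewrite E1 /= => /andP[aw _] ->; rewrite esym aw.
  by rewrite E0 E1 in uuv; ucount uuv.
(* Now [a] alone was skipped, so [v] replaces it on another longest path. The path [a :: y0 :: s]
   lies outside and is attached at both [y] and [z], so at least d + 1 vertices lie beyond each of
   them, more than |P| < 2l allows. *)
have LR : lpathT (m0 ++ y :: v :: z :: m1).
  by apply: longest_lpath L pR _; rewrite E E0 E1 !size_cat /= ?size_cat /=; clear; lia.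
have pA : pth e (a :: y0 :: s) by rewrite /pth SQ andbT; ucount uu.
have uA : uniq ((m0 ++ y :: v :: z :: m1) ++ a :: y0 :: s).
  by rewrite E0 E1 in uuv; ucount uuv.
have ya : e y a.
  by apply: (@last_edge m0); rewrite -[rcons m0 y]cats1 -E0 S0.
have az : e z a by move: S1; rewrite E1 /= esym => /andP[].
have [b0 _] := attach_ends esym LR pA uA (erefl _) ya.
have [_ b1] := attach_ends esym LR pA uA (catA m0 [:: y; v] (z :: m1)) az.
have := longest_lt H pR; rewrite Els size_cat /= in b0 b1 *; have := sy; rewrite /=.
by clear -b0 b1 dl qd; lia.
Qed.

(** In a component K with at least l vertices, Dirac's bound for minimum degree d - 1 provides a
    path on min(|K|, 2d - 1) >= l vertices, where l >= 5 is used. So no path on l vertices may avoid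
    K, and this determines where everything else lies until a contradiction appears. *)
Lemma component_small v : v != a -> #|component e a v| < l.
Proof.
move=> va; rewrite ltnNge; apply/negP => lK.
pose K := component e a v; have aK : a \notin K := comp_neq e va.
have [R LR] := ex_lpath e K; have [pR /isinP iR _] := LR; have [uR sR] := andP pR.
have szR : l <= size R.
  have := dirac_path esym eirr (comp_conn esym va) (fun y => comp_deg va) LR.
  apply: leq_trans; rewrite leq_min lK; clear -dl l5; lia.
(* The outside path has edges only to itself and [a]. Were it to meet K, it would contain K,
   although it has at most d + 1 = l - 1 vertices. *)
have QK y : y \in x :: t -> y \notin K.
  move=> yQ; apply/negP => yK.
  have clQ : forall z w, z \in [set u in x :: t] -> e z w -> w \in [set u in x :: t] \/ w = a.
    move=> z w; rewrite !(in_set (fun u => u \in x :: t)) => zQ zw; exact: (cl zQ zw).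
  have yQ' : y \in [set u in x :: t] by rewrite in_set.
  have := subset_leq_card (comp_sub esym va clQ yQ' yK); rewrite leqNgt.
  rewrite cardsE => /negP; apply; apply: leq_trans lK.
  by apply: leq_ltn_trans (card_size _) _; clear -qd1 dl; rewrite /=; lia.
have disj r2 : uniq r2 -> {in r2, forall y, y \notin K} -> uniq (R ++ r2).
  move=> u2 h; rewrite cat_uniq uR u2 andbT; apply/hasPn => y /h; apply: contra; exact: iR.
have yK : {in y0 :: s, forall y, y \notin K} by move=> y; rewrite (perm_mem pey); apply: QK.
have a0 : a \notin s0 by apply/negP => h; move: uu; rewrite cat_uniq => /and3P[_ /hasPn/(_ a (mem_head _ _)) + _]; rewrite /= h.
have a1 : a \notin s1 by apply/negP => h; move: uu; rewrite cat_uniq => /and3P[_ _] /=; rewrite mem_cat h.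
have srt0 : sorted e s0 by move: S0; rewrite -cats1 => /cat_sorted2[].
have srt1 : sorted e s1 by exact: path_sorted S1.
(* If [s0] were off K, then [s0], [a] and the outside path would form a path on l vertices avoiding
   K; the other side is treated alike. *)
have [K0|n0] := comp_all esym va srt0 a0; last first.
  apply: (two_paths sR arm0 _ szR sz0); apply: disj; first by ucount uu.
  by move=> y; rewrite mem_cat inE => /orP[/n0//|/orP[/eqP->//|/yK]].
have [K1|n1] := comp_all esym va srt1 a1; last first.
  apply: (two_paths sR arm1 _ szR sz1); apply: disj; first by ucount uu.
  by move=> y; rewrite mem_cat inE mem_rev => /orP[/yK//|/orP[/eqP->//|/n1]].
(* Otherwise connectedness gives a vertex off K and off the outside path that is adjacent to [a];
   followed by [a] and the outside path it forms a path on at least l vertices avoiding K. *)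
have cover z : [|| z \in K, z \in x :: t | z == a].
  apply: contraT => /norP[zK /norP[zQ za]].
  pose X := [set w | [&& w \notin K, w \notin x :: t & w != a]].
  case: (boolP [exists w in X, e w a]) => [/existsP[w /andP[]]|nex].
    rewrite in_set => /and3P[wK wQ wa] ewa; exfalso.
    apply: (two_paths sR (_ : sorted e (w :: a :: y0 :: s)) _ szR).
    - by move: SQ; rewrite /= ewa => ->.
    - apply: disj; last first.
        by move=> y; rewrite in_cons => /orP[/eqP->//|]; rewrite in_cons => /orP[/eqP->//|]; exact: yK.
      have : uniq (a :: y0 :: s) by ucount uu.
      have wn : w \notin a :: y0 :: s by rewrite in_cons negb_or wa (perm_mem pey) wQ.
      by move=> ua; rewrite cons_uniq wn.
    - by have := sy; rewrite /=; clear -dl qd; lia.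
  have XT : X = [set: T].
    apply: cT => //; first by apply/set0Pn; exists z; rewrite in_set zK zQ za.
    move=> u w; rewrite !(in_set (fun w => [&& w \notin K, w \notin x :: t & w != a])) => uX _ uw.
    have wa : w != a.
      apply: contra nex => /eqP <-; apply/existsP; exists u; rewrite uw andbT in_set; exact: uX.
    case/and3P: uX => uK uQ ua; rewrite wa andbT; apply/andP; split.
      apply: contra uK => wK; by apply: (comp_step va wK _ ua); rewrite esym.
    apply/negP => wQ; case: (cl wQ (_ : e w u)); rewrite ?(esym w) //.
      by move=> h; rewrite h in uQ.
    by move=> h; rewrite h eqxx in ua.
  by move: (in_setT a); rewrite -XT inE eqxx !andbF.
have [y yout] : exists y, y \notin P ++ x :: t.
  apply: exists_out; rewrite size_cat /=; have := nT; rewrite Els /= addn0.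
  by clear -pl qd1 dl; lia.
have [_ uPQ _ _] := S.
have clP w z : w \in x :: t -> e w z -> z \in x :: t \/ z \in P.
  by move=> wQ wz; case: (cl wQ wz) => [|->]; auto.
have [z [r [S2 yr]]] := ex_stuck1 H uPQ yout.
have S3 := stuck_ext H clP S2.
case: r S2 S3 yr => [|z' r] S2 S3 yr.
  move: yr; rewrite inE => /eqP Ey; rewrite -Ey in S3.
  have [_ nb] := stuck_singleton H S3; exact: single_case yout nb.
have n5 : ls <> [:: 5; 5; 5] by rewrite Els.
have qz := stuck_size H n5 L S3 isT.
pose Y2 := ~: [set y in P ++ x :: t].
have Y2E w : (w \in Y2) = (w \notin P) && (w \notin x :: t) by rewrite in_setC in_set mem_cat negb_or.
have [Q2 LQ2] := ex_lpath e Y2.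
have q2d : d <= size Q2.
  have [_ _ mx] := LQ2; apply: leq_trans qz _; have [p3 u3 _ _] := S2; apply: (mx _ p3); exact: uniq_out.
have q2d1 : size Q2 <= d.+1.
  have [p2 /isinP i2 _] := LQ2; have [_ _ mx] := LQ.
  apply: leq_trans qd1; apply: mx p2 _; apply/isinP => w /i2; rewrite Y2E in_setC in_set.
  by case/andP.
case: Q2 LQ2 q2d q2d1 => [|x2 t2] LQ2 q2d q2d1; first by clear -q2d dl l5; rewrite /= in q2d; lia.
have [|||||||a2 [u0 [u1 [y2 [r2 [E2 _ _ [y2a p2 pe2] cl2]]]]]] := block_attach H L _ _ LQ2.
- by move=> w; rewrite Y2E => /andP[].
- move=> u w; rewrite !Y2E => /andP[uP' uQ'] uw wP; rewrite wP andTb.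
  apply/negP => wQ; case: (cl wQ (_ : e w u)); rewrite ?(esym w) //.
    by move=> h; move: uQ'; rewrite h.
  by move=> h; rewrite h aP in uP'.
- by clear -dl l5; lia.
- exact: q2d.
- exact: q2d1.
- by clear -dl l5; lia.
- by clear -pl dl; lia.
have Q2out w : w \in x2 :: t2 -> w \notin P /\ w \notin x :: t.
  have [_ /isinP i2 _] := LQ2; move=> /i2; rewrite Y2E.
  by case/andP.
have y2Q : y2 \in x2 :: t2 by rewrite -(perm_mem pe2) mem_head.
(* With hub [a] the second outside path would be closed in G - a and meet K, hence contain K; but K
   contains [s0], which lies on P. *)
case: (eqVneq a2 a) => a2a.
  have cl2' : forall z w, z \in [set u in x2 :: t2] -> e z w -> w \in [set u in x2 :: t2] \/ w = a.
    by move=> u w; rewrite !(in_set (fun u => u \in x2 :: t2)) -a2a => uQ uw; exact: (cl2 _ _ uQ uw).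
  have y2in : y2 \in [set u in x2 :: t2] by rewrite in_set.
  have [y2P y2Q'] := Q2out y2 y2Q.
  have y2K : y2 \in K.
    have := cover y2; rewrite (negbTE y2Q') /= => /orP[//|/eqP h].
    by rewrite h aP in y2P.
  have := comp_sub esym va cl2' y2in y2K.
  case: (s0) K0 q0 E => // w s0' K0 _ E' /subsetP/(_ w (K0 w (mem_head _ _))).
  by rewrite in_set => /Q2out[]; rewrite E' mem_head.
have u2 : uniq (s0 ++ a :: s1 ++ (y0 :: s) ++ (y2 :: r2)).
  have : uniq (P ++ (x :: t) ++ (x2 :: t2)).
    rewrite catA cat_uniq uPQ; have [/andP[u2' _] _ _] := LQ2; rewrite u2' andbT.
    by apply/hasPn => w /Q2out[h1 h2]; rewrite /= mem_cat negb_or h1 h2.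
  have pp : perm_eq ((x :: t) ++ (x2 :: t2)) ((y0 :: s) ++ (y2 :: r2)).
    by rewrite perm_sym; apply: perm_cat.
  rewrite (perm_uniq (_ : perm_eq (P ++ (x :: t) ++ (x2 :: t2)) (P ++ (y0 :: s) ++ (y2 :: r2)))).
    by rewrite E -catA.
  by rewrite perm_cat2l.
have sz2 : size (y2 :: r2) = size (x2 :: t2) := perm_size pe2.
have a2P : a2 \in P by rewrite E2 mem_cat mem_head orbT.
have uP2 : uniq (P ++ y2 :: r2) by rewrite E; ucount u2.
have SQ2 : sorted e (a2 :: y2 :: r2) by rewrite /= esym y2a; case/andP: p2.
rewrite esym in y2a.
(* With its hub on one side of [a], the second outside path and the part of that side beyond the
   hub, away from [a], form a path on l vertices; the first outside path, [a] and the other side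
   form another. *)
move: a2P; rewrite E mem_cat inE (negbTE a2a) /= => /orP[] /mem_split[w0 [w1 Ew]].
  have EP : P = w0 ++ a2 :: (w1 ++ a :: s1) by rewrite E Ew -catA.
  have [b0 _] := attach_ends esym L p2 uP2 EP y2a.
  apply: (two_paths (_ : sorted e (w0 ++ a2 :: y2 :: r2)) arm1 _ _ sz1).
  - rewrite sorted_pivot SQ2 andbT; move: S0; rewrite Ew -cats1 -catA sorted_pivot.
    by case/andP.
  - by rewrite Ew in u2; ucount u2.
  - rewrite sz2 in b0; rewrite size_cat /= in b0 q2d sz2 *; clear -b0 q2d sz2 dl l5; lia.
have EP : P = (s0 ++ a :: w0) ++ a2 :: w1 by rewrite E Ew -catA.
have [_ b1] := attach_ends esym L p2 uP2 EP y2a.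
apply: (two_paths (_ : sorted e (rev (y2 :: r2) ++ a2 :: w1)) arm0 _ _ sz0).
- rewrite sorted_pivot -rev_cons sorted_rev // SQ2 /=; move: S1; rewrite Ew -cat_cons sorted_pivot.
  by case/andP.
- by rewrite Ew in u2; ucount u2.
- rewrite sz2 in b1; rewrite size_cat size_rev sz2 /= in b1 q2d *; clear -b1 q2d dl l5; lia.
Qed.

End TwoOdd.

Lemma two_odd l P x t : ls = [:: l; l] -> odd l -> lpathT P -> stuck e P x t -> 0 < size t ->
  exists a, forall v, v != a -> #|component e a v| < l.
Proof.
move=> Els lo L S t0; have l5 : 5 <= l.
  have := lal; rewrite Els /okl /= => /andP[/andP[h2 h3] _]; clear -h2 h3 lo; lia.
have dl : d.+2 = l by rewrite Els /hsum /=; clear -lo l5; lia.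
have n5 : ls <> [:: 5; 5; 5] by rewrite Els.
have qd := stuck_size H n5 L S t0.
have [/andP[uP sP] _ _] := L; have pl := longest_ge H L.
have [pQ u _ _] := S.
pose Y := ~: [set y in P].
have [Q LQ] := ex_lpath e Y.
have szQ : d <= size Q.
  have [_ _ mx] := LQ; apply: leq_trans qd _; apply: (mx _ pQ); exact: uniq_out.
case: Q LQ szQ => [|x' t'] LQ szQ; first by clear -szQ dl l5; rewrite /= in szQ; lia.
have YP : {in Y, forall y, y \notin P} by move=> y; rewrite !inE.
have cY : forall y z, y \in Y -> e y z -> z \notin P -> z \in Y by move=> y z _ _; rewrite !inE.
have S' := lpath_stuck H uP YP cY LQ.
have [pQ' u' _ _] := S'; have [uQ' sQ'] := andP pQ'.
have qd1 : size (x' :: t') <= d.+1.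
  rewrite leqNgt; apply/negP => h; apply: (two_paths Els sP sQ' u'); last by rewrite -dl.
  by clear -pl dl l5; lia.
have [|||||a [s0 [s1 [y0 [s [E q0 q1 [ya py pey] cl]]]]]] := block_attach H L YP cY LQ.
- by clear -dl l5; lia.
- exact: szQ.
- exact: qd1.
- by clear -dl l5; lia.
- have h : size P < l + l by have [pP _ _] := L; move: (longest_lt H pP); rewrite Els /= addn0.
  by clear -dl h; lia.
exists a => v; exact: (component_small Els lo l5 L LQ szQ qd1 E q0 q1 ya py pey cl).
Qed.

End Components.

(** * Three paths on five vertices *)

Section OutsideEdge.
Variables (T : finType) (e : rel T) (ls : seq nat).
Hypothesis H : setting e ls.
Let esym : symmetric e := g_sym H.
Let eirr : irreflexive e := g_irr H.
Let lsz : 1 < size ls := g_size H.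
Let lso : sorted geq ls := g_sorted H.
Let lal : all okl ls := g_ok H.
Let nF : ~ Fin e ls := g_free H.
Local Notation d := (hsum ls).-1.
Local Notation lpathT := (lpath e [set: T]).

Lemma cat_pivot_eq (s0 s0' s1 s1' : seq T) a a' : size s0 = size s0' ->
  s0 ++ a :: s1 = s0' ++ a' :: s1' -> [/\ s0 = s0', a = a' & s1 = s1'].
Proof. by move=> sz /eqP; rewrite eqseq_cat // => /andP[/eqP-> /eqP[-> ->]]. Qed.

Section ThreeP5.
Hypothesis Els : ls = [:: 5; 5; 5].

Let dE : d = 5. Proof. by rewrite Els. Qed.

Lemma tri_out P s : lpathT P -> pth e s -> uniq (P ++ s) -> size s <= 4.
Proof.
move=> L ps u; rewrite leqNgt; apply/negP => h; apply: nF; rewrite Els.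
have [/andP[uP sP] _ _] := L; have [_ ss] := andP ps.
apply: (Fin2 (xs := [:: 5; 5]) (ys := [:: 5]) sP ss u) => //=.
by apply: leq_trans (longest_ge H L); rewrite dE.
Qed.

(** The exceptional case of [outside_small] has |P| = 14 and two common neighbours, and the end and
    gap conditions already ask for 4 + 1 + 4 + 1 + 4 vertices, so the hub positions are fixed. *)
Lemma tri_hubs P y s : lpathT P -> stuck e P y s -> 0 < size s ->
  size s = 3 /\ exists a b s0 s1 s2, [/\ P = s0 ++ a :: s1 ++ b :: s2,
    [/\ size s0 = 4, size s1 = 4 & size s2 = 4], e (last y s) a, e y b &
    forall z, z \in P -> e y z = (z == a) || (z == b)].
Proof.
move=> L S s0'; have [pQ u _ _] := S.
have [|_ z3 z14 c2 eqe] := outside_small H L S s0'.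
  by rewrite dE; have := tri_out L pQ u; rewrite /=; clear; lia.
split=> //.
have : has (e y) P by rewrite has_count c2.
case/split_first => s0 [a [r [E n0 ya]]].
have cn (q : seq T) : ~~ has (e y) q -> count (e y) q = 0.
  by move=> h; apply/eqP; rewrite -leqn0 leqNgt -has_count.
have c1 : count (e y) r = 1.
  by move: c2; rewrite E count_cat /= ya (cn _ n0); clear; lia.
have : has (e y) r by rewrite has_count c1.
case/split_first => s1 [b [s2 [Er n1 yb]]].
have n2 : ~~ has (e y) s2.
  by rewrite has_count; move: c1; rewrite Er count_cat /= yb (cn _ n1); clear; lia.
have EP : P = s0 ++ a :: s1 ++ b :: s2 by rewrite E Er.
have EP' : P = (s0 ++ a :: s1) ++ b :: s2 by rewrite EP -catA.
have aP : a \in P by rewrite E mem_cat mem_head orbT.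
have [b0 _] := outside_ends esym L pQ u E (introT orP (or_introl ya)).
have [_ b2] := outside_ends esym L pQ u EP' (introT orP (or_introl yb)).
have [b1 _] := outside_gaps esym L pQ u EP.
have wb : e (last y s) b by rewrite -eqe // EP' mem_cat mem_head orbT.
move: b1; rewrite ya wb => /(_ isT) b1.
rewrite /= z3 in b0 b1 b2; exists a, b, s0, s1, s2; split=> //.
- by move: z14; rewrite EP size_cat /= size_cat /=; clear -b0 b1 b2; split; lia.
- by rewrite -eqe.
move=> z; rewrite EP mem_cat in_cons mem_cat in_cons.
have nn (q : seq T) : ~~ has (e y) q -> z \in q -> e y z = false.
  by move=> /hasPn h zq; apply/negbTE; apply: h.
case: (eqVneq z a) => [->|za]; first by rewrite ya.
case: (eqVneq z b) => [->|zb]; first by rewrite yb orbT.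
by rewrite !orFb => /or3P[] h; [exact: nn n0 h|exact: nn n1 h|exact: nn n2 h].
Qed.

(** An end of a longest outside path has two neighbours on P, hence by d = 5 all three other
    vertices of the path. The path thus closes into a cycle, every vertex is such an end, and it
    spans K_4. All its vertices have the same hubs because the hub positions on P are fixed. *)
Lemma tri_block P s : lpathT P -> pth e s -> uniq (P ++ s) -> size s = 4 ->
  exists a b s0 s1 s2, [/\ P = s0 ++ a :: s1 ++ b :: s2,
    [/\ size s0 = 4, size s1 = 4 & size s2 = 4] &
    forall y z, y \in s -> e y z = (z == a) || (z == b) || (z \in s) && (z != y)].
Proof.
move=> L ps u z4; have [/andP[uP sP] _ _] := L; case: s ps u z4 => // x t ps u z4.
pose Y := ~: [set y in P].
have LQ : lpath e Y (x :: t).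
  split=> //; first exact: uniq_out.
  move=> s' ps' is'; rewrite z4; have [us' _] := andP ps'.
  by apply: tri_out L ps' _; apply: out_uniq.
have YP : {in Y, forall y, y \notin P} by move=> y; rewrite !inE.
have cY : forall y z, y \in Y -> e y z -> z \notin P -> z \in Y by move=> y z _ _; rewrite !inE.
have t3 : size t = 3 by case: z4.
have deg3 y r : lpath e Y (y :: r) -> size r = 3 -> 3 <= count (e y) (y :: r).
  move=> Ly r3; have S := lpath_stuck H uP YP cY Ly; have [_ uy h _] := S.
  have [||_ _ _ c2 _] := outside_small H L S; rewrite ?r3 ?dE //.
  by have [+ _] := deg_split H uy h; rewrite c2 dE.
have Lr := lpath_rev esym LQ.
have Er : last x t :: rev (belast x t) = rev (x :: t) by rewrite (lastI x t) rev_rcons.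
have [|H1 H2] := lpath_closed esym eirr LQ.
  rewrite -Er in Lr; have := deg3 _ _ LQ t3; have := deg3 _ _ Lr; rewrite size_rev size_belast.
  move=> /(_ t3); rewrite Er count_rev z4; move: (count _ _) (count (e x) _) => m n; clear; lia.
have S := lpath_stuck H uP YP cY LQ.
have [|_ [a [b [s0 [s1 [s2 [E [z0 z1 z2] _ _ _]]]]]]] := tri_hubs L S; first by rewrite t3.
exists a, b, s0, s1, s2; split=> // y z yQ.
have [r [Ly pe]] := H1 y yQ; have r3 : size r = 3 by have := perm_size pe; rewrite z4; case.
have Sy := lpath_stuck H uP YP cY Ly.
have [|_ [a' [b' [s0' [s1' [s2' [E' [z0' z1' z2'] _ _ hub]]]]]]] := tri_hubs L Sy; first by rewrite r3.
have [|_ ea es] := cat_pivot_eq _ (etrans (Logic.eq_sym E) E'); first by rewrite z0.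
have [|_ eb _] := cat_pivot_eq _ es; first by rewrite z1.
subst a' b'.
case: (boolP (z \in P)) => zP.
  rewrite hub //; suff -> : z \in x :: t = false by rewrite orbF.
  by apply/negbTE/negP => zQ; move: u; rewrite cat_uniq => /and3P[_ /hasPn/(_ z zQ)]; rewrite /= zP.
have -> : (z == a) = false by apply: contraNF zP => /eqP->; rewrite E mem_cat mem_head orbT.
have -> : (z == b) = false.
  by apply: contraNF zP => /eqP->; rewrite E mem_cat in_cons mem_cat mem_head !orbT.
rewrite !orFb; apply/idP/idP.
  move=> yz; rewrite (H2 y z yQ) //=; last by rewrite !inE.
  by apply: contraTneq yz => ->; rewrite eirr.
case/andP => zQ zy; have : size r <= count (e y) r.
  by have := deg3 _ _ Ly r3; rewrite /= eirr r3.
move/(conj (count_size (e y) r))/andP; rewrite -eqn_leq -all_count => /allP; apply.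
by move: zQ; rewrite -(perm_mem pe) in_cons (negbTE zy).
Qed.

(** The exchange argument of the one-hub case, with three segments of P around two hubs: swapping a
    segment with the outside path preserves the hub positions. An outside vertex seeing only the
    hubs would have degree 2 < d. *)
Lemma tri_blocks P x t : lpathT P -> stuck e P x t -> 0 < size t ->
  exists a b, a != b /\ blocks e [set a; b] 4.
Proof.
move=> L S t0; have [t3 _] := tri_hubs L S t0.
have [/andP[uP sP] _ _] := L; have [pQ u _ _] := S.
have [|a [b [s0 [s1 [s2 [E [z0 z1 z2] B]]]]]] := tri_block L pQ u; first by rewrite /= t3.
have zQ : size (x :: t) = 4 by rewrite /= t3.
have uu : uniq (s0 ++ a :: s1 ++ b :: s2 ++ x :: t) by rewrite E in u; ucount u.
have nab : a != b.
  have : uniq [:: a; b] by ucount uu.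
  by rewrite /= inE andbT.
move: (sP); rewrite E sorted_pivot -cat_cons sorted_pivot => /and3P[S0 S1 S2].
have [uQ sQ] := andP pQ.
have xa : e x a by rewrite B ?mem_head ?eqxx.
have wa : e (last x t) a by rewrite B ?mem_last ?eqxx.
have xb : e x b by rewrite B ?mem_head ?eqxx ?orbT.
have wb : e (last x t) b by rewrite B ?mem_last ?eqxx ?orbT.
have pick P' s r0 r1 r2 : pth e P' -> P' = r0 ++ a :: r1 ++ b :: r2 -> size r0 = 4 ->
    size r1 = 4 -> size r2 = 4 -> pth e s -> size s = 4 -> uniq (P' ++ s) ->
    forall y z, y \in s -> e y z = (z == a) || (z == b) || (z \in s) && (z != y).
  move=> pP' E' y0 y1 y2 ps zs us.
  have L' : lpathT P'.
    apply: longest_lpath L _ _ => //.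
    by rewrite E E'; do 3 rewrite ?size_cat /=; rewrite z0 z1 z2 y0 y1 y2.
  have [a' [b' [w0 [w1 [w2 [E'' [x0 x1 x2] B']]]]]] := tri_block L' ps us zs.
  have [|_ -> es] := cat_pivot_eq _ (etrans (Logic.eq_sym E') E''); first by rewrite y0.
  by have [|_ -> _] := cat_pivot_eq _ es; first by rewrite y1.
have srt0 : sorted e s0 by move: S0; rewrite -cats1 => /cat_sorted2[].
have srt1 : sorted e s1.
  by move: S1; rewrite rcons_cons -cats1 => /path_sorted/cat_sorted2[].
have srt2 : sorted e s2 by exact: path_sorted S2.
have SQb : sorted e (rcons (x :: t) b) by rewrite -cats1 sorted_cat sQ /= wb.
have SQa : sorted e (rcons (x :: t) a) by rewrite -cats1 sorted_cat sQ /= wa.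
have B0 : forall y z, y \in s0 -> e y z = (z == a) || (z == b) || (z \in s0) && (z != y).
  apply: (pick ((x :: t) ++ a :: s1 ++ b :: s2) s0 (x :: t) s1 s2) => //.
  - by rewrite /pth sorted_pivot SQa -cat_cons sorted_pivot S1 S2 !andbT; ucount uu.
  - by rewrite /pth srt0 andbT; ucount uu.
  - by ucount uu.
have B1 : forall y z, y \in s1 -> e y z = (z == a) || (z == b) || (z \in s1) && (z != y).
  apply: (pick (s0 ++ a :: (x :: t) ++ b :: s2) s1 s0 (x :: t) s2) => //.
  - rewrite /pth sorted_pivot S0 -cat_cons sorted_pivot S2 andbT rcons_cons /= (esym a) xa.
    by move: SQb => /= ->; rewrite andbT; ucount uu.
  - by rewrite /pth srt1 andbT; ucount uu.
  - by ucount uu.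
have B2 : forall y z, y \in s2 -> e y z = (z == a) || (z == b) || (z \in s2) && (z != y).
  apply: (pick (s0 ++ a :: s1 ++ b :: x :: t) s2 s0 s1 (x :: t)) => //.
  - rewrite /pth sorted_pivot S0 -cat_cons sorted_pivot S1 /= (esym b) xb.
    by move: sQ => /= ->; rewrite andbT; ucount uu.
  - by rewrite /pth srt2 andbT; ucount uu.
  - by ucount uu.
have abP w : (w == a) || (w == b) -> w \in P.
  by case/orP => /eqP ->; rewrite E mem_cat in_cons mem_cat in_cons eqxx ?orbT.
have mk s v : v \in s -> uniq (a :: b :: s) -> size s = 4 ->
    (forall y z, y \in s -> e y z = (z == a) || (z == b) || (z \in s) && (z != y)) ->
    exists C : {set T}, [/\ v \in C, #|C| = 4 &
      forall y, y \in C -> y \notin [set a; b] /\ forall z, e y z = (z \in [set a; b]) || (z \in C) && (z != y)].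
  move=> vs us zs Bs; exists [set y in s]; split; rewrite ?in_set //.
    by rewrite cardsE -zs; apply/card_uniqP; case/and3P: us.
  move=> y; rewrite in_set => ys; split; last first.
    by move=> z; rewrite in_setU !in_set1 in_set; apply: Bs.
  rewrite in_setU !in_set1.
  have /and3P[+ bs _] := us; rewrite in_cons negb_or => /andP[_ as_].
  by apply/negP => /orP[/eqP E1|/eqP E1]; [move: as_|move: bs]; rewrite -E1 ys.
exists a, b; split=> // v; rewrite in_setU !in_set1 negb_or => /andP[va vb].
case: (boolP (v \in P)) => vP.
  move: vP; rewrite E mem_cat in_cons mem_cat in_cons (negbTE va) (negbTE vb) /= => /or3P[] vs.
  - by apply: (mk s0) => //; ucount uu.
  - by apply: (mk s1) => //; ucount uu.
  - by apply: (mk s2) => //; ucount uu.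
have [x' [t' [S' vt']]] := ex_stuck1 H uP vP.
case: t' S' vt' => [|y' t'] S' vt'.
  move: vt' S'; rewrite inE => /eqP <- /(stuck_singleton H)[_ nb].
  have nbab y : e v y -> y \in [:: a; b].
    move=> vy; have := nb y vy; rewrite !in_cons orbF E mem_cat in_cons mem_cat in_cons.
    have no (s : seq T) : (forall y z, y \in s -> e y z = (z == a) || (z == b) || (z \in s) && (z != y)) ->
       {subset s <= P} -> y \in s -> False.
      move=> Bs sub ys; move: vy; rewrite esym Bs // (negbTE va) (negbTE vb) /= => /andP[vs _].
      by rewrite (sub v vs) in vP.
    case/or4P => [h|->//|h|/orP[->|h]]; rewrite ?orbT //.
    + by exfalso; apply: (no s0 B0 _ h) => w ws; rewrite E mem_cat ws.
    + by exfalso; apply: (no s1 B1 _ h) => w ws; rewrite E mem_cat in_cons mem_cat ws !orbT.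
    + by exfalso; apply: (no s2 B2 _ h) => w ws; rewrite E mem_cat in_cons mem_cat in_cons ws !orbT.
  have uab : uniq [:: a; b] by rewrite /= inE nab.
  have := deg_count H uab nbab; rewrite dE leqNgt => /negP; case.
  by apply: leq_ltn_trans (count_size _ _) _.
have [z' _] := tri_hubs L S' isT.
have [pQ' u' _ _] := S'; have zQ' : size [:: x', y' & t'] = 4 by rewrite /= in z' *; rewrite z'.
apply: (mk _ v vt' _ zQ' (pick P _ s0 s1 s2 (introT andP (conj uP sP)) E z0 z1 z2 pQ' zQ' u')).
by rewrite E in u'; ucount u'.
Qed.

End ThreeP5.

Lemma outside_edge P x t : lpathT P -> stuck e P x t -> 0 < size t ->
  [\/ exists l a, [/\ 2 <= l, type1 l ls & blocks e [set a] l.-1],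
      exists l a, [/\ 2 <= l, odd l, ls = [:: l; l] & forall v, v != a -> #|component e a v| < l] |
      ls = [:: 5; 5; 5] /\ exists a b, a != b /\ blocks e [set a; b] 4].
Proof.
move=> L S t0; case: (bin_packing lsz lso lal).
- move=> [xs [ys [pe sy sx]]]; case: (ltnP (size t).+1 d) => qd.
    have [El _ _ _ _] := outside_small H L S t0 qd.
    by apply: Or33; split=> //; apply: tri_blocks L S t0.
  exfalso; apply: nF; have [/andP[_ sP] _ _] := L; have [/andP[_ sQ] u _ _] := S.
  apply: (Fin2 sP sQ u pe); last exact: leq_trans qd.
  apply: leq_trans (longest_ge H L); apply: leq_trans sx _.
  by have := hsum_gt1 H; clear; lia.
- by move=> El; case: (five_P5 H El L S t0).
- move=> [l [l2 ty]]; have [a B] := type1_blocks H ty L S t0.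
  apply: Or31; exists l, a; split=> //.
  by have [hl _] := type1_facts H ty; rewrite -hl.
- move=> [l [l2 lo El]]; have [a h] := two_odd H El lo L S t0.
  by apply: Or32; exists l, a.
Qed.

End OutsideEdge.

(** * Longest paths with an independent complement *)

Section Bits.
Variables (T : Type) (b : pred T).

(** No three consecutive entries fail [b]; initial and final gaps are included. *)
Fixpoint nof3 (s : seq T) : bool :=
  if s is x :: t then (if t is y :: z :: _ then [|| b x, b y | b z] else true) && nof3 t else true.

Lemma nof3_pivot s1 x s2 : b x -> nof3 s1 -> nof3 s2 -> nof3 (s1 ++ x :: s2).
Proof.
move=> bx; elim: s1 => [|u s1 IH] /=.
  by move=> _ ->; rewrite andbT bx; case: s2 => // y [].
move=> /andP[h1 h2] h3; rewrite IH // andbT.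
case: s1 h1 {h2 IH} => [|v [|w s1]] //= h1; last by rewrite bx ?orbT.
by case: s2 {h3} => //= y s2; rewrite bx orbT.
Qed.

Lemma nof3_sub s1 s2 : nof3 (s1 ++ s2) -> nof3 s2.
Proof. by elim: s1 => //= x s1 IH /andP[_ /IH]. Qed.

Lemma nof3N s : ~~ nof3 s -> exists s1 x y z s2,
  s = s1 ++ x :: y :: z :: s2 /\ [/\ ~~ b x, ~~ b y & ~~ b z].
Proof.
elim: s => //= x s IH; rewrite negb_and => /orP[|/IH[s1 [u [v [w [s2 [-> h]]]]]]]; last first.
  by exists (x :: s1), u, v, w, s2.
case: s {IH} => // y [|z s] //; rewrite !negb_or => /and3P[h1 h2 h3].
by exists [::], x, y, z, s.
Qed.

Lemma sparse_weight x s : sparse b (x :: s) ->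
  (count b (x :: s)).*2 < (size s).+1 + b x + b (last x s).
Proof.
elim: s x => [|y s IH] x; first by rewrite /=; case: (b x).
move=> /andP[nb h]; have := IH y h; rewrite /=; move: nb.
by case: (b x); case: (b y) => //= _; clear; lia.
Qed.

(** Three consecutive misses would leave two sparse pieces; bounding twice the count on each by its
    size, up to the outer ends, gives a total three below [size + b x + b last], against the
    hypothesis. *)
Lemma sparse_nof3 x s : sparse b (x :: s) ->
  (size s).+1 + b x + b (last x s) < (count b (x :: s)).*2 + 3 -> nof3 (x :: s).
Proof.
move=> sp lt; apply: contraT => /nof3N[s1 [u [v [w [s2 [E [bu bv bw]]]]]]].
have hd : b (head x s1) <= b x.
  by case: s1 E => [|x1 s1] //= [<- _].
have ls : b (last w s2) = b (last x s).
  by have := congr1 (last x) E; rewrite last_cat /= => E'; rewrite E'.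
have cE : count b (x :: s) = count b s1 + count b s2.
  by rewrite E count_cat /= (negbTE bu) (negbTE bv) (negbTE bw).
have sE : (size s).+1 = size s1 + size s2 + 3.
  by have := congr1 size E; rewrite /= size_cat /=; clear; lia.
rewrite E in sp; have [sp1 sp2] := sparse_cat sp.
have {}sp2 : sparse b s2.
  by have [_ +] := @sparse_cat _ b [:: u; v; w] s2 sp2.
have w1 : (count b s1).*2 <= size s1 + b x.
  case: s1 sp1 hd {E cE sE sp} => // y s1 /sparse_weight /= + hd.
  by case: (b (last y s1)) => /= h; clear -hd h; lia.
have w2 : (count b s2).*2 <= size s2 + b (last x s).
  rewrite -ls; case: s2 sp2 {E cE sE sp ls} => // y s2 /sparse_weight /=.
  by case: (b y) => /= h; clear -h; lia.
by clear -w1 w2 lt cE sE; lia.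
Qed.

End Bits.

(** An entry with [b2] but not [b1] is neither first nor last, and sparseness of the union keeps
    both its list neighbours out of [b1]: three consecutive misses. *)
Lemma sparse_union_eq (T : finType) (b1 b2 : pred T) s :
  sparse (predU b1 b2) s -> nof3 b1 s ->
  (forall x s', s = x :: s' -> ~~ b2 x) -> (forall s' x, s = rcons s' x -> ~~ b2 x) ->
  {in s, forall x, b2 x -> b1 x}.
Proof.
move=> sp n3 hd ls x /mem_split[s1 [s2 E]] b2x; apply: contraT => nb1.
case/lastP: s1 E => [|s1 y] E; first by move: (hd _ _ E); rewrite b2x.
case: s2 E => [|z s2] E.
  by move: (ls (rcons s1 y) x); rewrite E cats1 => /(_ erefl); rewrite b2x.
move: sp n3; rewrite E cat_rcons => /sparse_cat[_ +] /nof3_sub.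
rewrite /sparse /= b2x orbT andbT /= => /and3P[h1 h2 _] /andP[+ _].
by move: h1 h2; rewrite (negbTE nb1) /=; case: (b1 y); case: (b1 z).
Qed.

(** * Greedy removal of the odd components *)

Section Greedy.
Variables (T : finType) (e : rel T).
Hypothesis esym : symmetric e.

(* The odd components are cut off the left end of the path [R], a vertex of [U] being appended
   to a segment on an even number of vertices whenever some end of the segment allows it. *)
Lemma greedy os n ex U (R : seq T) : all (leq 1) os -> sorted e R -> 0 < ex ->
  size R + 1 = (sumn os + n).*2 + ex -> size os <= size U ->
  {in U, forall w, sparse (e w) R} ->
  (exists ss r, [/\ map size ss = map (fun h => h.*2.+1) os, all (sorted e) ss, sorted e r,
     n.*2 <= size r & forall z, count_mem z (flatten ss ++ r) <= count_mem z (U ++ R)]) \/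
  exists U', [/\ subseq U' U, size U <= size U' + size os &
    {in U', forall w, count (e w) R < sumn os + n /\ ((count (e w) R).+1 = sumn os + n -> (forall x s, R = x :: s -> ~~ e w x) ->
       (forall s x, R = rcons s x -> ~~ e w x) -> nof3 (e w) R)}].
Proof.
(* [os] lists the halves of the odd components, [n] is the half sum of the even ones, and [ex] is
   the excess of |R| over 2([sumn os + n]) - 1. Keeping it positive leaves 2n vertices for the even
   components at the end. *)
elim: os ex U R => [|h os IH] ex U R /=.
  move=> _ sR ex0 sz _ _; left; exists [::], R; split=> //.
    by clear -sz ex0; rewrite add0n in sz; lia.
  by move=> z; rewrite /= count_cat leq_addl.
move=> /andP[h1 os1] sR ex0 sz szU spU.
have le : h.*2 <= size R by clear -sz ex0; lia.
case ER1 : (take h.*2 R) (size_takel le) => [|x t] sR1; first by clear -sR1 h1; rewrite /= in sR1; lia.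
have ER : R = (x :: t) ++ drop h.*2 R by rewrite -ER1 cat_take_drop.
move: (drop h.*2 R) ER {ER1} => R2 ER.
have sR2 : size R2 + 1 = (sumn os + n).*2 + ex.
  by move: sz; rewrite ER size_cat sR1; clear; lia.
have /and3P[S1 S2 _] : [&& sorted e (x :: t), sorted e R2 & lk e (x :: t) R2].
  by rewrite -sorted_cat -ER.
have sp w : w \in U -> sparse (e w) (x :: t) /\ sparse (e w) R2.
  by move=> /spU; rewrite ER => /sparse_cat.
have lR2 R3 s' y : R2 = R3 ++ rcons s' y -> R = rcons ((x :: t) ++ R3 ++ s') y.
  by rewrite ER => ->; rewrite !rcons_cat.
case: (boolP (has (fun w => e w x || e w (last x t)) U)) => [|none].
  case/split_first => U1 [w [U2 [EU _ wx]]].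
  have [p [sp1 sp2 sp3]] : exists p, [/\ sorted e p, size p = h.*2.+1 & perm_eq p (w :: x :: t)].
    case/orP: wx => wx.
      by exists (w :: x :: t); split=> //; [rewrite /= wx|rewrite /= -sR1].
    exists (w :: rev (x :: t)); split=> //; last by rewrite perm_cons perm_rev.
      have Er : last x t :: rev (belast x t) = rev (x :: t) by rewrite (lastI x t) rev_rcons.
      by move: S1; rewrite -(sorted_rev esym) -Er /= wx.
    by rewrite /= size_rev sR1.
  have [||[ss [r [m1 m2 m3 m4 m5]]]|[U' [sub le' hU']]] := IH ex (U1 ++ U2) R2 os1 S2 ex0 sR2.
  - by move: szU; rewrite EU !size_cat /=; clear; lia.
  - by move=> u; rewrite mem_cat => uU; have [] := sp u; rewrite // EU mem_cat in_cons; case/orP: uU => ->; rewrite ?orbT.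
  - left; exists (p :: ss), r; split=> //=.
    + by rewrite sp2 m1.
    + by rewrite sp1.
    move=> z; have := m5 z; have /permP/(_ (pred1 z)) := sp3.
    rewrite ER EU; clear; do 4 rewrite /= ?count_cat; lia.
  right; exists U'; split.
  - rewrite EU; apply: subseq_trans sub _; apply: cat_subseq => //; exact: subseq_cons.
  - by move: le'; rewrite EU !size_cat /=; clear; lia.
  move=> u uU'; have [c2 n2] := hU' u uU'.
  have uU : u \in U.
    by have := mem_subseq sub uU'; rewrite EU !mem_cat in_cons; case/orP=> ->; rewrite ?orbT.
  have [p1 p2] := sp u uU; have wt := sparse_weight p1; rewrite -[(size t).+1]/(size (x :: t)) sR1 in wt.
  have b1 : (e u x : nat) <= 1 by case: (e u x).
  have b2 : (e u (last x t) : nat) <= 1 by case: (e u (last x t)).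
  have cE : count (e u) R = count (e u) (x :: t) + count (e u) R2 by rewrite ER count_cat.
  split; first by rewrite cE; clear -wt b1 b2 c2; lia.
  move=> tight hd ls; have ux := hd x (t ++ R2) ER.
  rewrite (negbTE ux) in wt; rewrite cE in tight.
  have [t1 t2] : count (e u) (x :: t) = h /\ (count (e u) R2).+1 = sumn os + n.
    by clear -tight wt b2 c2; lia.
  have lT : e u (last x t) by rewrite t1 in wt; move: wt; case: (e u _) => //; clear; lia.
  have n1 : nof3 (e u) (x :: t).
    apply: sparse_nof3 p1 _; rewrite (negbTE ux) lT -[(size t).+1]/(size (x :: t)) sR1 t1; clear; lia.
  case: R2 ER S2 sR2 sp lR2 hU' c2 n2 p2 cE t2 tight => [|y R3] ER S2 sR2 sp lR2 hU' c2 n2 p2 cE t2 tight.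
    by rewrite ER cats0.
  have nl : ~~ e u y.
    have := spU u uU; rewrite ER (lastI x t) cat_rcons => /sparse_cat[_].
    by rewrite /sparse /= lT /= => /andP[].
  have n3 : nof3 (e u) (y :: R3).
    apply: n2 => //; first by move=> z s [<-].
    move=> s z Es; apply: (ls ((x :: t) ++ s)); rewrite rcons_cat -Es //.
  rewrite ER lastI cat_rcons; apply: nof3_pivot => //.
  move: n1; rewrite lastI -cats1; clear; elim: (belast x t) => //= v s IH /andP[h1 h2].
  rewrite IH // andbT; case: s h1 {IH h2} => [|v' [|v'' s]] //=.
have nx w : w \in U -> ~~ e w x /\ ~~ e w (last x t).
  by move=> wU; have := hasPn none w wU; rewrite negb_or => /andP.
(* A sparse neighbourhood that avoids both ends of a segment of 2h vertices has at most h - 1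
   elements there, one less than a segment could contribute. *)
have tightR1 w : w \in U -> count (e w) (x :: t) < h /\ ((count (e w) (x :: t)).+1 = h -> nof3 (e w) (x :: t)).
  move=> wU; have [p1 _] := sp w wU; have [u1 u2] := nx w wU.
  have := sparse_weight p1; rewrite (negbTE u1) (negbTE u2) -[(size t).+1]/(size (x :: t)) sR1 => wt.
  split; first by clear -wt; lia.
  move=> Eh; apply: sparse_nof3 p1 _; rewrite (negbTE u1) (negbTE u2) -[(size t).+1]/(size (x :: t)) sR1.
  by clear -Eh; lia.
case: ex ex0 sz sR2 => [|[|ex]] // _ sz sR2.
  right; exists U; split=> //; first by rewrite leq_addr.
  move=> w wU; have [c1 n1] := tightR1 w wU; have [_ p2] := sp w wU.
  have cE : count (e w) R = count (e w) (x :: t) + count (e w) R2 by rewrite ER count_cat.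
  have c2 := sparse_count_gen p2.
  split; first by rewrite cE; clear -c1 c2 sR2; lia.
  rewrite cE => tight hd ls.
  have [t1 t2] : (count (e w) (x :: t)).+1 = h /\ count (e w) R2 = sumn os + n.
    by clear -tight c1 c2 sR2; lia.
  case: R2 ER S2 sR2 sp lR2 p2 cE c2 t2 tight => [|y R3] ER S2 sR2 sp lR2 p2 cE c2 t2 tight.
    by rewrite ER cats0; exact: n1.
  have nl : ~~ e w (last y R3).
    by apply: (ls ((x :: t) ++ belast y R3)); rewrite rcons_cat -lastI.
  have := sparse_weight p2; rewrite (negbTE nl) addn0 -[(size R3).+1]/(size (y :: R3)) t2 => wt.
  have wy : e w y by move: wt; case: (e w y) => //; clear -sR2; rewrite /= in sR2 *; lia.
  rewrite ER; apply: nof3_pivot => //; first exact: n1.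
  have : nof3 (e w) (y :: R3).
    apply: sparse_nof3 p2 _; rewrite (negbTE nl) wy t2; clear -sR2; rewrite /= in sR2; lia.
  by case/andP.
case: R2 ER S2 sR2 sp lR2 => [|y R3] ER S2 sR2 sp lR2; first by clear -sR2; rewrite /= in sR2; lia.
have S3 : sorted e R3 by exact: path_sorted S2.
have sR3 : size R3 + 1 = (sumn os + n).*2 + ex.+1 by clear -sR2; rewrite /= in sR2; lia.
have Sy : sorted e (rcons (x :: t) y) by move: sR; rewrite ER sorted_pivot => /andP[].
have [||[ss [r [m1 m2 m3 m4 m5]]]|[U' [sub le' hU']]] := IH ex.+1 U R3 os1 S3 isT sR3.
- by apply: ltnW.
- by move=> w /sp[_]; rewrite -cat1s => /sparse_cat[].
- left; exists (rcons (x :: t) y :: ss), r; split=> //.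
  + by rewrite /= size_rcons -[(size t).+1]/(size (x :: t)) sR1 m1.
  + by move: Sy => /= ->.
  move=> z; have := m5 z; rewrite ER -cats1; clear; do 4 rewrite /= ?count_cat; lia.
right; exists U'; split=> //.
  by rewrite addnS; apply: leqW.
move=> w wU'; have wU := mem_subseq sub wU'; have [c3 n3] := hU' w wU'.
have [c1 n1] := tightR1 w wU; have [_ p2] := sp w wU.
have cE : count (e w) R = count (e w) (x :: t) + (e w y + count (e w) R3) by rewrite ER count_cat.
have b1 : (e w y : nat) <= 1 by case: (e w y).
split; first by rewrite cE; clear -c1 c3 b1; lia.
rewrite cE => tight hd ls.
have [t1 [t2 t3]] : (count (e w) (x :: t)).+1 = h /\ (e w y : nat) = 1 /\ (count (e w) R3).+1 = sumn os + n.
  by clear -tight c1 c3 b1; lia.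
have wy : e w y by case: (e w y) t2.
rewrite ER; apply: nof3_pivot => //; first exact: n1.
case: R3 ER sR2 sR3 S2 S3 sp lR2 Sy hU' c3 n3 p2 cE t3 tight => [|z R3] ER sR2 sR3 S2 S3 sp lR2 Sy hU' c3 n3 p2 cE t3 tight //.
apply: n3 => //.
  by move=> u s [<- _]; move: p2; rewrite /sparse /= wy /= => /andP[].
by move=> s u Es; apply: (ls ((x :: t) ++ y :: s)); rewrite rcons_cat rcons_cons -Es.
Qed.

End Greedy.

Lemma size_odd_le ls : all okl ls -> size ls + count odd ls <= hsum ls.
Proof.
elim: ls => //= l ls IH /andP[/andP[h2 h3] /IH]; rewrite /hsum /=.
by have := odd_double_half l; case: (odd l) => /=; lia.
Qed.

(** * The common neighbourhood of the outside vertices *)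

Section IndependentOutside.
Variables (T : finType) (e : rel T) (ls : seq nat).
Hypothesis H : setting e ls.
Let esym : symmetric e := g_sym H.
Let lsz : 1 < size ls := g_size H.
Let lal : all okl ls := g_ok H.
Let nT : 2 * sumn ls <= #|T| := g_card H.
Let nF : ~ Fin e ls := g_free H.
Local Notation d := (hsum ls).-1.
Local Notation lpathT := (lpath e [set: T]).

Section Independent.
Hypothesis noE : forall P x y, lpathT P -> x \notin P -> y \notin P -> ~~ e x y.

(* Rerouting through [w'] and [w] drops only [N]; the new path is longer than [P], or as long
   with an edge outside. *)
Lemma reroute P w w' S1 z z1 M b N tail : lpathT P -> w \notin P -> w' \notin P -> w != w' ->
  P = S1 ++ z :: (z1 :: M) ++ b :: N ++ tail -> e w' z -> e w z1 -> e w' b ->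
  sorted e (w :: tail) -> size N <= 2 -> False.
Proof.
move=> L wP wP' ww E wz wz1 wb st N2; have [/andP[uP sP] _ _] := L.
have uu : uniq (w :: w' :: P) by rewrite /= in_cons negb_or ww wP wP' uP.
rewrite E in uu.
have pR : pth e (S1 ++ z :: w' :: b :: rev (z1 :: M) ++ w :: tail).
  apply/andP; split; first by ucount uu.
  have /and3P[s1 s2 _] : [&& sorted e (rcons S1 z), sorted e (rcons (z :: z1 :: M) b) & sorted e (b :: N ++ tail)].
    by move: sP; rewrite E sorted_pivot -cat_cons sorted_pivot.
  rewrite sorted_pivot s1 /= esym wz wb.
  have s3 : sorted e (rev (rcons (z1 :: M) b)).
    by rewrite sorted_rev //; move: s2; rewrite /= => /andP[].
  move: s3; rewrite rev_rcons => s3; rewrite -[path _ _ _]/(sorted e (b :: rev (z1 :: M) ++ w :: tail)).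
  rewrite -cat_cons sorted_cat s3 st rev_cons -rcons_cons lk_rcons andTb.
  by rewrite esym.
have szP : size P = size S1 + size M + size N + size tail + 3.
  by rewrite E; do 4 rewrite ?size_cat /=; clear; lia.
have szR : size (S1 ++ z :: w' :: b :: rev (z1 :: M) ++ w :: tail) = size S1 + size M + size tail + 5.
  by do 4 rewrite ?(size_cat, size_rev) /=; clear; lia.
have := lpath_max L pR; rewrite szP szR => le.
have N2' : size N = 2 by clear -le N2; lia.
case: N N2' E uu le szP {N2} => [|n1 [|n2 [|]]] // _ E uu le szP.
have LR : lpathT (S1 ++ z :: w' :: b :: rev (z1 :: M) ++ w :: tail).
  by apply: longest_lpath L pR _; rewrite szP szR /=; clear; lia.
have uu' : uniq ([:: n1; n2] ++ (S1 ++ z :: w' :: b :: rev (z1 :: M) ++ w :: tail)) by ucount uu.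
have out n : n \in [:: n1; n2] -> n \notin S1 ++ z :: w' :: b :: rev (z1 :: M) ++ w :: tail.
  move=> nn; move: uu'; rewrite uniq_catC cat_uniq => /and3P[_ /hasPn h _]; exact: h.
have := noE LR (out n1 (mem_head _ _)) (out n2 _); rewrite !inE eqxx orbT => /(_ isT).
move: sP; rewrite E -cat_cons catA sorted_pivot /= => /andP[_].
by case/and3P => _ ->.
Qed.

(** If [w'] has a neighbour b after [z1], [reroute] applies with N the run between b and the next
    neighbour of [w], at most two vertices by [nof3]. If [w] has a neighbour before [z], the
    reversed path exchanges the roles. If neither holds, [S2] has at most one vertex and [w] at most
    one neighbour on P. *)
Lemma no_switch P w w' S1 z z1 S2 : lpathT P -> w \notin P -> w' \notin P -> w != w' ->
  nof3 (e w) P -> nof3 (e w') P -> 1 < count (e w) P ->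
  P = S1 ++ z :: z1 :: S2 -> e w' z -> e w z1 -> False.
Proof.
have W P' v v' R1 y y1 R2 : lpathT P' -> v \notin P' -> v' \notin P' -> v != v' ->
  nof3 (e v) P' -> P' = R1 ++ y :: y1 :: R2 -> e v' y -> e v y1 -> has (e v') R2 -> False.
  move=> L vP vP' vv n3 E vy vy1 /split_first[M [b [R3 [E3 _ vb]]]].
  have n3' : nof3 (e v) R3.
    apply: (@nof3_sub _ _ (R1 ++ y :: y1 :: M ++ [:: b])).
    suff <- : P' = (R1 ++ y :: y1 :: M ++ [:: b]) ++ R3 by [].
    by rewrite E E3 -catA /= -catA.
  have [N [tail [ER st N2]]] : exists N tail, [/\ R3 = N ++ tail, sorted e (v :: tail) & size N <= 2].
    have short s : nof3 (e v) s -> ~~ has (e v) s -> size s <= 2.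
      case: s => [|a1 [|a2 [|a3 s]]] //= /andP[h _]; rewrite !negb_or => /and4P[h1 h2 h3 _].
      by move: h; rewrite (negbTE h1) (negbTE h2) (negbTE h3).
    case: (boolP (has (e v) R3)) => [/split_first[N [c [tl [EN nN vc]]]]|nh]; last first.
      by exists R3, [::]; rewrite cats0; split=> //; apply: short.
    exists N, (c :: tl); split=> //.
      have [/andP[_ +] _ _] := L; rewrite /= vc.
      have -> : P' = (R1 ++ y :: y1 :: M ++ b :: N) ++ c :: tl.
        by rewrite E E3 EN -catA /= -catA.
      by rewrite sorted_pivot => /andP[].
    apply: short nN; move: n3'; rewrite EN; clear.
    elim: N => //= a N IH /andP[h1 h2]; rewrite IH // andbT.
    by case: N h1 {IH h2} => [|? [|? ?]].
  apply: (reroute L vP vP' vv (_ : P' = R1 ++ y :: (y1 :: M) ++ b :: N ++ tail) vy vy1 vb st N2).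
  by rewrite E E3 ER.
move=> L wP wP' ww n3 n3' c2 E wz wz1.
case: (boolP (has (e w') S2)) => [h|nh]; first exact: (W P w w' _ _ _ _ L wP wP' ww n3 E wz wz1 h).
case: (boolP (has (e w) S1)) => [h|nh1].
  have Lr := lpath_rev esym L.
  have Er : rev P = rev S2 ++ z1 :: z :: rev S1.
    by rewrite E rev_cat !rev_cons -!cats1 -!catA.
  have n3r s : nof3 (e w') s -> nof3 (e w') (rev s).
    move=> g; apply: contraT => /nof3N[u1 [a1 [a2 [a3 [u2 [Es [h1 h2 h3]]]]]]].
    move: g; rewrite -(revK s) Es rev_cat !rev_cons -!cats1 -!catA => /nof3_sub /=.
    by rewrite (negbTE h1) (negbTE h2) (negbTE h3).
  rewrite eq_sym in ww.
  apply: (W (rev P) w' w _ _ _ _ Lr _ _ ww (n3r P n3') Er wz1 wz); rewrite ?mem_rev //.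
  by rewrite has_rev.
have S2s : size S2 <= 1.
  have z1n : ~~ e w' z1 by apply/negP => h; apply: (single_between esym L wP' E wz h).
  move: n3'; rewrite E -cat_rcons => /nof3_sub; rewrite /= (negbTE z1n) /=.
  case: S2 nh {E} => [|a1 [|a2 S2]] //=; rewrite !negb_or => /and3P[h1 h2 _].
  by rewrite (negbTE h1) (negbTE h2).
have zn : ~~ e w z by apply/negP => h; apply: (single_between esym L wP E h wz1).
have := single_count_suffix H L wP (etrans E (Logic.eq_sym (cat_rcons z S1 (z1 :: S2)))).
have c1 : count (e w) S1 = 0 by apply/eqP; rewrite -leqn0 leqNgt -has_count.
move: c2; rewrite E count_cat c1 [count _ (z :: _)]/= (negbTE zn) !add0n /=.
by clear -S2s; lia.
Qed.

Lemma sorted_of_pairs (R : rel T) s :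
  (forall s1 x y s2, s = s1 ++ x :: y :: s2 -> R x y) -> sorted R s.
Proof.
elim: s => // x [|y s] IH h //=; rewrite (h [::] x y s) //=.
by apply: IH => s1 u v s2 E; apply: (h (x :: s1) u v s2); rewrite E.
Qed.

Lemma single_hd P w : lpathT P -> w \notin P -> forall x s, P = x :: s -> ~~ e w x.
Proof.
move=> L wP x s E; apply/negP => wx.
by have [] := single_ends H L wP (E : P = [::] ++ x :: s) wx.
Qed.

Lemma single_lst P w : lpathT P -> w \notin P -> forall s x, P = rcons s x -> ~~ e w x.
Proof.
move=> L wP s x E; rewrite -cats1 in E; apply/negP => wx.
by have [] := single_ends H L wP E wx.
Qed.

(** By [no_switch] no two consecutive vertices of P are seen one by [w] and the other by [w'], so
    the union of the two neighbourhoods is sparse and [sparse_union_eq] applies in both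
    directions. *)
Lemma same_nbrs P w w' : lpathT P -> w \notin P -> w' \notin P ->
  nof3 (e w) P -> nof3 (e w') P -> 1 < count (e w) P -> 1 < count (e w') P ->
  {in P, e w =1 e w'}.
Proof.
move=> L wP wP' n3 n3' c2 c2'; case: (eqVneq w w') => [->//|ww].
have ww' : w' != w by rewrite eq_sym.
have sp : sparse (predU (e w) (e w')) P.
  apply: sorted_of_pairs => s1 x y s2 E; apply/negP => /andP[/orP[]h1 /orP[]h2].
  - exact: (single_between esym L wP E h1 h2).
  - exact: (no_switch L wP' wP ww' n3' n3 c2' E h1 h2).
  - exact: (no_switch L wP wP' ww n3 n3' c2 E h1 h2).
  - exact: (single_between esym L wP' E h1 h2).
have sp' : sparse (predU (e w') (e w)) P.
  by move: sp; apply: sub_sorted => x y /=; rewrite (orbC (e w x)) (orbC (e w y)).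
move=> x xP; apply/idP/idP.
  by apply: (sparse_union_eq sp' n3' (single_hd L wP) (single_lst L wP)).
by apply: (sparse_union_eq sp n3 (single_hd L wP') (single_lst L wP')).
Qed.

Lemma filter_odd_perm s : perm_eq (filter odd s ++ filter (predC odd) s) s.
Proof. by apply/permPl; exact: perm_filterC. Qed.

Lemma sumn_even s : all (predC odd) s -> sumn s = (sumn (map half s)).*2.
Proof. by elim: s => //= x s IH /andP[/= ox /IH ->]; have := odd_double_half x; clear -ox; lia. Qed.

Lemma tight_outside : exists P U, [/\ lpathT P, uniq U, (hsum ls).*2 < size U &
  {in U, forall w, [/\ w \notin P, forall y, e w y -> y \in P, count (e w) P = d & nof3 (e w) P]}].
Proof.
have [P L] := ex_lpath e [set: T]; have [pP _ _] := L; have [uP sP] := andP pP.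
have p1 := longest_ge H L; have p2 := longest_lt H pP; have k2 := hsum_gt1 H.
have F := forest_sizeE ls; have O := odd_le_hsum lal.
pose W := filter (fun w => w \notin P) (enum T).
have uW : uniq W by rewrite filter_uniq ?enum_uniq.
have WP : {in W, forall w, w \notin P} by move=> w; rewrite mem_filter => /andP[].
have sW : #|T| - size P <= size W.
  rewrite cardT /W size_filter -(count_predC (fun w => w \in P)) leq_subLR leq_add2r.
  rewrite -size_filter; apply: uniq_leq_size; first by rewrite filter_uniq ?enum_uniq.
  by move=> w; rewrite mem_filter => /andP[].
have nbP w : w \in W -> forall y, e w y -> y \in P.
  move=> wW y wy; apply: contraT => yP.
  by have := noE L (WP w wW) yP; rewrite wy.
have cP w : w \in W -> d <= count (e w) P.
  by move=> wW; apply: (deg_count H uP); apply: nbP.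
case Ep : P (p1) => [|x t] pp1; first by clear -pp1; rewrite /= in pp1; lia.
have xl w : w \in W -> e w x = false /\ e w (last x t) = false.
  move=> wW; split; apply/negbTE.
    exact: (single_hd L (WP w wW) Ep).
  by apply: (single_lst L (WP w wW) (etrans Ep (lastI x t))).
have sp w : w \in W -> sparse (e w) (x :: t).
  by move=> wW; rewrite -Ep; apply: single_sparse H _ _ L (WP w wW).
(* Without excess, a sparse set of vertices of P avoiding both ends has at most d elements, so the
   minimum degree alone makes every outside vertex tight. *)
case: (eqVneq (size P) d.*2.+1) => [p0|pn].
  exists P, W; split=> //.
    by apply: leq_trans sW; have := nT; clear -p2 F; lia.
  move=> w wW; have [h1 h2] := xl w wW; have wt := sparse_weight (sp w wW).
  have c := cP w wW; rewrite h1 h2 -[(size t).+1]/(size (x :: t)) -Ep p0 in wt.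
  have cd : count (e w) P = d by clear -wt c; lia.
  split; [exact: WP|exact: nbP|exact: cd|].
  rewrite Ep; apply: sparse_nof3 (sp w wW) _.
  by rewrite h1 h2 -[(size t).+1]/(size (x :: t)) -Ep p0 cd; clear; lia.
pose os := map half (filter odd ls); pose evs := filter (predC odd) ls.
have Kn : sumn os + sumn (map half evs) = hsum ls.
  rewrite /hsum -sumn_cat -map_cat; apply: perm_sumn; apply: perm_map; exact: filter_odd_perm.
have os1 : all (leq 1) os.
  apply/allP => h /mapP[l]; rewrite mem_filter => /andP[_ /(allP lal)/andP[l2 _]] ->.
  by clear -l2; lia.
have so : size os = count odd ls by rewrite size_map size_filter.
(* The excess is |P| - (2d + 1), because 2([sumn os + n]) - 1 = 2k - 1 = 2d + 1. *)
have [] := @greedy T e esym os (sumn (map half evs)) (size P - d.*2.+1) W P os1 sP.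
- by clear -pn p1; lia.
- by rewrite Kn; clear -p1 k2; lia.
- by rewrite so; apply: leq_trans sW; have := nT; clear -p2 F O k2; lia.
- by move=> w wW; rewrite Ep; apply: sp.
- move=> [ss [r [m1 m2 m3 m4 m5]]]; exfalso; apply: nF.
  have ev : all (predC odd) evs by rewrite filter_all.
  have [|ss' [n1 n2 n3]] := split_sorted (ls := evs) m3; first by rewrite (sumn_even ev).
  exists (ss ++ ss'); split; last 1 first.
  + have uWP : uniq (W ++ P).
      rewrite cat_uniq uW uP andbT; apply/hasPn => w wP; apply/negP => /WP.
      by rewrite wP.
    apply: (uniq_count_le uWP) => z; apply: leq_trans (m5 z).
    by rewrite flatten_cat !count_cat leq_add2l.
  + rewrite map_cat m1 n1; apply: perm_trans (filter_odd_perm ls).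
    suff -> : [seq h.*2.+1 | h <- os] = filter odd ls by [].
    rewrite /os -map_comp -[RHS]map_id; apply/eq_in_map => l; rewrite mem_filter => /andP[ol _].
    by rewrite /=; have := odd_double_half l; rewrite ol; clear; lia.
  + by rewrite all_cat m2 n2.
move=> [U [sub sU hU]]; exists P, U; split=> //.
- exact: subseq_uniq sub uW.
(* At least 2|F| - (|F| - 1) - o = 2k + 1 vertices are left over. *)
- by have := nT; clear -sU sW so p2 F; lia.
move=> w wU; have wW := mem_subseq sub wU; have [c n3] := hU w wU; have c' := cP w wW.
rewrite Kn in c n3.
have cd : count (e w) P = d by clear -c c'; lia.
split; [exact: WP|exact: nbP|exact: cd|].
by apply: n3; [rewrite cd; clear -k2; lia|exact: single_hd L (WP w wW)|exact: single_lst L (WP w wW)].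
Qed.

Lemma common_nbrs : exists (A : {set T}) (I : seq T), [/\ #|A| = d, uniq I, (hsum ls).*2 < size I &
  {in I, forall i, i \notin A /\ forall a, a \in A -> e i a}].
Proof.
have [P [U [L uU sU hU]]] := tight_outside; have [/andP[uP _] _ _] := L.
case: U uU sU hU => // w0 U uU sU hU.
have [w0P nb0 c0 n0] := hU w0 (mem_head _ _).
exists [set y in P | e w0 y], (w0 :: U); split=> //.
  rewrite -c0 -size_filter -(card_uniqP (filter_uniq _ uP)); apply: eq_card => y.
  by rewrite !inE mem_filter andbC.
move=> w wU; have [wP nb c n] := hU w wU; split.
  by rewrite inE (negbTE wP).
move=> a; rewrite inE => /andP[aP w0a].
case: (ltnP 1 d) => d1.
  by rewrite (same_nbrs L wP w0P n n0) ?c ?c0.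
(* For d = 1 there is no second neighbour, as [same_nbrs] requires. But then F has no odd component,
   |P| <= 3, and any neighbour of an outside vertex is the middle vertex of P. *)
have k2 := hsum_gt1 H; have d1' : d = 1 by clear -d1 k2; lia.
have [pP _ _] := L; have p3 : size P <= 3.
  have := longest_le H pP; have := size_odd_le lal; have := lsz; clear -d1' k2; lia.
have ends v : v \notin P -> forall y s1 s2, P = s1 ++ y :: s2 -> e v y -> size s1 = 1.
  move=> vP y s1 s2 E vy; have [e1 e2] := single_ends H L vP E vy.
  by move: p3; rewrite E size_cat /=; clear -e1 e2; lia.
have [s1 [s2 E]] := mem_split aP; have z1 := ends w0 w0P a s1 s2 E w0a.
have : has (e w) P by rewrite has_count c d1'.
case/hasP => y yP wy; have [r1 [r2 E']] := mem_split yP; have z2 := ends w wP y r1 r2 E' wy.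
by have [|_ <- _] := cat_pivot_eq _ (etrans (Logic.eq_sym E') E); first by rewrite z1.
Qed.

End Independent.
End IndependentOutside.

(** * Complete joins *)

Lemma size_filter_notin (T : eqType) (p : pred T) (s s' : seq T) : uniq s' ->
  {in s', forall y, p y} -> size s' <= count p s + size (filter (fun y => y \notin s) s').
Proof.
move=> u ps; rewrite -(count_predC (fun y => y \in s) s') size_filter leq_add2r.
rewrite -!size_filter; apply: uniq_leq_size; first by rewrite filter_uniq.
by move=> w; rewrite !mem_filter => /andP[-> /ps ->].
Qed.

Section Alternate.
Variables (T : finType) (e : rel T).
Hypothesis esym : symmetric e.

(** The lists are swapped in the recursive call, so entries alternate; a path of order n takes
    [uphalf n] entries from the first list and [n./2] from the second. *)
Fixpoint alt n (xs ys : seq T) : seq T :=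
  if n is m.+1 then (if xs is x :: xs' then x :: alt m ys xs' else [::]) else [::].

Lemma alt_size n xs ys : uphalf n <= size xs -> n./2 <= size ys -> size (alt n xs ys) = n.
Proof.
elim: n xs ys => // n IH [|x xs] ys //= h1 h2; rewrite IH //.
Qed.

Lemma alt_count n xs ys z : uphalf n <= size xs -> n./2 <= size ys ->
  count_mem z (alt n xs ys) = count_mem z (take (uphalf n) xs) + count_mem z (take n./2 ys).
Proof.
elim: n xs ys => [|n IH] [|x xs] ys //= h1 h2; rewrite ?take0 //.
by rewrite IH // addnCA addnC -addnA.
Qed.

Lemma alt_path n x (xs ys : seq T) : {in xs & ys, forall u v, e u v} -> {in xs, forall u, e x u} ->
  path e x (alt n xs ys).
Proof.
elim: n x xs ys => // n IH x [|u xs] ys // full xu; rewrite /= xu ?mem_head //=.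
apply: IH; last by move=> v vy; apply: full => //; exact: mem_head.
by move=> v w vy wx; rewrite esym; apply: full => //; rewrite in_cons wx orbT.
Qed.

Lemma alt_sorted n (xs ys : seq T) : {in xs & ys, forall u v, e u v} -> sorted e (alt n xs ys).
Proof.
case: n xs => [|n] [|x xs] // full; apply: alt_path.
  by move=> v w vy wx; rewrite esym; apply: full => //; rewrite in_cons wx orbT.
by move=> v vy; apply: full => //; exact: mem_head.
Qed.

Lemma alt_pack s (xs ys : seq T) : {in xs & ys, forall u v, e u v} ->
  sumn (map uphalf s) <= size xs -> sumn (map half s) <= size ys ->
  exists ss, [/\ map size ss = s, all (sorted e) ss &
    forall z, count_mem z (flatten ss) <= count_mem z (xs ++ ys)].
Proof.
elim: s xs ys => [|n s IH] xs ys full /= h1 h2; first by exists [::].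
have [|||ss [m1 m2 m3]] := IH (drop (uphalf n) xs) (drop n./2 ys).
- by move=> u v /mem_drop h /mem_drop h'; apply: full.
- by rewrite size_drop; lia.
- by rewrite size_drop; lia.
exists (alt n xs ys :: ss); split.
- by rewrite /= m1 alt_size //; lia.
- by rewrite /= alt_sorted.
move=> z; rewrite /= count_cat alt_count; [|lia|lia].
rewrite -[in X in _ <= X](cat_take_drop (uphalf n) xs) -[in X in _ <= X](cat_take_drop n./2 ys).
have := m3 z; rewrite !count_cat => le.
by rewrite addnACA leq_add2l.
Qed.

End Alternate.

Section JoinStructure.
Variables (T : finType) (e : rel T) (ls : seq nat).
Hypothesis H : setting e ls.
Let esym : symmetric e := g_sym H.
Let eirr : irreflexive e := g_irr H.
Let lsz : 1 < size ls := g_size H.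
Let lal : all okl ls := g_ok H.
Let cT : conn e [set: T] := g_conn H.
Let nF : ~ Fin e ls := g_free H.
Let dT : forall x, (hsum ls).-1 <= #|[set y | e x y]| := g_deg H.
Local Notation d := (hsum ls).-1.

Section Join.
Variables (A : {set T}) (I : seq T).
Hypotheses (cA : #|A| = d) (uI : uniq I) (sI : (hsum ls).*2 < size I).
Hypothesis hI : {in I, forall i, i \notin A /\ forall a, a \in A -> e i a}.

Lemma uphalf_sum s : sumn (map uphalf s) = hsum s + count odd s.
Proof. by elim: s => //= l s ->; rewrite /hsum /= uphalf_half; clear; case: (odd l); lia. Qed.

(** Alternating between [I] and [A], the components of F would need [hsum ls] vertices of [A], one
    more than there are. A path [s0] that begins one component and saves a vertex of [A] therefore
    yields F. The remaining 2j vertices of that component start at a neighbour in [A] of the last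
    vertex of [s0] and alternate. *)
Lemma special_path s0 l ls' j : pth e s0 -> s0 != [::] -> l = size s0 + j.*2 ->
  perm_eq (l :: ls') ls ->
  (0 < j -> exists2 a, a \in A & a \notin s0 /\ lk e s0 [:: a]) ->
  count (mem A) s0 + j + hsum ls' <= d ->
  size s0 + j + (hsum ls' + count odd ls') <= size I -> False.
Proof.
move=> /andP[u0 p0] n0 El pe ja hA hIs.
pose xs := filter (fun y => y \notin s0) I; pose ys := filter (fun y => y \notin s0) (enum A).
have sx : j + (hsum ls' + count odd ls') <= size xs.
  rewrite -(leq_add2l (size s0)) addnA; apply: leq_trans hIs _.
  have h := @size_filter_notin _ predT s0 I uI (fun y _ => isT); apply: leq_trans h _.
  by rewrite leq_add2r count_size.
have sy : j + hsum ls' <= size ys.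
  rewrite -(leq_add2l (count (mem A) s0)) addnA; apply: leq_trans hA _.
  rewrite -cA cardE; apply: size_filter_notin; first exact: enum_uniq.
  by move=> y; rewrite mem_enum.
have xsE w : (w \in xs) = (w \notin s0) && (w \in I) by rewrite mem_filter.
have ysE w : (w \in ys) = (w \notin s0) && (w \in A) by rewrite mem_filter mem_enum.
have full : {in xs & ys, forall u v, e u v}.
  move=> u v; rewrite xsE ysE => /andP[_ uI'] /andP[_ vA].
  by have [_] := hI uI'; apply.
have ux : uniq (s0 ++ xs ++ ys).
  have [ux uy] : uniq xs /\ uniq ys by split; rewrite filter_uniq ?enum_uniq.
  rewrite !cat_uniq u0 ux uy /= andbT; apply/andP; split.
    by apply/hasPn => w; rewrite mem_cat xsE ysE => /orP[]/andP[].
  apply/hasPn => w; rewrite xsE ysE => /andP[_ wA]; apply/negP => /andP[_ /hI[]].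
  by rewrite wA.
case: (posnP j) => [j0|jp].
  have [||ss [m1 m2 m3]] := @alt_pack _ e esym ls' xs ys full.
  - by rewrite uphalf_sum; apply: leq_trans sx; rewrite leq_addl.
  - by apply: leq_trans sy; rewrite leq_addl.
  apply: nF; exists (s0 :: ss); split.
  - by rewrite /= m1; apply: perm_trans pe; rewrite El j0 addn0.
  - by rewrite /= p0.
  - apply: (uniq_count_le ux) => z; rewrite /= !count_cat leq_add2l -count_cat; exact: m3.
have [a aA [as0 la]] := ja jp.
have ay : a \in ys by rewrite ysE as0.
have pey := perm_to_rem ay.
pose ys' := rem a ys; have sy' : size ys = (size ys').+1 by rewrite (perm_size pey).
have fa : {in a :: ys' & xs, forall u v, e u v}.
  by move=> u v uy vx; rewrite esym; apply: full => //; rewrite (perm_mem pey).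
pose p := alt j.*2 (a :: ys') xs.
have jE : uphalf j.*2 = j by rewrite uphalf_double.
have jE' : (j.*2)./2 = j by rewrite doubleK.
have [|||ss [m1 m2 m3]] := @alt_pack _ e esym ls' (drop j xs) (drop j (a :: ys')) _.
- by move=> u v /mem_drop h /mem_drop h'; rewrite esym; apply: fa.
- by rewrite uphalf_sum size_drop leq_subRL // (leq_trans _ sx) // leq_addr.
- by rewrite size_drop /= -sy' -[sumn _]/(hsum ls') leq_subRL // (leq_trans _ sy) // leq_addr.
apply: nF; exists ((s0 ++ p) :: ss); split.
- rewrite /= m1; apply: perm_trans pe; rewrite size_cat /p alt_size ?El ?jE ?jE' //=.
    by rewrite /= -sy' (leq_trans _ sy) // leq_addr.
  by rewrite (leq_trans _ sx) // leq_addr.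
- rewrite /= m2 andbT sorted_cat p0 /p (alt_sorted esym) //=.
  by case: (j) jp => // j' _; rewrite doubleS /= (lk_cons e s0 a _ [::]).
- apply: (uniq_count_le ux) => z; rewrite /= !count_cat /p alt_count ?jE ?jE'.
  + rewrite -addnA leq_add2l; apply: leq_trans (leq_add (leqnn _) (m3 z)) _.
    have /permP/(_ (pred1 z)) -> := pey.
    rewrite count_cat (addnC (count_mem z (take j (a :: ys')))) addnACA -!count_cat.
    by rewrite !cat_take_drop.
  + by rewrite /= -sy' (leq_trans _ sy) // leq_addr.
  + by rewrite (leq_trans _ sx) // leq_addr.
Qed.

(** A closed set of vertices of G - A without edges to [A] would be everything by connectedness,
    although [A] is nonempty. *)
Lemma A_nbr (C : {set T}) : C != set0 -> (forall x, x \in C -> x \notin A) -> 0 < d ->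
  (forall x y, x \in C -> e x y -> y \notin A -> y \in C) ->
  exists u a, [/\ u \in C, a \in A & e u a].
Proof.
move=> C0 CA d0 cl.
case: (boolP [exists u in C, [exists a in A, e u a]]).
  by case/existsP => u /andP[uC /existsP[a /andP[aA ua]]]; exists u, a.
move=> nex; have : C = [set: T].
  apply: cT => //; move=> x y xC _ xy; apply: (cl x) => //; apply: contra nex => yA.
  by apply/existsP; exists x; rewrite xC; apply/existsP; exists y; rewrite yA.
have /card_gt0P[a aA] : 0 < #|A| by rewrite cA.
by move=> E; have := CA a; rewrite E inE aA => /(_ isT).
Qed.

Lemma perm_front l : l \in ls -> exists ls', [/\ perm_eq (l :: ls') ls,
  hsum ls = l./2 + hsum ls' & count odd ls = odd l + count odd ls'].
Proof.
move=> /perm_to_rem pe; exists (rem l ls); split; first by rewrite perm_sym.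
  by rewrite /hsum (perm_sumn (perm_map half pe)).
by have /permP -> := pe.
Qed.

(** An even component may start with an edge off [A] and continue at a vertex of [A]; having two
    consecutive vertices off [A] it needs only [l./2 - 1] vertices of [A]. Applying [A_nbr] to the
    non-isolated vertices of G - A provides an edge with an end that sees [A]. *)
Lemma no_edge_even x y : has (fun l => ~~ odd l) ls -> x \notin A -> y \notin A -> ~~ e x y.
Proof.
case/hasP => l lls ol xA yA; apply/negP => xy; have k2 := hsum_gt1 H.
have O := odd_le_hsum lal.
pose C := [set z | (z \notin A) && [exists w, (w \notin A) && e z w]].
have [||||u [a [uC aA ua]]] := @A_nbr C.
- apply/set0Pn; exists x; rewrite inE xA; apply/existsP; exists y; by rewrite yA.
- by move=> z; rewrite inE => /andP[].
- by clear -k2; lia.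
- move=> z w; rewrite !inE => /andP[zA _] zw wA; rewrite wA; apply/existsP; exists z.
  by rewrite zA esym.
move: uC; rewrite inE => /andP[uA /existsP[v /andP[vA uv]]].
have [ls' [pe h1 h2]] := perm_front lls.
have l2 : 2 <= l by have := allP lal l lls => /andP[].
apply: (@special_path [:: v; u] l ls' (l./2).-1) => //.
- have uv' : v != u by apply: contraTneq uv => ->; rewrite eirr.
  by rewrite /pth /= inE uv' esym uv.
- by have := odd_double_half l; clear -ol l2; rewrite /=; lia.
- by move=> _; exists a => //; split=> //; rewrite !inE negb_or; apply/andP; split; [apply: contraTneq aA|apply: contraTneq aA] => ->.
- rewrite /= (negbTE uA) (negbTE vA) /=; clear -h1 l2; lia.
- apply: leq_trans sI; rewrite /=; clear -h1 h2 O l2 k2; lia.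
Qed.

Section AllOdd.
Hypothesis ao : all odd ls.

Let l := head 0 ls.
Let lls : l \in ls. Proof. by rewrite /l; move: lsz; case: (ls) => //= *; exact: mem_head. Qed.

Let hs4 : 4 <= hsum ls /\ 2 <= l./2 /\ odd l.
Proof.
have h s : all odd s -> all okl s -> (size s).*2 <= hsum s.
  elim: s => //= a s IH /andP[oa os] /andP[/andP[a2 a3] oks]; have := IH os oks.
  by rewrite /hsum /=; clear -oa a2 a3; lia.
split; first by apply: leq_trans (h ls ao lal); have := lsz; clear; lia.
have ol : odd l := allP ao l lls; split=> //.
by have /andP[l2 l3] := allP lal l lls; clear -ol l2 l3; lia.
Qed.

(** An odd component starting with three vertices off [A] has 2([l./2 - 1]) further ones, only half
    of them in [A], which saves one. *)
Lemma p3_adj x y z : x \notin A -> y \notin A -> z \notin A -> e x y -> e y z -> x != z ->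
  (exists2 a, a \in A & e z a) -> False.
Proof.
move=> xA yA zA xy yz xz [a aA za]; have [ls' [pe h1 h2]] := perm_front lls.
have [k4 [g2 ol]] := hs4; have O := odd_le_hsum lal.
have nA w : w \notin A -> a != w by move=> wA; apply: contraNneq wA => <-.
apply: (@special_path [:: x; y; z] l ls' (l./2).-1) => //.
- have n1 : x != y by apply: contraTneq xy => ->; rewrite eirr.
  have n2 : y != z by apply: contraTneq yz => ->; rewrite eirr.
  by rewrite /pth /= !inE negb_or n1 xz n2 xy yz.
- by have := odd_double_half l; rewrite ol; clear -g2; rewrite /=; lia.
- by move=> _; exists a => //; split=> //; rewrite !inE !negb_or !nA.
- rewrite /= (negbTE xA) (negbTE yA) (negbTE zA) /=; clear -h1 g2; lia.
- apply: leq_trans sI; rewrite /=; rewrite ol in h2; clear -h1 h2 O g2 k4; lia.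
Qed.

(** [C] consists of the centres of three-vertex paths off [A] and of their neighbours off [A]; some
    member v sees [A]. A neighbour of a centre is an end of such a path. If v is a centre with
    neighbour u, either u sees [A] and is such an end, or its degree, at least 3, gives another
    neighbour off [A], which makes u a centre and v an end. *)
Lemma no_p3 x y z : x \notin A -> y \notin A -> z \notin A -> e x y -> e y z -> x = z.
Proof.
move=> xA yA zA xy yz; apply/eqP; apply: contraT => xz; exfalso.
have [k4 _] := hs4.
pose ctr v := [exists u, [exists w, [&& u \notin A, v \notin A, w \notin A, e u v, e v w & u != w]]].
have ctrI u v w : u \notin A -> v \notin A -> w \notin A -> e u v -> e v w -> u != w -> ctr v.
  move=> *; apply/existsP; exists u; apply/existsP; exists w; do !(apply/andP; split=> //).
pose C := [set v | (v \notin A) && (ctr v || [exists w, [&& w \notin A, e v w & ctr w]])].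
have [||||v [a [vC aA va]]] := @A_nbr C.
- by apply/set0Pn; exists y; rewrite inE yA (ctrI x y z).
- by move=> v; rewrite inE => /andP[].
- by clear -k4; lia.
- move=> v w; rewrite !inE => /andP[vA hv] vw wA; rewrite wA /=.
  case/orP: hv => [cv|/existsP[u /and3P[uA vu cu]]].
    by apply/orP; right; apply/existsP; exists v; rewrite vA esym vw cv.
  case: (eqVneq u w) => [<-|uw]; first by rewrite cu.
  apply/orP; right; apply/existsP; exists v; rewrite vA (esym w) vw /=.
  by apply: (ctrI u v w) => //; rewrite esym.
move: vC; rewrite inE => /andP[vA /orP[cv|/existsP[w /and3P[wA vw cw]]]].
  case/existsP: cv => u /existsP[w /and5P[uA _ wA uv /andP[vw uw]]].
  case: (boolP [exists b in A, e u b]) => [/existsP[b /andP[bA ub]]|nb].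
    apply: (@p3_adj w v u) => //; rewrite 1?esym // 1?eq_sym //; by exists b.
  have [u' [u'A [uu' u'v]]] : exists u', u' \notin A /\ e u u' /\ u' != v.
    case: (boolP [exists u', [&& u' \notin A, e u u' & u' != v]]) => [/existsP[u' /and3P[]]|nex].
      by exists u'.
    exfalso; have sub : [set t | e u t] \subset [set v].
      apply/subsetP => t; rewrite !inE => ut; apply: contraT => tv.
      case: (boolP (t \in A)) => tA.
        by case/negP: nb; apply/existsP; exists t; rewrite tA.
      by case/negP: nex; apply/existsP; exists t; rewrite tA ut.
    by have := leq_trans (dT u) (subset_leq_card sub); rewrite cards1; clear -k4; lia.
  by apply: (@p3_adj u' u v) => //; [rewrite esym|exists a].
case/existsP: cw => u /existsP[t /and5P[uA _ tA uw /andP[wt ut]]].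
case: (eqVneq u v) => [uv|uv].
  apply: (@p3_adj t w v) => //; rewrite 1?esym // -?uv 1?eq_sym //; by exists a; rewrite // uv.
by apply: (@p3_adj u w v) => //; [rewrite esym|exists a].
Qed.

(** By [no_p3] each end of the two edges has at least d - 1 neighbours in [A]; since 2(d - 1) > d,
    [u] and [u'] share a neighbour a, and [v'] sees another one. The path v, u, a, u', v' has five
    vertices and only one in [A], so an odd component built on it saves one. *)
Lemma no_two_edges u v u' v' : u \notin A -> v \notin A -> u' \notin A -> v' \notin A ->
  e u v -> e u' v' -> uniq [:: v; u; u'; v'] -> False.
Proof.
move=> uA vA uA' vA' uv uv' un; have [k4 [g2 ol]] := hs4.
have [ls' [pe h1 h2]] := perm_front lls; have O := odd_le_hsum lal.
have nA x y : x \notin A -> y \notin A -> e x y -> d <= #|[set a in A | e x a]|.+1.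
  move=> xA yA xy; have := dT x => /leq_trans; apply; rewrite -addn1 -(cards1 y).
  apply: leq_trans (leq_card_setU _ _); apply/subset_leq_card/subsetP => t; rewrite !inE => xt.
  case: (boolP (t \in A)) => tA /=; first by rewrite xt.
  by apply/eqP; apply: (@no_p3 t x y) => //; rewrite esym.
have Nu := nA u v uA vA uv; have Nu' := nA u' v' uA' vA' uv'.
have Nv' : d <= #|[set a in A | e v' a]|.+1 by apply: (nA v' u') => //; rewrite esym.
have /card_gt0P[a] : 0 < #|[set a in A | e u a] :&: [set a in A | e u' a]|.
  have := cardsUI [set a in A | e u a] [set a in A | e u' a].
  have : #|[set a in A | e u a] :|: [set a in A | e u' a]| <= d.
    rewrite -cA; apply/subset_leq_card/subsetP => t; rewrite !inE.
    by case/orP => /andP[].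
  move: (#|_ :|: _|) (#|_ :&: _|) => m n; clear -Nu Nu' k4; lia.
rewrite !inE => /andP[/andP[aA ua] /andP[_ ua']].
have [b [bA bv ba]] : exists b, [/\ b \in A, e v' b & b != a].
  have : 0 < #|[set b in A | e v' b] :\ a|.
    have := cardsD1 a [set b in A | e v' b]; clear -Nv' k4; case: (a \in _) => /= E; lia.
  by case/card_gt0P => b; rewrite !inE => /and3P[ba bA vb]; exists b.
have nn w : w \notin A -> forall c, c \in A -> c != w by move=> wA c cA'; apply: contraNneq wA => <-.
apply: (@special_path [:: v; u; a; u'; v'] l ls' (l./2).-2) => //.
- rewrite /pth; apply/andP; split; last by rewrite /= (esym v) uv ua (esym a) ua' uv'.
  move: un; rewrite /= !inE !negb_or => /and4P[/and3P[-> -> ->] /andP[-> ->] -> _].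
  by rewrite !(eq_sym _ a) !nn // !(eq_sym a) !(nn _ _ a) // !andbT.
- by have := odd_double_half l; rewrite ol; clear -g2; rewrite /=; lia.
- by move=> _; exists b => //; split=> //; rewrite !inE !negb_or ba !nn.
- rewrite /= (negbTE uA) (negbTE vA) (negbTE uA') (negbTE vA') aA /=; clear -h1 g2 k4; lia.
- apply: leq_trans sI; rewrite /=; rewrite ol in h2; clear -h1 h2 O g2 k4; lia.
Qed.

Lemma one_edge u v x y : u \notin A -> v \notin A -> x \notin A -> y \notin A ->
  e u v -> e x y -> (x = u /\ y = v) \/ (x = v /\ y = u).
Proof.
move=> uA vA xA yA uv xy.
have nuv : v != u by apply: contraTneq uv => ->; rewrite eirr.
have nxy : x != y by apply: contraTneq xy => ->; rewrite eirr.
case: (eqVneq x u) => [E|xu].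
  by left; split=> //; apply: (@no_p3 y x v) => //; [rewrite esym|rewrite E].
case: (eqVneq x v) => [E|xv].
  by right; split=> //; apply: (@no_p3 y x u) => //; [rewrite esym|rewrite E esym].
case: (eqVneq y u) => [E|yu].
  by case/eqP: xv; apply: (@no_p3 x y v) => //; rewrite E.
case: (eqVneq y v) => [E|yv].
  by case/eqP: xu; apply: (@no_p3 x y u) => //; rewrite E esym.
exfalso; apply: (@no_two_edges u v x y) => //.
by rewrite /= !inE !negb_or nuv !(eq_sym _ x) !(eq_sym _ y) xu xv yu yv (eq_sym y) nxy.
Qed.

End AllOdd.
End Join.
End JoinStructure.

(** * The theorem *)

Section Embeddings.
Variable G : sgraph.
Hypotheses (sG : symmetric (@adj G)) (iG : irreflexive (@adj G)).

Lemma index_enum_inj (S : {set vert G}) x y : x \in S -> y \in S ->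
  index x (enum S) = index y (enum S) -> x = y.
Proof.
move=> xS yS E; rewrite -[x](nth_index x (_ : x \in enum S)) ?mem_enum //.
by rewrite E nth_index ?mem_enum.
Qed.

Lemma index_enum_lt (S : {set vert G}) x : (index x (enum S) < #|S|) = (x \in S).
Proof. by rewrite cardE index_mem mem_enum. Qed.

(** [A] is numbered by its enumeration. Off [A] the index equals m, so [insub] fails and [g] takes
    over. *)
Lemma subgraph_join (K : sgraph) (A : {set vert G}) m (g : vert G -> vert K) : #|A| = m ->
  (forall x y, x \notin A -> y \notin A -> g x = g y -> x = y) ->
  (forall x y, x \notin A -> y \notin A -> adj x y -> adj (g x) (g y)) ->
  subgraph G (gjoin (Kg m) K).
Proof.
move=> cA gi ge.
pose f v : vert (gjoin (Kg m) K) :=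
  if (insub (index v (enum A)) : option 'I_m) is Some i then inl i else inr (g v).
have fin v : v \in A -> exists2 i : 'I_m, f v = inl i & val i = index v (enum A).
  move=> vA; rewrite /f; case: insubP => [i _ Ei|]; first by exists i.
  by rewrite -{1}cA index_enum_lt vA.
have fout v : v \notin A -> f v = inr (g v).
  move=> vA; rewrite /f; case: insubP => // i; rewrite -{1}cA index_enum_lt.
  by rewrite (negbTE vA).
exists f; split.
- move=> x y; case: (boolP (x \in A)) => xA; case: (boolP (y \in A)) => yA.
  + have [i -> Ei] := fin x xA; have [j -> Ej] := fin y yA; case=> ij.
    by apply: (index_enum_inj xA yA); rewrite -Ei -Ej ij.
  + by have [i -> _] := fin x xA; rewrite fout.
  + by have [i -> _] := fin y yA; rewrite fout.
  + by rewrite !fout // => -[]; apply: gi.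
- move=> x y xy; case: (boolP (x \in A)) => xA; case: (boolP (y \in A)) => yA.
  + have [i -> Ei] := fin x xA; have [j -> Ej] := fin y yA => /=.
    apply: contraTneq xy => ij; suff -> : x = y by rewrite iG.
    by apply: (index_enum_inj xA yA); rewrite -Ei -Ej ij.
  + by have [i -> _] := fin x xA; rewrite fout.
  + by have [i -> _] := fin y yA; rewrite fout.
  + by rewrite !fout //; apply: ge.
Qed.

Lemma inord_index_inj (S : {set vert G}) m x y : #|S| = m.+1 -> x \in S -> y \in S ->
  inord (index x (enum S)) = inord (index y (enum S)) :> 'I_m.+1 -> x = y.
Proof.
move=> cS xS yS /(congr1 val); rewrite /= !inordK -?cS ?index_enum_lt //.
exact: index_enum_inj.
Qed.

Lemma subgraph_join_empty (A : {set vert G}) m : #|A| = m -> m < #|vert G| ->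
  (forall x y, x \notin A -> y \notin A -> ~~ adj x y) ->
  subgraph G (gjoin (Kg m) (Eg (#|vert G| - m))).
Proof.
move=> cA lt no; have : #|~: A| = #|vert G| - m by rewrite cardsCs setCK cA.
case E: (#|vert G| - m) => [|r] cC; first by move: E lt; clear; lia.
apply: (@subgraph_join (Eg r.+1) A m (fun v => inord (index v (enum (~: A)))) cA).
  by move=> x y xA yA; apply: inord_index_inj; rewrite ?inE.
by move=> x y xA yA xy; move: (no x y xA yA); rewrite xy.
Qed.

Lemma subgraph_join_edge (A : {set vert G}) m u v : #|A| = m -> m.+2 < #|vert G| ->
  u \notin A -> v \notin A -> u != v ->
  (forall x y, x \notin A -> y \notin A -> adj x y -> (x = u /\ y = v) \/ (x = v /\ y = u)) ->
  subgraph G (gjoin (Kg m) (gunion (Eg (#|vert G| - m - 2)) (Kg 2))).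
Proof.
move=> cA lt uA vA uv one; pose B := (~: A) :\ u :\ v.
have : #|B| = #|vert G| - m - 2.
  have cC : #|~: A| = #|vert G| - m by rewrite cardsCs setCK cA.
  have := cardsD1 u (~: A); have := cardsD1 v ((~: A) :\ u).
  have -> : (u \in ~: A) = true by rewrite inE.
  have -> : (v \in (~: A) :\ u) = true by rewrite !inE vA andbT eq_sym.
  by rewrite cC -/B; move: #|B| #|_ :\ u|; clear; lia.
case E: (#|vert G| - m - 2) => [|r] cB; first by move: E lt; clear; lia.
pose g w : vert (gunion (Eg r.+1) (Kg 2)) :=
  if w == u then inr ord0 else if w == v then inr ord_max else inl (inord (index w (enum B))).
apply: (@subgraph_join _ A m g cA).
- move=> x y xA yA; rewrite /g.
  case: (eqVneq x u) => [Ex|xu]; case: (eqVneq y u) => [Ey|yu].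
  + by rewrite Ex Ey.
  + by case: ifP.
  + by case: ifP.
  case: (eqVneq x v) => [Ex|xv]; case: (eqVneq y v) => [Ey|yv] //; first by rewrite Ex Ey.
  case; apply: (inord_index_inj cB); first by rewrite !inE xu xv.
  by rewrite !inE yu yv.
- move=> x y xA yA xy; case: (one x y xA yA xy) => [[-> ->]|[-> ->]]; rewrite /g !eqxx;
    by rewrite (eq_sym v) (negbTE uv).
Qed.

(** For mere containment one copy of K_(l-1) per vertex set is a convenient supply: each vertex goes
    to the copy indexed by its component in G - a. As components with fewer vertices also embed in
    K_(l-1), the second parameter can be 0. *)
Lemma subgraph_components a l : 1 < l ->
  (forall v, v != a -> #|component (@adj G) a v| < l) ->
  subgraph G (gjoin (Kg 1) (gunion (copies #|{set vert G}| (Kg (l - 1))) (copies 0 (Kg (l - 2))))).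
Proof.
move=> l1 small; case E : (l - 1) => [|r]; first by move: E l1; clear; lia.
pose f v : vert (gjoin (Kg 1) (gunion (copies #|{set vert G}| (Kg r.+1)) (copies 0 (Kg (l - 2))))) :=
  if v == a then inl ord0 else
  let C := component (@adj G) a v in inr (inl (inord (index v (enum C)), enum_rank C)).
have lt v : v != a -> index v (enum (component (@adj G) a v)) < r.+1.
  move=> va; have := small v va; have := comp_self (@adj G) a v.
  rewrite -index_enum_lt => h1 h2; apply: leq_trans h1 _.
  by move: h2 E; clear; lia.
have same v w : v != a -> w != a -> adj v w -> component (@adj G) a v = component (@adj G) a w.
  have half x y : x != a -> y != a -> adj x y -> component (@adj G) a x \subset component (@adj G) a y.
    move=> xa ya xy; apply: (@comp_sub _ (@adj G) sG a x _ y) => //.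
    - move=> u t uC ut; case: (eqVneq t a) => [->|ta]; [by right|left].
      exact: (comp_step ya uC ut ta).
    - exact: comp_self.
    - exact: (comp_step xa (comp_self _ _ _) xy ya).
  by move=> va wa vw; apply/eqP; rewrite eqEsubset !half // sG.
exists f; split.
- move=> x y; rewrite /f; case: (eqVneq x a) => [->|xa]; case: (eqVneq y a) => [->|ya] //.
  case=> /(congr1 val) + /enum_rank_inj eC; rewrite /= !inordK ?lt // eC => h.
  by apply: index_enum_inj h; rewrite -?eC ?comp_self // eC comp_self.
- move=> x y xy; rewrite /f; case: (eqVneq x a) xy => [->|xa] xy; case: (eqVneq y a) xy => [->|ya] xy //=.
    by rewrite iG in xy.
  have Exy := same x y xa ya xy; rewrite Exy eqxx /=.
  apply: contraTneq xy => /(congr1 val) /=; rewrite !inordK ?lt //; last by rewrite -Exy lt.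
  move=> h; suff -> : x = y by rewrite iG.
  by apply: index_enum_inj h; rewrite ?comp_self // -Exy comp_self.
Qed.

End Embeddings.

(** All longest paths have the same order, so quantifying over tuples of that size makes the
    alternative boolean. *)
Lemma longest_edge_dec (T : finType) (e : rel T) :
  (exists P x y, [/\ lpath e [set: T] P, x \notin P, y \notin P & e x y]) \/
  (forall P x y, lpath e [set: T] P -> x \notin P -> y \notin P -> ~~ e x y).
Proof.
have [P0 L0] := ex_lpath e [set: T].
case: (boolP [exists t : (size P0).-tuple T, pth e t &&
  [exists x, [exists y, [&& x \notin t, y \notin t & e x y]]]]).
  case/existsP => t /andP[pt /existsP[x /existsP[y /and3P[xt yt xy]]]]; left.
  by exists t, x, y; split=> //; apply: longest_lpath L0 pt _; rewrite size_tuple.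
move=> nex; right => P x y L xP yP; apply: contra nex => xy.
have sz : size P == size P0.
  have [pP _ _] := L; have [pP0 _ _] := L0.
  by rewrite eqn_leq (lpath_max L0 pP) (lpath_max L pP0).
apply/existsP; exists (Tuple sz); have [pP _ _] := L; rewrite /= pP.
by apply/existsP; exists x; apply/existsP; exists y; rewrite !memtE /= xP yP.
Qed.

Lemma conn_of_connect (T : finType) (e : rel T) : symmetric e ->
  (forall x y, connect e x y) -> conn e [set: T].
Proof.
move=> se ce X _ /set0Pn[x xX] cl; apply/setP => y; rewrite in_setT.
have clX : closed e (mem X).
  by apply: (intro_closed (sym_connect_sym se)) => u v uv uX; apply: (cl u).
by have := closed_connect clX (ce x y); rewrite /= xX => <-.
Qed.

Theorem mainTheorem3 (ls : seq nat) (G : sgraph) :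
  2 <= size ls ->
  sorted geq ls ->
  all (fun l => (2 <= l) && (l != 3)) ls ->
  simple G ->
  2 * forest_size ls <= #|vert G| ->
  gconnected G ->
  Ffree (linear_forest ls) G ->
  min_deg_ge G (deltaF ls) ->
  subgraph G (GF ls #|vert G|)
  \/ (exists l : nat, 2 <= l /\
        ((~~ odd l /\ (ls = [:: l.+1; l] \/ ls = [:: l; l]))
         \/ (odd l /\ (ls = [:: l.+2; l] \/ ls = [:: l.+1; l] \/ ls = [:: l; l; 2])))
        /\ exists t : nat, isomorphic G (gjoin (Kg 1) (copies t (Kg (l - 1)))))
  \/ (exists l : nat, 2 <= l /\ odd l /\ ls = [:: l; l] /\
        exists t1 t2 : nat,
          subgraph G (gjoin (Kg 1) (gunion (copies t1 (Kg (l - 1))) (copies t2 (Kg (l - 2))))))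
  \/ (ls = [:: 5; 5; 5] /\
        exists t : nat, isomorphic G (gjoin (Kg 2) (copies t (Kg 4)))
                     \/ isomorphic G (gjoin (Eg 2) (copies t (Kg 4)))).
Proof.
move=> sz so al [sG iG] cG conG free dG.
have S : setting (@adj G) ls.
  split=> //.
  - exact: conn_of_connect.
  - by move=> h; apply: free; apply: subgraph_of_Fin h.
have [[P [x [y [L xP yP xy]]]]|noE] := longest_edge_dec (@adj G).
  right; have [/andP[uP _] _ _] := L.
  have [u [t [St t0]]] := pth_nbr_out S uP xP yP xy.
  have [[l [a [l2 ty B]]]|[l [a [l2 lo El small]]]|[El [a [b [ab B]]]]] := outside_edge S L St t0.
  - left; exists l; split=> //; split=> //; rewrite subn1.
    apply: (@iso_blocks G (Kg 1) [set a] l.-1 (fun _ => a)) => //.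
    + by move=> i j _; rewrite (ord1 i) (ord1 j).
    + by move=> i; rewrite inE.
    + by move=> c; rewrite inE => /eqP->; exists ord0.
    + by move=> i j; rewrite iG /= (ord1 i) (ord1 j).
  - right; left; exists l; split=> //; split=> //; split=> //.
    exists #|{set vert G}|, 0; exact: subgraph_components small.
  - right; right; split=> //.
    (* [h] names the two hubs; whether they are adjacent decides between K_2 and E_2. *)
    pose h (i : 'I_2) := if i == ord0 then a else b.
    have h1 : injective h.
      move=> i j; rewrite /h; case: (eqVneq i ord0) => [Ei|i0]; case: (eqVneq j ord0) => [Ej|j0].
      + by rewrite Ei Ej.
      + by move=> E; rewrite E eqxx in ab.
      + by move=> E; rewrite E eqxx in ab.
      by move=> _; apply/val_inj; move: i j i0 j0 => [[|[|i]] hi] [[|[|j]] hj].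
    have h2 i : h i \in [set a; b] by rewrite /h !inE; case: ifP; rewrite eqxx ?orbT.
    have h3 c : c \in [set a; b] -> exists i, h i = c.
      by rewrite !inE => /orP[]/eqP->; [exists ord0|exists ord_max].
    have h4 i j : adj (h i) (h j) = (i != j) && adj a b.
      rewrite /h; case: (eqVneq i ord0) => [Ei|i0]; case: (eqVneq j ord0) => [Ej|j0].
      + by rewrite Ei Ej iG eqxx.
      + by rewrite Ei eq_sym j0.
      + by rewrite Ej i0 sG.
      by rewrite iG; move: i j i0 j0 => [[|[|i]] hi] [[|[|j]] hj].
    case ab' : (adj a b) h4 => h4.
      have [|t' It] := @iso_blocks G (Kg 2) [set a; b] 4 h sG h1 h2 h3 _ B.
        by move=> i j; rewrite h4 andbT.
      by exists t'; left.
    have [|t' It] := @iso_blocks G (Eg 2) [set a; b] 4 h sG h1 h2 h3 _ B.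
      by move=> i j; rewrite h4 andbF.
    by exists t'; right.
left; have [A [I [cA uI sI hI]]] := common_nbrs S noE.
have big : ((hsum ls).-1).+3 < #|vert G|.
  have := g_card S; have := hsum_gt1 S; have := forest_sizeE ls; clear; lia.
rewrite /GF -[deltaF ls]/((hsum ls).-1).
case: (boolP (has (fun l => ~~ odd l) ls)) => hev.
  apply: (subgraph_join_empty iG cA); first by clear -big; lia.
  by move=> x y xA yA; apply: (no_edge_even S cA uI sI hI hev xA yA).
have ao : all odd ls by apply/allP => l lin; apply/negPn; exact: (hasPn hev).
have [u [v [uA vA uv one]]] : exists u v, [/\ u \notin A, v \notin A, u != v &
    forall x y, x \notin A -> y \notin A -> adj x y -> (x = u /\ y = v) \/ (x = v /\ y = u)].
  case: (boolP [exists u, [exists v, [&& u \notin A, v \notin A & adj u v]]]).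
    case/existsP => u /existsP[v /and3P[uA vA uv]]; exists u, v; split=> //.
      by apply: contraTneq uv => ->; rewrite iG.
    by move=> x y xA yA xy; apply: (one_edge S cA uI sI hI ao uA vA xA yA uv xy).
  (* If G - A has no edge at all, any two vertices off [A] can be sent to the K_2. *)
  move=> nex; have : 1 < #|~: A| by rewrite cardsCs setCK cA; clear -big; lia.
  case/card_gt1P => u [v [+ + uv]]; rewrite !inE => uA vA; exists u, v; split=> // x y xA yA xy.
  by case/negP: nex; apply/existsP; exists x; apply/existsP; exists y; rewrite xA yA.
by apply: (subgraph_join_edge iG cA _ uA vA uv one); clear -big; lia.
Qed.
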